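(* Let $F$ be a $p$-adic field and $H\subset G$ reductive groups over $F$ such that $Y=H\backslash G$ is spherical, and assume the local conjecture of Sakellaridis–Venkatesh, so that canonical local periods $Z_\sigma$ and spherical characters $J_\sigma$ are defined for all irreducible unitary $\sigma$ appearing in the Plancherel decomposition of $L^2(Y(F))$. Let $E$ be a field embeddable into $\mathbb{C}$, $R$ a finitely generated reduced (Noetherian) $E$-algebra, $\Sigma\subset X=\mathrm{Spec}(R)$ a Zariski dense set of closed points, and $\pi$ a finitely generated smooth admissible torsion-free $R[G(F)]$-module with $\mathcal{E}(\pi|_x)\ne\emptyset$ for all $x\in\Sigma$. (a) When $R=E$, the rationality statement (P1) for canonical local periods implies the rationality statement (S1) for spherical characters. (b) For general $R$, the meromorphy statement (P2) for canonical local periods implies the meromorphy statement (S2) for spherical characters, for those $\pi$ such that for every open compact subgroup $K\subset G(F)$ the function $$\phi_{\pi^K}: X\to\mathbb{N},\qquad x\mapsto \dim_{k(x)}(\pi^K|_x)$$ is locally constant on $\Sigma$. Here the statements (P1), (P2), (S1), (S2) are those formulated in the context.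
   Context: Modules. An $R[G(F)]$-module $\pi$ is smooth if every element is fixed by some open compact subgroup; admissible if $\pi^K$ is a finitely generated $R$-module for every compact open subgroup $K\subset G(F)$; finitely generated if it is so over $R[G(F)]$; torsion-free if it is torsion-free over $R$. For $x\in X$ with residue field $k(x)$, $M|_x=M\otimes_R k(x)$ for any $R$-module $M$; for a field embedding $\tau:k(x)\to\mathbb{C}$, $(\pi|_x)_\tau=\pi|_x\otimes_{k(x),\tau}\mathbb{C}$. For $x\in\Sigma$, $\mathcal{E}(\pi|_x)$ is the set of field embeddings $\tau:k(x)\to\mathbb{C}$ such that $(\pi|_x)_\tau$ is irreducible and appears in the Plancherel decomposition of $L^2(Y(F))$. $\mathrm{Frac}\,R$ is the total ring of fractions. All measures on $F$-points of $F$-groups are Haar measures giving rational volumes to open compact subgroups. Canonical local periods and spherical characters. Let $\sigma$ be a complex irreducible unitary $G(F)$-representation appearing in the Plancherel decomposition of $L^2(Y(F))$, with contragredient $\sigma^\vee$ and a non-degenerate $G(F)$-invariant pairing $(\cdot,\cdot)$ on $\sigma\times\sigma^\vee$. The local conjecture of Sakellaridis–Venkatesh provides a canonical local period $Z_\sigma(\cdot,\cdot):\sigma\times\sigma^\vee\to\mathbb{C}$, an element of $\mathrm{Hom}_{H(F)\times H(F)}(\sigma\otimes\sigma^\vee,\mathbb{C})$, depending on $(\cdot,\cdot)$ and scaling linearly with it. For a field $L$, $\mathcal{S}(G(F),L)$ denotes the Hecke algebra of locally constant compactly supported $L$-valued functions on $G(F)$ and $\mathcal{H}(K,L)$ its subspace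 of bi-$K$-invariant functions. The spherical character is $J_\sigma:\mathcal{S}(G(F),\mathbb{C})\to\mathbb{C}$, $J_\sigma(f)=\sum_iZ_\sigma(\sigma(f)\varphi_i,\varphi^i)$ for $f\in\mathcal{H}(K,\mathbb{C})$, where $\{\varphi_i\}$, $\{\varphi^i\}$ are bases of $\sigma^K$, $\sigma^{\vee,K}$ with $(\varphi_i,\varphi^j)=\delta_{ij}$, and $\sigma(f)\varphi=\int_{G(F)}f(g)\sigma(g)\varphi\,dg$; it is independent of $(\cdot,\cdot)$. Statements about canonical local periods. These concern a $\pi$ as in the claim for which there exists a finitely generated smooth admissible torsion-free $R[G(F)]$-module $\tilde\pi$ with a $G(F)$-invariant $R$-bilinear pairing $(\cdot,\cdot):\pi\times\tilde\pi\to R$ which for every $x\in\Sigma$ induces a non-degenerate $G(F)$-invariant pairing $(\cdot,\cdot)|_x:\pi|_x\times\tilde\pi|_x\to k(x)$. (P1) For any $x\in\Sigma$ there exists a unique bi-$H(F)$-invariant pairing $Z_{\pi|_x}:\pi|_x\times\tilde\pi|_x\to k(x)$ such that for any $\tau\in\mathcal{E}(\pi|_x)$, $\tau(Z_{\pi|_x}(v,\tilde v))=Z_{(\pi|_x)_\tau}(v\otimes1,\tilde v\otimes 1)$ for all $v\in\pi|_x$, $\tilde v\in\tilde\pi|_x$, where $Z_{(\pi|_x)_\tau}$ is defined using the linear extension of $(\cdot,\cdot)|_x$. (P2) After shrinking $\mathrm{Spec}(R)$ to an open subset containing $\Sigma$, there exists a bi-$H(F)$-invariant $R$-bilinear pairing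 $Z_\pi:\pi\times\tilde\pi\to R$ whose specialization at each $x\in\Sigma$ is the pairing $Z_{\pi|_x}$ of (P1). Statements about spherical characters. (S1) For any $x\in\Sigma$ there exists a unique $k(x)$-linear functional $J_{\pi|_x}:\mathcal{S}(G(F),k(x))\to k(x)$ such that $\tau(J_{\pi|_x}(f))=J_{(\pi|_x)_\tau}(\tau\circ f)$ for all $\tau\in\mathcal{E}(\pi|_x)$ and all $f$. (S2) For any $f\in\mathcal{S}(G(F),E)$ there exists a unique meromorphic function $J_\pi(f)\in\mathrm{Frac}\,R$ interpolating $J_{\pi|_x}(f)$, $x\in\Sigma$, i.e. regular at each $x\in\Sigma$ with value $J_{\pi|_x}(f)$, where $J_{\pi|_x}$ is the functional of (S1). *)

(* Defs.v *)
Set Warnings "-notation-overridden,-ambiguous-paths,-notation-incompatible-prefix".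
From HB Require Import structures.
From mathcomp Require Import all_boot all_order all_algebra.
From mathcomp Require Import mxpoly ring_quotient generic_quotient complex ring.
From mathcomp Require Import all_classical all_reals all_analysis measurable_realfun.
From mathcomp.multinomials Require mpoly.

Set Implicit Arguments.
Unset Strict Implicit.
Unset Printing Implicit Defensive.

Import Order.TTheory GRing.Theory Num.Theory.
Local Open Scope classical_set_scope.
Local Open Scope ring_scope.
Local Open Scope quotient_scope.

Section Tensor.
Variables (R L : comNzRingType) (chi : {rmorphism R -> L}) (M : lmodType R).

Definition balanced (U : zmodType) (b : M -> L -> U) : Prop :=
  [/\ forall m m' a, b (m + m') a = b m a + b m' a,
      forall m a a', b m (a + a') = b m a + b m a' &
      forall r m a, b (r *: m) a = b m (chi r * a)].

Definition tens_equiv (s t : seq (M * L)) : bool :=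
  `[< forall (U : zmodType) (b : M -> L -> U), balanced b ->
      \sum_(p <- s) b p.1 p.2 = \sum_(p <- t) b p.1 p.2 >].

Lemma tens_equiv_is_equiv : equiv_class_of tens_equiv.
Proof.
split=> [s|s t|t s u].
- exact/asboolP.
- by apply/asboolP/asboolP => h U b bb; rewrite h.
- by move=> /asboolP h1 /asboolP h2; apply/asboolP => U b bb; rewrite h1 ?h2.
Qed.

Canonical tens_equiv_equiv := EquivRelPack tens_equiv_is_equiv.
Canonical tens_equiv_encModRel := defaultEncModRel tens_equiv.

(** [tens] is [M ⊗_R L], with [L] an [R]-algebra through [chi]. *)
Definition tens := {eq_quot tens_equiv}.
HB.instance Definition _ : EqQuotient _ tens_equiv tens := EqQuotient.on tens.
HB.instance Definition _ := Choice.on tens.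

Definition tens_pure (m : M) (a : L) : tens := \pi_tens [:: (m, a)].

Lemma tens_eqP (s t : seq (M * L)) :
  (forall (U : zmodType) (b : M -> L -> U), balanced b ->
      \sum_(p <- s) b p.1 p.2 = \sum_(p <- t) b p.1 p.2) <->
  \pi_tens s = \pi_tens t.
Proof.
split=> [h|/eqquotP/asboolP //]; first by apply/eqquotP/asboolP.
Qed.

Lemma tens_repr (s : seq (M * L)) (U : zmodType) (b : M -> L -> U) : balanced b ->
  \sum_(p <- repr (\pi_tens s)) b p.1 p.2 = \sum_(p <- s) b p.1 p.2.
Proof. by move: U b; apply/tens_eqP; rewrite reprK. Qed.

Lemma balancedN (U : zmodType) (b : M -> L -> U) : balanced b ->
  forall m a, b (- m) a = - b m a.
Proof.
case=> h _ _ m a; apply/eqP; rewrite -addr_eq0 -h addNr.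
by rewrite -(subrr (b 0 a)) -{2}(addr0 0) h addrK.
Qed.

Definition tens_zero : tens := \pi_tens [::].
Definition tens_add (t u : tens) : tens := \pi_tens (repr t ++ repr u).
Definition tens_opp (t : tens) : tens :=
  \pi_tens [seq (- p.1, p.2) | p <- repr t].
Definition tens_scale (a : L) (t : tens) : tens :=
  \pi_tens [seq (p.1, a * p.2) | p <- repr t].

Lemma tens_addA : associative tens_add.
Proof.
move=> x y z; apply/tens_eqP => U b bb.
by rewrite !big_cat /= !tens_repr // !big_cat /= addrA.
Qed.
Lemma tens_addC : commutative tens_add.
Proof. by move=> x y; apply/tens_eqP => U b bb; rewrite !big_cat /= addrC. Qed.
Lemma tens_add0 : left_id tens_zero tens_add.
Proof.
move=> x; rewrite -[RHS]reprK; apply/tens_eqP => U b bb.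
by rewrite big_cat /= tens_repr // big_nil add0r.
Qed.
Lemma tens_addN : left_inverse tens_zero tens_opp tens_add.
Proof.
move=> x; apply/tens_eqP => U b bb.
rewrite big_cat /= tens_repr // big_map big_nil -big_split /= big1 // => p _.
by rewrite balancedN // addNr.
Qed.
HB.instance Definition _ :=
  GRing.isZmodule.Build tens tens_addA tens_addC tens_add0 tens_addN.

Lemma balanced_scale (U : zmodType) (b : M -> L -> U) a : balanced b ->
  balanced (fun m c => b m (a * c)).
Proof.
case=> h1 h2 h3; split=> [m m' c|m c c'|r m c]; first exact: h1.
- by rewrite mulrDr h2.
- by rewrite h3 mulrCA.
Qed.

Lemma tens_scaleA a c x :
  tens_scale a (tens_scale c x) = tens_scale (a * c) x.
Proof.
apply/tens_eqP => U b bb; rewrite !big_map /=.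
rewrite (tens_repr _ (balanced_scale a bb)) big_map /=.
by apply: eq_bigr => p _; rewrite mulrA.
Qed.
Lemma tens_scale1 : left_id 1 tens_scale.
Proof.
move=> x; rewrite -[RHS]reprK; apply/tens_eqP => U b bb; rewrite big_map.
by apply: eq_bigr => p _; rewrite mul1r.
Qed.
Lemma tens_scaleDr : right_distributive tens_scale +%R.
Proof.
move=> a x y; apply/tens_eqP => U b bb.
rewrite big_cat /= !tens_repr // !big_map (tens_repr _ (balanced_scale a bb)).
by rewrite big_cat.
Qed.
Lemma tens_scaleDl x : {morph tens_scale^~ x : a c / a + c}.
Proof.
move=> a c; apply/tens_eqP => U b bb.
rewrite big_cat /= !tens_repr // !big_map -big_split /=.
by apply: eq_bigr => p _; rewrite mulrDl; case: bb => _ -> _.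
Qed.
HB.instance Definition _ := GRing.Zmodule_isLmodule.Build L tens
  tens_scaleA tens_scale1 tens_scaleDr tens_scaleDl.

End Tensor.

Section TensorMap.
Variables (R L : comNzRingType) (chi : {rmorphism R -> L}) (M N : lmodType R).

Definition tens_map (f : M -> M) (t : tens chi M) : tens chi M :=
  \pi_(tens chi M) [seq (f p.1, p.2) | p <- repr t].

Lemma balanced_map (f : M -> M) (U : zmodType) (b : M -> L -> U) : linear f ->
  balanced chi b -> balanced chi (fun m c => b (f m) c).
Proof.
move=> lf [h1 h2 h3]; split=> [m m' c|m c c'|r m c]; last 2 first.
- exact: h2.
- have f0 : f 0 = 0 by move: (lf (-1) 0 0); rewrite scaleN1r oppr0 addr0 scaleN1r addNr.
  by rewrite -[r *: m]addr0 lf f0 addr0 h3.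
- by rewrite -h1 -[m in LHS]scale1r lf scale1r.
Qed.

Lemma tens_map_linear (f : M -> M) : linear f -> linear (tens_map f).
Proof.
move=> lf a x y; rewrite /tens_map.
apply/tens_eqP => U b bb; rewrite big_map /=.
rewrite (tens_repr _ (balanced_map lf bb)) !big_cat /=.
rewrite (tens_repr _ (balanced_map lf bb)) !big_map !tens_repr // !big_map /=.
rewrite (tens_repr _ (balanced_scale a bb)) !big_map.
by congr (_ + _).
Qed.

Lemma tens_map_id (f : M -> M) : f =1 id -> tens_map f =1 id.
Proof.
move=> fid t; rewrite -[RHS]reprK; apply/tens_eqP => U b bb; rewrite big_map.
by apply: eq_bigr => p _; rewrite fid.
Qed.

Lemma tens_map_comp (f g h : M -> M) : linear f -> f \o g =1 h ->
  forall t, tens_map h t = tens_map f (tens_map g t).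
Proof.
move=> lf fg t; apply/tens_eqP => U b bb; rewrite !big_map /=.
rewrite (tens_repr _ (balanced_map lf bb)) big_map.
by apply: eq_bigr => p _; rewrite -fg.
Qed.

(** The [L]-bilinear extension of an [R]-bilinear pairing. *)
Definition tens_pairing (p : M -> N -> R) (t : tens chi M) (u : tens chi N) : L :=
  \sum_(x <- repr t) \sum_(y <- repr u) chi (p x.1 y.1) * (x.2 * y.2).

End TensorMap.

Section TotalFractions.
Variable R : comNzRingType.

Definition ratio := {p : R * R | `[< GRing.lreg p.2 >]}.
Implicit Types x y z : ratio.

Definition rnum x : R := (val x).1.
Definition rden x : R := (val x).2.

Lemma rden_reg x : GRing.lreg (rden x).
Proof. by apply/asboolP; exact: (valP x). Qed.
Arguments rden_reg : clear implicits.

Definition mk_ratio (a s : R) (hs : GRing.lreg s) : ratio :=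
  exist _ (a, s) (introT (asboolP _) hs).

Definition ratio_equiv x y : bool := rnum x * rden y == rnum y * rden x.

Lemma ratio_equiv_is_equiv : equiv_class_of ratio_equiv.
Proof.
split=> [x|x y|y x z]; rewrite /ratio_equiv; first exact: eqxx.
  by rewrite eq_sym.
move=> /eqP h1 /eqP h2; apply/eqP; apply: (rden_reg y) => /=.
by rewrite mulrA [rden y * _]mulrC h1 mulrAC h2; ring.
Qed.

Canonical ratio_equiv_equiv := EquivRelPack ratio_equiv_is_equiv.
Canonical ratio_equiv_encModRel := defaultEncModRel ratio_equiv.

(** The total ring of fractions: numerators over non-zero-divisors. *)
Definition total_frac := {eq_quot ratio_equiv}.
HB.instance Definition _ : EqQuotient _ ratio_equiv total_frac :=
  EqQuotient.on total_frac.
HB.instance Definition _ := Choice.on total_frac.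

Lemma total_frac_eqP x y :
  \pi_total_frac x = \pi_total_frac y <-> rnum x * rden y = rnum y * rden x.
Proof. by split=> [/eqquotP/eqP|h]; last by apply/eqquotP/eqP. Qed.

Lemma lregM (a b : R) : GRing.lreg a -> GRing.lreg b -> GRing.lreg (a * b).
Proof. by move=> ha hb c d; rewrite -!mulrA => /ha/hb. Qed.

Definition radd x y : ratio :=
  mk_ratio (rnum x * rden y + rnum y * rden x) (lregM (rden_reg x) (rden_reg y)).
Definition rmul x y : ratio :=
  mk_ratio (rnum x * rnum y) (lregM (rden_reg x) (rden_reg y)).
Definition ropp x : ratio := mk_ratio (- rnum x) (rden_reg x).
Definition rconst (a : R) : ratio := mk_ratio a (@lreg1 R).

Lemma ratioE :
  (((forall x y, (rnum (radd x y) = rnum x * rden y + rnum y * rden x)%R) *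
    (forall x y, (rden (radd x y) = rden x * rden y)%R)) *
   ((forall x y, (rnum (rmul x y) = rnum x * rnum y)%R) *
    (forall x y, (rden (rmul x y) = rden x * rden y)%R)) *
   ((forall x, (rnum (ropp x) = - rnum x)%R) * (forall x, rden (ropp x) = rden x)) *
   ((forall a, rnum (rconst a) = a) * (forall a, (rden (rconst a) = 1)%R)))%type.
Proof. by []. Qed.

Definition frac_add (X Y : total_frac) : total_frac :=
  \pi_total_frac (radd (repr X) (repr Y)).
Definition frac_mul (X Y : total_frac) : total_frac :=
  \pi_total_frac (rmul (repr X) (repr Y)).
Definition frac_opp (X : total_frac) : total_frac :=
  \pi_total_frac (ropp (repr X)).

Lemma repr_frac x : rnum (repr (\pi_total_frac x)) * rden x =
  rnum x * rden (repr (\pi_total_frac x)).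
Proof. by apply/total_frac_eqP; rewrite reprK. Qed.

Lemma frac_addE x y :
  frac_add (\pi_total_frac x) (\pi_total_frac y) = \pi_total_frac (radd x y).
Proof.
apply/total_frac_eqP; move: (repr_frac x) (repr_frac y).
set x' := repr _; set y' := repr _ => hx hy; rewrite !ratioE.
have -> : (rnum x' * rden y' + rnum y' * rden x') * (rden x * rden y) =
  (rnum x' * rden x) * (rden y' * rden y) + (rnum y' * rden y) * (rden x' * rden x) by ring.
rewrite hx hy; ring.
Qed.

Lemma frac_mulE x y :
  frac_mul (\pi_total_frac x) (\pi_total_frac y) = \pi_total_frac (rmul x y).
Proof.
apply/total_frac_eqP; move: (repr_frac x) (repr_frac y).
set x' := repr _; set y' := repr _ => hx hy; rewrite !ratioE.
by rewrite mulrACA hx hy mulrACA.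
Qed.

Lemma frac_oppE x : frac_opp (\pi_total_frac x) = \pi_total_frac (ropp x).
Proof.
apply/total_frac_eqP; move: (repr_frac x).
set x' := repr _ => hx; rewrite !ratioE.
by rewrite !mulNr hx.
Qed.

Let frac0 := \pi_total_frac (rconst 0).
Let frac1 := \pi_total_frac (rconst 1).

Lemma frac_addA : associative frac_add.
Proof.
elim/quotW=> x; elim/quotW=> y; elim/quotW=> z.
rewrite (frac_addE y z) (frac_addE x y) !frac_addE.
apply/total_frac_eqP; rewrite !ratioE; ring.
Qed.
Lemma frac_addC : commutative frac_add.
Proof.
elim/quotW=> x; elim/quotW=> y; rewrite (frac_addE x y) (frac_addE y x).
apply/total_frac_eqP; rewrite !ratioE; ring.
Qed.
Lemma frac_add0 : left_id frac0 frac_add.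
Proof.
elim/quotW=> x; rewrite frac_addE.
apply/total_frac_eqP; rewrite !ratioE; ring.
Qed.
Lemma frac_addN : left_inverse frac0 frac_opp frac_add.
Proof.
elim/quotW=> x; rewrite (frac_oppE x) frac_addE.
apply/total_frac_eqP; rewrite !ratioE; ring.
Qed.
HB.instance Definition _ :=
  GRing.isZmodule.Build total_frac frac_addA frac_addC frac_add0 frac_addN.

Lemma frac_mulA : associative frac_mul.
Proof.
elim/quotW=> x; elim/quotW=> y; elim/quotW=> z.
rewrite (frac_mulE y z) (frac_mulE x y) !frac_mulE.
apply/total_frac_eqP; rewrite !ratioE; ring.
Qed.
Lemma frac_mulC : commutative frac_mul.
Proof.
elim/quotW=> x; elim/quotW=> y; rewrite (frac_mulE x y) (frac_mulE y x).
apply/total_frac_eqP; rewrite !ratioE; ring.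
Qed.
Lemma frac_mul1 : left_id frac1 frac_mul.
Proof.
elim/quotW=> x; rewrite frac_mulE.
apply/total_frac_eqP; rewrite !ratioE; ring.
Qed.
Lemma frac_mulD : left_distributive frac_mul +%R.
Proof.
elim/quotW=> x; elim/quotW=> y; elim/quotW=> z.
change (frac_mul (frac_add (\pi_total_frac x) (\pi_total_frac y)) (\pi_total_frac z) =
  frac_add (frac_mul (\pi_total_frac x) (\pi_total_frac z))
           (frac_mul (\pi_total_frac y) (\pi_total_frac z))).
rewrite (frac_addE x y) (frac_mulE x z) (frac_mulE y z) frac_mulE frac_addE.
apply/total_frac_eqP; rewrite !ratioE; ring.
Qed.
Lemma frac_1neq0 : frac1 != 0.
Proof.
apply/eqP => /total_frac_eqP; rewrite !ratioE !mulr1 => /eqP.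
by rewrite oner_eq0.
Qed.
HB.instance Definition _ := GRing.Zmodule_isComNzRing.Build total_frac
  frac_mulA frac_mulC frac_mul1 frac_mulD frac_1neq0.

Definition to_frac (a : R) : total_frac := \pi_total_frac (rconst a).

Lemma to_frac_zmod_morphism : zmod_morphism to_frac.
Proof.
move=> a b; change (to_frac (a - b) = frac_add (to_frac a) (frac_opp (to_frac b))).
by rewrite /to_frac frac_oppE frac_addE; apply/total_frac_eqP; rewrite !ratioE; ring.
Qed.
Lemma to_frac_monoid_morphism : monoid_morphism to_frac.
Proof.
split=> // a b; change (to_frac (a * b) = frac_mul (to_frac a) (to_frac b)).
by rewrite /to_frac frac_mulE; apply/total_frac_eqP; rewrite !ratioE; ring.
Qed.
HB.instance Definition _ :=
  GRing.isZmodMorphism.Build R total_frac to_frac to_frac_zmod_morphism.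
HB.instance Definition _ :=
  GRing.isMonoidMorphism.Build R total_frac to_frac to_frac_monoid_morphism.

End TotalFractions.

Section ClosedPoints.
Variable R : comNzRingType.

(** Points of [Spec R] *)
Record prime_point := PrimePoint {
  pp_ideal :> R -> bool;
  pp_idealr : idealr_closed pp_ideal;
  pp_prime : prime_idealr_closed pp_ideal
}.

Record closed_point := ClosedPoint {
  cp_point :> prime_point;
  cp_max : forall J : R -> bool, idealr_closed J ->
    (forall a, cp_point a -> J a) -> (forall a, J a -> cp_point a)
}.

Definition cp_ideal (x : closed_point) : R -> bool := x.
HB.instance Definition _ (x : closed_point) :=
  isIdealr.Build R (cp_ideal x) (pp_idealr x).

Variable x : closed_point.

Definition residue_field := {ideal_quot (cp_ideal x : idealr R)}.
HB.instance Definition _ := GRing.ComNzRing.on residue_field.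

Definition residue : R -> residue_field := \pi_{ideal_quot (cp_ideal x : idealr R)}.
HB.instance Definition _ := GRing.RMorphism.on residue.

Lemma residue_eq0 a : (residue a == 0) = (a \in (cp_ideal x : {pred R})).
Proof. by rewrite -(rmorph0 residue) -Quotient.idealrBE subr0. Qed.

Lemma residue_inv_ex (y : residue_field) : y != 0 -> exists z, z * y == 1.
Proof.
rewrite -[y]reprK -/(residue _) residue_eq0; set a := repr y => ha.
have [//|noinv] := pselect (exists z, z * residue a == 1).
pose J : R -> bool := fun b => `[< exists c, (b - c * a) \in (cp_ideal x : {pred R}) >].
have JP b : reflect (exists c, (b - c * a) \in (cp_ideal x : {pred R})) (b \in (J : {pred R})) by exact: asboolP.
have hJ : idealr_closed J.
  split.
  - by apply/JP; exists 0; rewrite mul0r subr0 rpred0.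
  - apply/negP => /JP[c hc]; apply: noinv; exists (residue c).
    by rewrite -rmorphM -(rmorph1 residue) eq_sym -Quotient.idealrBE.
  - move=> r u v /JP[c hc] /JP[d hd]; apply/JP; exists (r * c + d).
    have -> : r * u + v - (r * c + d) * a = r * (u - c * a) + (v - d * a) by ring.
    by rewrite rpredD // idealMr.
have sub b : cp_ideal x b -> J b.
  by move=> hb; apply/JP; exists 0; rewrite mul0r subr0.
have /(cp_max hJ sub) : J a by apply/JP; exists 1; rewrite mul1r subrr rpred0.
by move=> h; move: ha; rewrite /in_mem /= /cp_ideal h.
Qed.

Definition residue_inv (y : residue_field) : residue_field :=
  if pselect (exists z, z * y == 1) is left h then xchoose h else 0.

Lemma residue_mulVf y : y != 0 -> residue_inv y * y = 1.
Proof.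
move=> /residue_inv_ex h; rewrite /residue_inv; case: pselect => // h'.
exact/eqP/(xchooseP h').
Qed.
Lemma residue_inv0 : residue_inv 0 = 0.
Proof.
rewrite /residue_inv; case: pselect => // h; move: (xchooseP h).
by rewrite mulr0 eq_sym oner_eq0.
Qed.
HB.instance Definition _ :=
  GRing.ComNzRing_isField.Build residue_field residue_mulVf residue_inv0.

End ClosedPoints.

(** A [p]-adic field, given as a field of characteristic zero complete for a
    normalised discrete valuation with finite residue field. The value of
    [pf_val] at [0] carries no information. *)
Definition val_ge (K : fieldType) (v : K -> int) (m : int) (a : K) : Prop :=
  a = 0 \/ m <= v a.

Record padicField := PadicField {
  pf_sort :> fieldType;
  pf_val : pf_sort -> int;
  pf_char0 : [pchar pf_sort] =i pred0;
  pf_valM : forall a b, a != 0 -> b != 0 -> pf_val (a * b) = pf_val a + pf_val b;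
  pf_valD : forall a b, a != 0 -> b != 0 -> a + b != 0 ->
    Num.min (pf_val a) (pf_val b) <= pf_val (a + b);
  pf_uniformizer : exists a, a != 0 /\ pf_val a = 1;
  pf_complete : forall u : nat -> pf_sort,
    (forall m, exists N, forall i j, (N <= i)%N -> (N <= j)%N ->
       val_ge pf_val m (u i - u j)) ->
    exists l, forall m, exists N, forall i, (N <= i)%N -> val_ge pf_val m (u i - l);
  pf_residue_finite : exists s : seq pf_sort, forall a, val_ge pf_val 0 a ->
    exists2 b, b \in s & val_ge pf_val 1 (a - b)
}.

Section AlgebraicGroups.
Variables (F : fieldType) (Fbar : closedFieldType) (iota : {rmorphism F -> Fbar}).
Variable n : nat.
Local Notation mx := 'M[Fbar]_n.

(** The common zeros in [GL_n(Fbar)] of a set of polynomials in the [n * n]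
    matrix entries, with coefficients in a field mapping to [Fbar]. *)
Definition zero_locus (K : fieldType) (f : K -> Fbar)
    (eqs : set (mpoly.mpoly (n * n) K)) : set mx :=
  [set g | g \in unitmx /\
           forall p, eqs p -> mpoly.mmap f (fun k => mxvec g 0 k) p = 0].

Record is_subgroup (A : set mx) : Prop := {
  sg_unit : A `<=` [set g | g \in unitmx];
  sg_one : A 1%:M;
  sg_mul : forall g h, A g -> A h -> A (g *m h);
  sg_inv : forall g, A g -> A (invmx g)
}.

(** Linear algebraic [F]-groups. In characteristic zero such a group is
    determined by its [Fbar]-points, a subgroup of [GL_n(Fbar)] cut out by
    polynomials over [F]. *)
Record algGroup := AlgGroup {
  ag_pts :> set mx;
  ag_group : is_subgroup ag_pts;
  ag_defined : exists eqs, ag_pts = zero_locus iota eqs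
}.

Definition zclosed (A : set mx) : Prop := exists eqs, A = zero_locus idfun eqs.

Definition zconnected (A : set mx) : Prop :=
  forall B C, zclosed B -> zclosed C -> A = B `|` C -> B `&` C = set0 ->
    B = set0 \/ C = set0.

Definition solvable_set (A : set mx) : Prop :=
  exists (S : nat -> set mx) (k : nat),
    [/\ S 0%N = A, S k = [set 1%:M], forall i, is_subgroup (S i) &
        forall i g h, S i g -> S i h ->
          S i.+1 (invmx g *m invmx h *m g *m h)].

Definition unipotent_set (A : set mx) : Prop :=
  forall g, A g -> (g - 1%:M) ^+ n = 0.

Definition normal_in (A B : set mx) : Prop :=
  A `<=` B /\ forall g h, A g -> B h -> A (invmx h *m g *m h).

Definition reductive (A : set mx) : Prop :=
  forall U, is_subgroup U -> zclosed U -> zconnected U -> unipotent_set U ->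
    normal_in U A -> U = [set 1%:M].

Definition connected_solvable (A B : set mx) : Prop :=
  [/\ is_subgroup B, zclosed B, zconnected B, solvable_set B & B `<=` A].

Definition borel_of (A B : set mx) : Prop :=
  connected_solvable A B /\
  forall B', connected_solvable A B' -> B `<=` B' -> B' `<=` B.

(** [H \ G] is spherical: a Borel subgroup has an open orbit; the orbit of
    [H x] is open iff its preimage [H x B] is open in [G]. *)
Definition spherical (H G : set mx) : Prop :=
  exists B x, [/\ borel_of G B, G x &
    exists2 C, zclosed C &
      [set h *m x *m b | h in H & b in B] = G `\` C].

End AlgebraicGroups.

(** Groups with a topology, without compatibility axioms; only used for the
    groups [G(F)] below, where compatibility holds. *)
#[short(type="preTopGroupType")]
HB.structure Definition PreTopologicalGroup := {T of Group T & PointedTopological T}.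

Section RationalPoints.
Variables (F : padicField) (Fbar : closedFieldType) (iota : {rmorphism F -> Fbar}).
Variables (n : nat) (G : algGroup iota n).

(** [G(F)], with the topology of entrywise convergence. *)
Definition points := {g : 'M[F]_n | `[< ag_pts G (map_mx iota g) >]}.
HB.instance Definition _ := Choice.on points.
Implicit Types g h : points.

Definition pt_val g : 'M[F]_n := val g.

Lemma pt_in g : ag_pts G (map_mx iota (pt_val g)).
Proof. by apply/asboolP; exact: (valP g). Qed.

Lemma pt_unit g : pt_val g \in unitmx.
Proof. by rewrite -(map_unitmx iota); apply: (sg_unit (ag_group G)); exact: pt_in. Qed.

Definition pt_mk (a : 'M[F]_n) (h : ag_pts G (map_mx iota a)) : points :=
  exist _ a (introT (asboolP _) h).

Fact pt_one_subproof : ag_pts G (map_mx iota 1%:M).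
Proof. by rewrite map_mx1; exact: sg_one (ag_group G). Qed.
Fact pt_mul_subproof g h : ag_pts G (map_mx iota (pt_val g *m pt_val h)).
Proof. by rewrite map_mxM; apply: (sg_mul (ag_group G)); exact: pt_in. Qed.
Fact pt_inv_subproof g : ag_pts G (map_mx iota (invmx (pt_val g))).
Proof. by rewrite map_invmx; apply: (sg_inv (ag_group G)); exact: pt_in. Qed.

Definition pt_one := pt_mk pt_one_subproof.
Definition pt_mul g h := pt_mk (pt_mul_subproof g h).
Definition pt_inv g := pt_mk (pt_inv_subproof g).

Fact pt_mulA : associative pt_mul.
Proof. by move=> g h k; apply: val_inj; rewrite /= mulmxA. Qed.
Fact pt_mul1 : left_id pt_one pt_mul.
Proof. by move=> g; apply: val_inj; rewrite /= mul1mx. Qed.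
Fact pt_1mul : right_id pt_one pt_mul.
Proof. by move=> g; apply: val_inj; rewrite /= mulmx1. Qed.
Fact pt_mulV : left_inverse pt_one pt_inv pt_mul.
Proof. by move=> g; apply: val_inj; rewrite /= mulVmx // pt_unit. Qed.
Fact pt_Vmul : right_inverse pt_one pt_inv pt_mul.
Proof. by move=> g; apply: val_inj; rewrite /= mulmxV // pt_unit. Qed.
HB.instance Definition _ := isGroup.Build points pt_mulA pt_mul1 pt_1mul pt_mulV pt_Vmul.
HB.instance Definition _ := isPointed.Build points pt_one.

Definition pt_near (m : int) g h : Prop :=
  forall i j, val_ge (@pf_val F) m (pt_val h i j - pt_val g i j).

Definition pt_open : set_system points :=
  [set U | forall g, U g -> exists m, forall h, pt_near m g h -> U h].

Fact pt_openT : pt_open setT.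
Proof. by move=> g _; exists 0. Qed.
Fact pt_openI : setI_closed pt_open.
Proof.
move=> U V hU hV g [/hU[m hm] /hV[k hk]]; exists (Num.max m k) => h gh.
split; [apply: hm|apply: hk] => i j; case: (gh i j) => [e|le]; first 1 [by left].
- by right; apply: le_trans le; rewrite le_max lexx.
- by left.
- by right; apply: le_trans le; rewrite le_max lexx orbT.
Qed.
Fact pt_open_bigU (I : Type) (f : I -> set points) :
  (forall i, pt_open (f i)) -> pt_open (\bigcup_i f i).
Proof.
move=> hf g [i _ /(hf i)[m hm]]; exists m => h gh; exists i => //; exact: hm.
Qed.
HB.instance Definition _ :=
  @isOpenTopological.Build points pt_open pt_openT pt_openI pt_open_bigU.

End RationalPoints.

Section GModules.
Variables (gT : preTopGroupType).
Implicit Types (K : set gT).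

Record open_compact_subgroup K : Prop := {
  ocs_open : open K;
  ocs_compact : compact K;
  ocs_one : K 1%g;
  ocs_mul : forall g h, K g -> K h -> K (g * h)%g;
  ocs_inv : forall g, K g -> K (g^-1)%g
}.

(** [R[G]]-modules. *)
Record gmodule (R : comNzRingType) := GModule {
  gm_sort :> lmodType R;
  gm_act : gT -> gm_sort -> gm_sort;
  gm_act_linear : forall g, linear (gm_act g);
  gm_act1 : forall v, gm_act 1%g v = v;
  gm_actM : forall g h v, gm_act (g * h)%g v = gm_act g (gm_act h v)
}.

Section Conditions.
Variables (R : comNzRingType) (M : gmodule R).

Definition lin_span (V : lmodType R) (s : seq V) : set V :=
  [set v | exists c : nat -> R, v = \sum_(i < size s) c i *: s`_i].

Definition fixed K : {pred M} :=
  [pred v | `[< forall k, K k -> gm_act k v = v >]].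

Definition smooth : Prop :=
  forall v : M, exists2 K, open_compact_subgroup K & v \in fixed K.

Definition admissible : Prop := forall K, open_compact_subgroup K ->
  exists s : seq M, [set v | v \in fixed K] = lin_span s.

Definition finitely_generated : Prop := exists s : seq M, forall v,
  exists gs : seq gT, lin_span [seq gm_act g w | g <- gs, w <- s] v.

Definition torsion_free : Prop :=
  forall (r : R) (v : M), GRing.lreg r -> r *: v = 0 -> v = 0.

Definition irreducible : Prop := (exists v : M, v != 0) /\
  forall W : set M, W 0 -> (forall a v w, W v -> W w -> W (a *: v + w)) ->
    (forall g v, W v -> W (gm_act g v)) -> W = [set 0] \/ W = setT.

End Conditions.
Arguments fixed {R} M K.

(** [M^K] as an [R]-module. *)
Section Invariants.
Variables (R : comNzRingType) (M : gmodule R) (K : set gT).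

Fact fixed_submod_closed : submod_closed (fixed M K).
Proof.
split=> [|a v w /asboolP hv /asboolP hw].
  apply/asboolP => k _; move: (@gm_act_linear _ M k (-1) 0 0).
  by rewrite scaleN1r oppr0 addr0 scaleN1r addNr.
by apply/asboolP => k hk; rewrite gm_act_linear hv ?hw.
Qed.
HB.instance Definition _ :=
  GRing.isSubmodClosed.Build R M (fixed M K) fixed_submod_closed.

Definition invariants := {v : M | v \in fixed M K}.
HB.instance Definition _ := SubChoice.on invariants.
HB.instance Definition _ := [SubChoice_isSubLmodule of invariants by <:].
End Invariants.

Section BaseChange.
Variables (R L : comNzRingType) (chi : {rmorphism R -> L}) (M : gmodule R).

Fact gm_ext_act1 (t : tens chi M) : tens_map (gm_act 1%g) t = t.
Proof. by apply: tens_map_id => v; rewrite gm_act1. Qed.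
Fact gm_ext_actM g h (t : tens chi M) : tens_map (gm_act (g * h)%g) t =
  tens_map (gm_act g) (tens_map (gm_act h) t).
Proof.
apply: tens_map_comp => [|v]; first exact: gm_act_linear.
by rewrite /= gm_actM.
Qed.

(** [M ⊗_R L] with [g (m ⊗ a) = g m ⊗ a]. *)
Definition gm_ext : gmodule L := GModule
  (fun g => tens_map_linear (@gm_act_linear _ M g)) gm_ext_act1 gm_ext_actM.
End BaseChange.

Definition gm_iso (L : comNzRingType) (V W : gmodule L) (u : V -> W) : Prop :=
  [/\ linear u, bijective u & forall g v, u (gm_act g v) = gm_act g (u v)].

Section Pairings.
Variables (R : comNzRingType).

Definition bilinear_map (V W : lmodType R) (S : comNzRingType)
    (f : {rmorphism R -> S}) (p : V -> W -> S) : Prop :=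
  (forall a v v' w, p (a *: v + v') w = f a * p v w + p v' w) /\
  (forall a v w w', p v (a *: w + w') = f a * p v w + p v w').

Definition bi_invariant (H : set gT) (V W : gmodule R) (S : Type)
    (p : V -> W -> S) : Prop :=
  forall h h' v w, H h -> H h' -> p (gm_act h v) (gm_act h' w) = p v w.

Definition invariant_pairing (V W : gmodule R) (S : Type) (p : V -> W -> S) :=
  forall g v w, p (gm_act g v) (gm_act g w) = p v w.

Definition nondegenerate (V W : lmodType R) (p : V -> W -> R) : Prop :=
  (forall v, (forall w, p v w = 0) -> v = 0) /\
  (forall w, (forall v, p v w = 0) -> w = 0).
End Pairings.

(** [W], with the pairing [p], is the contragredient of [V]. *)
Definition contragredient (L : fieldType) (V W : gmodule L) (p : V -> W -> L) :=
  [/\ smooth W, admissible W, bilinear_map idfun p, invariant_pairing p &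
      nondegenerate p].

(** [S(G, L)]: locally constant compactly supported functions. *)
Definition hecke_fun (L : nzRingType) (f : gT -> L) : Prop :=
  (forall g, \forall h \near g, f h = f g) /\
  compact (closure [set g | f g != 0]).

Definition bi_invariant_fun (L : Type) K (f : gT -> L) : Prop :=
  forall k k' g, K k -> K k' -> f (k * g * k')%g = f g.

Section Haar.
Variables (RT : realType).

Definition borel_type := g_sigma_algebraType (@open gT).

(** A left Haar measure giving rational volumes to open compact subgroups
    (left and right Haar measures agree on the groups considered). *)
Record rational_haar (mu : {measure set borel_type -> \bar RT}) : Prop := {
  haar_inv : forall (g : gT) (A : set borel_type), measurable A ->
    mu [set (g * a)%g | a in (A : set gT)] = mu A;
  haar_compact : forall K, compact K -> (mu K < +oo)%E;
  haar_open : forall U : set gT, open U -> U !=set0 -> (0 < mu U)%E;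
  haar_rational : forall K, open_compact_subgroup K ->
    exists q : rat, mu K = (ratr q)%:E
}.

Variable mu : {measure set borel_type -> \bar RT}.

(** The rational number [mu K]. *)
Definition vol K : rat := xget 0 [set q | mu K = (ratr q)%:E].

(** [∫_G phi(g) dg] for [phi] locally constant with compact support and values
    in an [L]-vector space, [L] of characteristic zero: for [K] such that [phi]
    is right [K]-invariant it is [∑ vol(K) phi(g)] over the cosets [g K] meeting
    the support, of which [s] is a list of representatives. *)
Definition haar_integral (L : fieldType) (V : lmodType L) (phi : gT -> V) : V :=
  xget 0 [set w | exists K (s : seq gT),
    [/\ open_compact_subgroup K,
        forall g k, K k -> phi (g * k)%g = phi g,
        forall g, phi g != 0 -> exists2 a, a \in s & K (a^-1 * g)%g,
        pairwise (fun a b => `[< ~ K (a^-1 * b)%g >]) s &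
        w = \sum_(a <- s) ratr (vol K) *: phi a]].

Definition hecke_act (L : fieldType) (V : gmodule L) (f : gT -> L) (v : V) : V :=
  haar_integral (fun g => f g *: gm_act g v).

End Haar.

Definition is_basis (L : fieldType) (V : lmodType L) (W : set V) n
    (e : 'I_n -> V) : Prop :=
  [/\ forall i, W (e i),
      forall v, W v -> exists c : 'I_n -> L, v = \sum_i c i *: e i &
      forall c : 'I_n -> L, \sum_i c i *: e i = 0 -> forall i, c i = 0].

(** Only meaningful for finite-dimensional spaces. *)
Definition vdim (L : fieldType) (V : lmodType L) : nat :=
  xget 0%N [set d | exists e : 'I_d -> V, is_basis setT e].

End GModules.
Arguments fixed {gT R} M K.
Arguments invariants {gT R} M K.

Section PlancherelDecomposition.
Variables (F : padicField) (Fbar : closedFieldType) (iota : {rmorphism F -> Fbar}).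
Variables (n : nat) (G H : algGroup iota n) (RT : realType).
Local Notation C := (complex RT).
Local Notation GF := (points G).
Local Notation mx := 'M[Fbar]_n.

(** [H(F)] as a subset of [G(F)]. *)
Definition sub_points : set GF := [set h : GF | ag_pts H (map_mx iota (pt_val h))].

(** The preimage in [G(Fbar)] of [Y(F)], [Y = H \ G]: the [t] such that the coset
    [H t] is fixed by every automorphism of [Fbar] over [F]. *)
Definition Y_points : set mx := [set t | ag_pts G t /\
  forall s : {rmorphism Fbar -> Fbar}, (forall a, s (iota a) = iota a) ->
    ag_pts H (map_mx s t *m invmx t)].

(** [C_c^∞(Y(F))], as functions on [Y_points] extended by zero. The orbits of
    [G(F)] on [Y(F)] are open and carry the quotient topology of [G(F)], so such a
    function is one which is right invariant under some open compact [K] and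
    supported on finitely many [K]-orbits. *)
Definition Y_schwartz (phi : mx -> C) : Prop :=
  [/\ forall t, ~ Y_points t -> phi t = 0,
      forall h t, ag_pts H h -> phi (h *m t) = phi t &
      exists2 K : set GF, open_compact_subgroup K &
        (forall t k, K k -> phi (t *m map_mx iota (pt_val k)) = phi t) /\
        exists s : seq mx, forall t, phi t != 0 -> exists t0 h k,
          [/\ t0 \in s, ag_pts H h, K k &
              t = h *m t0 *m map_mx iota (pt_val k)]].

Definition Y_translate (g : GF) (phi : mx -> C) : mx -> C :=
  fun t => phi (t *m map_mx iota (pt_val g)).

(** Integration against a [G(F)]-invariant Radon measure of full support on
    [Y(F)], as a positive functional on [C_c^∞(Y(F))]. *)
Record Y_measure (m : (mx -> C) -> C) : Prop := {
  Ym_linear : forall a phi psi, Y_schwartz phi -> Y_schwartz psi ->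
    m (fun t => a * phi t + psi t) = a * m phi + m psi;
  Ym_pos : forall phi, Y_schwartz phi -> (forall t, 0 <= phi t) ->
    (exists t, phi t != 0) -> 0 < m phi;
  Ym_inv : forall g phi, Y_schwartz phi -> m (Y_translate g phi) = m phi
}.

Record invariant_inner_product (V : gmodule GF C) (ip : V -> V -> C) : Prop := {
  ip_linear : forall a v v' w, ip (a *: v + v') w = a * ip v w + ip v' w;
  ip_sym : forall v w, ip w v = (ip v w)^*;
  ip_pos : forall v, v != 0 -> 0 < ip v v;
  ip_inv : forall g v w, ip (gm_act g v) (gm_act g w) = ip v w
}.

(** Irreducible unitary representations are given through their spaces of smooth
    vectors. *)
Definition irreducible_unitary (V : gmodule GF C) : Prop :=
  [/\ smooth V, admissible V, irreducible V &
      exists ip : V -> V -> C, invariant_inner_product ip].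

(** A Plancherel decomposition of [L^2(Y(F))]: a measured family of irreducible
    unitary representations [pl_rep w], with for every [w] a non-zero
    equivariant map [(pl_map w i)_i] from [C_c^∞(Y(F))] to a (countable, possibly
    infinite) multiple of [pl_rep w], such that [|phi|^2] is the integral over
    [w] of the norms [\sum_i |pl_map w i phi|^2]. *)
Record plancherel := Plancherel {
  pl_int : (mx -> C) -> C;
  pl_int_measure : Y_measure pl_int;
  pl_disp : measure_display;
  pl_space : measurableType pl_disp;
  pl_measure : {measure set pl_space -> \bar RT};
  pl_sigma_finite : sigma_finite setT pl_measure;
  pl_rep : pl_space -> gmodule GF C;
  pl_irreducible : forall w, irreducible_unitary (pl_rep w);
  pl_ip : forall w, pl_rep w -> pl_rep w -> C;
  pl_ipP : forall w, invariant_inner_product (@pl_ip w);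
  pl_map : forall w, nat -> (mx -> C) -> pl_rep w;
  pl_map_linear : forall w i a phi psi, Y_schwartz phi -> Y_schwartz psi ->
    pl_map w i (fun t => a * phi t + psi t) = a *: pl_map w i phi + pl_map w i psi;
  pl_map_equiv : forall w i g phi, Y_schwartz phi ->
    pl_map w i (Y_translate g phi) = gm_act g (pl_map w i phi);
  pl_map_neq0 : forall w, exists i phi, Y_schwartz phi /\ pl_map w i phi != 0;
  pl_norm : (mx -> C) -> pl_space -> \bar RT := fun phi w =>
    (\sum_(0 <= i <oo) (complex.Re (pl_ip (pl_map w i phi) (pl_map w i phi)))%:E)%E;
  pl_measurable : forall phi, Y_schwartz phi -> measurable_fun setT (pl_norm phi);
  pl_formula : forall phi, Y_schwartz phi ->
    (complex.Re (pl_int (fun t => phi t * (phi t)^*)))%:E =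
    (\int[pl_measure]_w pl_norm phi w)%E
}.

Arguments pl_rep : clear implicits.

Variable D : plancherel.

(** [V] is a representation appearing in the decomposition. *)
Definition appears (V : gmodule GF C) : Prop :=
  exists w (u : V -> pl_rep D w), gm_iso u.

(** The canonical local periods provided by the local conjecture of Sakellaridis
    and Venkatesh: for [V] appearing in the Plancherel decomposition, [W] its
    contragredient and [p] the pairing, [lp_Z p] is the canonical period. It is
    attached canonically to [(V, W, p)], hence compatible with isomorphisms. *)
Record local_periods := LocalPeriods {
  lp_Z : forall V W : gmodule GF C, (V -> W -> C) -> V -> W -> C;
  lp_bilinear : forall (V W : gmodule GF C) (p : V -> W -> C), appears V ->
    contragredient p -> bilinear_map idfun (lp_Z p);
  lp_invariant : forall (V W : gmodule GF C) (p : V -> W -> C), appears V ->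
    contragredient p -> bi_invariant sub_points (lp_Z p);
  lp_scale : forall (V W : gmodule GF C) (p : V -> W -> C) (a : C), appears V ->
    contragredient p -> a != 0 ->
    forall v w, lp_Z (fun v' w' => a * p v' w') v w = a * lp_Z p v w;
  lp_iso : forall (V W V' W' : gmodule GF C) (p : V -> W -> C) (p' : V' -> W' -> C)
      (u : V -> V') (u' : W -> W'), appears V -> contragredient p ->
    gm_iso u -> gm_iso u' -> (forall v w, p' (u v) (u' w) = p v w) ->
    forall v w, lp_Z p' (u v) (u' w) = lp_Z p v w
}.

Variable Z : local_periods.
Variable mu : {measure set (borel_type GF) -> \bar RT}.

(** [J_V(f) = \sum_i Z_V(V(f) e_i, e^i)] for dual bases [e_i], [e^i] of [V^K] and
    [W^K], with [f] bi-[K]-invariant; the value depends neither on [K], nor on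
    the contragredient [(W, p)], nor on the bases. *)
Definition spherical_character (V : gmodule GF C) (f : GF -> C) : C :=
  xget 0 [set c | exists K (W : gmodule GF C) (p : V -> W -> C) (d : nat)
      (e : 'I_d -> V) (e' : 'I_d -> W),
    [/\ open_compact_subgroup K /\ bi_invariant_fun K f, contragredient p,
        is_basis [set v | v \in fixed V K] e /\ is_basis [set w | w \in fixed W K] e',
        forall i j, p (e i) (e' j) = (i == j)%:R &
        c = \sum_i lp_Z Z p (hecke_act mu f (e i)) (e' i)]].

End PlancherelDecomposition.
Arguments sub_points {F Fbar iota n} G H.

Section Claims.
Variables (F : padicField) (Fbar : closedFieldType) (iota : {rmorphism F -> Fbar}).
Variables (n : nat) (G H : algGroup iota n) (RT : realType).
Local Notation C := (complex RT).
Local Notation GF := (points G).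
Variables (D : plancherel G H RT) (Z : local_periods D).
Variable mu : {measure set (borel_type GF) -> \bar RT}.
Variables (E : fieldType) (R : comAlgType E).
Implicit Types (Sigma : set (closed_point R)) (x : closed_point R).
Implicit Type M : gmodule GF R.

Definition finitely_generated_algebra : Prop := exists s : seq R,
  forall A : set R, (forall a, a \in s -> A a) -> (forall a : E, A (a%:A)) ->
    (forall a b, A a -> A b -> A (a + b) /\ A (a * b)) -> A = setT.

Definition reduced_ring : Prop := forall (a : R) k, a ^+ k = 0 -> a = 0.

Definition noetherian : Prop := forall I : set R,
  I 0 -> (forall a b c, I b -> I c -> I (a * b + c)) ->
  exists s : seq R, I = lin_span (s : seq R^o).

(** Every non-empty open subset of [Spec R] meets [Sigma]. *)
Definition zariski_dense Sigma : Prop :=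
  forall a : R, (exists P : prime_point R, ~~ P a) ->
    exists2 x, Sigma x & ~~ x a.

(** [M|_x] *)
Definition fiber M x : gmodule GF (residue_field x) := gm_ext (residue x) M.
Definition fiber_elt M x (v : M) : fiber M x := tens_pure (residue x) v 1.
Definition fiber_pairing M (M' : gmodule GF R) (p : M -> M' -> R) x : fiber M x -> fiber M' x -> residue_field x :=
  @tens_pairing _ _ (residue x) M M' p.

(** [(M|_x)_tau] *)
Definition cfiber M x (tau : {rmorphism residue_field x -> C}) : gmodule GF C :=
  gm_ext tau (fiber M x).

(** The set [E(M|_x)]. *)
Definition embeddings M x (tau : {rmorphism residue_field x -> C}) : Prop :=
  irreducible (cfiber M tau) /\ appears D (cfiber M tau).

Record setting Sigma M : Prop := {
  set_fg_algebra : finitely_generated_algebra;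
  set_reduced : reduced_ring;
  set_noetherian : noetherian;
  set_dense : zariski_dense Sigma;
  set_finitely_generated : finitely_generated M;
  set_smooth : smooth M;
  set_admissible : admissible M;
  set_torsion_free : torsion_free M;
  set_embeddings : forall x, Sigma x -> exists tau, @embeddings M x tau
}.

(** The auxiliary module and pairing of the statements on local periods. *)
Record dual_datum Sigma M (M' : gmodule GF R) (p : M -> M' -> R) : Prop := {
  dual_finitely_generated : finitely_generated M';
  dual_smooth : smooth M';
  dual_admissible : admissible M';
  dual_torsion_free : torsion_free M';
  dual_bilinear : bilinear_map idfun p;
  dual_invariant : invariant_pairing p;
  dual_nondegenerate : forall x, Sigma x -> nondegenerate (@fiber_pairing M M' p x)
}.

(** [Zx] is the pairing [Z_(M|_x)]. *)
Definition fiber_period M (M' : gmodule GF R) (p : M -> M' -> R) x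
    (Zx : fiber M x -> fiber M' x -> residue_field x) : Prop :=
  [/\ bilinear_map idfun Zx, bi_invariant (sub_points G H) Zx &
      forall tau, @embeddings M x tau -> forall v v',
        tau (Zx v v') =
        lp_Z Z (V := cfiber M tau) (W := cfiber M' tau)
          (@tens_pairing _ _ tau (fiber M x) (fiber M' x) (@fiber_pairing M M' p x))
          (tens_pure tau v 1) (tens_pure tau v' 1)].

Definition rationality_of_periods Sigma M : Prop :=
  forall (M' : gmodule GF R) (p : M -> M' -> R), dual_datum Sigma p -> forall x, Sigma x ->
    exists Zx, fiber_period p Zx /\
      forall Zx', @fiber_period M M' p x Zx' -> forall v v', Zx' v v' = Zx v v'.

(** [q] is regular at [x], with value [c]. *)
Definition has_value x (q : total_frac R) (c : residue_field x) : Prop :=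
  exists a b : R, [/\ ~~ x b, to_frac b * q = to_frac a &
    c = residue x a / residue x b].

Definition regular_at (P : prime_point R) (q : total_frac R) : Prop :=
  exists a b : R, ~~ P b /\ to_frac b * q = to_frac a.

(** An open subset of [Spec R] is a union of basic open sets [b != 0], [b] in [A].
    For [R] reduced and [U] a dense open subset, the ring [O(U)] consists of the
    total fractions regular at every point of [U], and a pairing over [U] with
    values in the structure sheaf amounts to an [R]-bilinear pairing with values in
    [O(U)]. *)
Definition in_open (A : set R) (P : prime_point R) : Prop := exists2 b, A b & ~~ P b.

Definition meromorphy_of_periods Sigma M : Prop :=
  forall (M' : gmodule GF R) (p : M -> M' -> R), dual_datum Sigma p ->
  exists (A : set R) (ZM : M -> M' -> total_frac R),
    [/\ forall x, Sigma x -> in_open A x,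
        forall P, in_open A P -> forall v v', regular_at P (ZM v v'),
        bilinear_map (@to_frac R) ZM,
        bi_invariant (sub_points G H) ZM &
        forall x, Sigma x -> exists2 Zx, @fiber_period M M' p x Zx &
          forall v v', has_value (ZM v v') (Zx (fiber_elt x v) (fiber_elt x v'))].

(** [Jx] is the functional [J_(M|_x)]. *)
Definition fiber_character M x
    (Jx : (GF -> residue_field x) -> residue_field x) : Prop :=
  (forall a f f', hecke_fun f -> hecke_fun f' ->
     Jx (fun g => a * f g + f' g) = a * Jx f + Jx f') /\
  forall tau f, @embeddings M x tau -> hecke_fun f ->
    tau (Jx f) = spherical_character Z mu (cfiber M tau) (tau \o f).

Definition rationality_of_characters Sigma M : Prop :=
  forall x, Sigma x -> exists Jx, @fiber_character M x Jx /\
    forall Jx', @fiber_character M x Jx' -> forall f, hecke_fun f -> Jx' f = Jx f.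

Definition interpolates_character Sigma M (f : GF -> E) (q : total_frac R) : Prop :=
  forall x, Sigma x -> exists2 Jx, @fiber_character M x Jx &
    has_value q (Jx (fun g => residue x ((f g)%:A))).

Definition meromorphy_of_characters Sigma M : Prop :=
  forall f : GF -> E, hecke_fun f ->
    exists q, interpolates_character Sigma M f q /\
      forall q', interpolates_character Sigma M f q' -> q' = q.

(** The function [phi_(M^K)]: the dimension of [M^K ⊗_R k(x)], not of [(M|_x)^K]. *)
Definition fiber_dim M (K : set GF) x : nat :=
  vdim (tens (residue x) (invariants M K)).

Definition locally_constant_fiber_dim Sigma M : Prop :=
  forall K : set GF, open_compact_subgroup K -> forall x, Sigma x ->
    exists2 b : R, ~~ x b & forall y, Sigma y -> ~~ y b ->
      fiber_dim M K y = fiber_dim M K x.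

End Claims.

(* Main.v *)
Require Import Defs.
From HB Require Import structures.
From mathcomp Require Import all_boot all_order all_algebra.
From mathcomp Require Import mxpoly complex finmap ring zify ring_quotient generic_quotient.
From mathcomp Require Import all_classical all_reals all_analysis.

Set Implicit Arguments.
Unset Strict Implicit.
Unset Printing Implicit Defensive.

Import Order.TTheory GRing.Theory Num.Theory.
Local Open Scope classical_set_scope.
Local Open Scope ring_scope.

(** Fix a point [x] of [Sigma] and a function [f] that is invariant on both sides under
    an open compact subgroup [K]. The spherical character of [f] at [x] is
    [\sum_i Z(f e_i, e'_i)] for dual bases [e], [e'] of the [K]-invariants of [M|_x] and
    of its contragredient. When the period and the contragredient are defined over
    [k(x)], so is this sum. It does not depend on [K], on the bases or on the
    contragredient ([character_sum_unique], [spherical_characterE]), so that every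
    embedding of [k(x)] maps it to the complex spherical character
    ([fiber_character_ofP]); embeddings being injective, this determines it.

    The hypotheses on periods quantify over the auxiliary modules [M'] with a pairing
    [p], so such a pair has to be constructed ([dual_datum_ex]). The smooth [R]-linear
    dual of [M] need not visibly be finitely generated; [M'] is its submodule generated
    by the functionals invariant under one group [K0] that fixes generators of [M]. As
    [R] is Noetherian, [M'] is finitely generated and admissible. What remains is that
    [p] is non-degenerate at each [x] in [Sigma]. Since [R] is reduced, [Sigma] is dense
    and the fibre dimension of [M^K] is locally constant on [Sigma], the module [M^K] is
    free near [x], with coordinate functionals ([locally_free], [local_basis_ex]).
    Hence some functional in [M'] is not zero at [x], and the left kernel of [p] at [x]
    vanishes because the complexified fibre of [M] is irreducible
    ([left_nondegenerate]). So the [K]-invariants of [M'] contain functionals dual at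
    [x] to a basis of [M^K]; they span these invariants near [x] by Cramer's rule, and
    the right kernel vanishes as well ([right_nondegenerate]).

    If [R] is a field, [Sigma] is a single point, the condition on fibre dimensions is
    empty, and the first part follows. In general, a basis of [M^K] near [x] and
    functionals dual to it at [x] have an invertible Gram matrix near [x], so the
    dual bases at the nearby points of [Sigma] are specializations of one family with
    denominator the Gram determinant. With periods that are values of fractions, this
    makes the spherical character near [x] the value of a fraction
    ([character_locally_regular]). To glue these, consider the ideal of all
    denominators of the function [x |-> J_x(f)]: no point of [Sigma] contains it, so its
    annihilator is zero, and in a reduced Noetherian ring it then contains a
    non-zero-divisor ([ideal_regular_element], [glue_values]). Uniqueness holds because
    an element of [R] that vanishes on [Sigma] is zero ([dense_vanish]). *)

(** * Small open compact subgroups of G(F) *)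

(** These three facts are all that the arguments below use of the topology of
    [G(F)]. *)
Record small_subgroups (gT : preTopGroupType) : Prop := {
  ss_mull : forall (g : gT) (U : set gT), open U -> open [set h | U (g * h)%g];
  ss_mulr : forall (g : gT) (U : set gT), open U -> open [set h | U (h * g)%g];
  ss_small : forall (U K : set gT), open U -> U 1%g -> open_compact_subgroup K ->
    exists K', open_compact_subgroup K' /\ K' `<=` U `&` K
}.

Section Valuation.
Variable F : padicField.
Local Notation vge := (val_ge (@pf_val F)).

Lemma pf_val1 : pf_val (1 : F) = 0.
Proof.
have := pf_valM (oner_neq0 F) (oner_neq0 F); rewrite mulr1 => /eqP.
by rewrite -subr_eq0 opprD addrA subrr sub0r oppr_eq0 => /eqP.
Qed.

Lemma pf_valN (a : F) : a != 0 -> pf_val (- a) = pf_val a.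
Proof.
have n1 : -1 != 0 :> F by rewrite oppr_eq0 oner_neq0.
move=> a0; rewrite -mulN1r pf_valM //.
have := pf_valM n1 n1; rewrite mulrNN mulr1 pf_val1 -mulr2n => /esym/eqP.
by rewrite -mulr_natl mulf_eq0 /= => /eqP ->; rewrite add0r.
Qed.

Lemma vge_le m k a : k <= m -> vge m a -> vge k a.
Proof. by move=> km [->|h]; [left|right; apply: le_trans h]. Qed.

Lemma vge0 m : vge m 0. Proof. by left. Qed.

Lemma vgeN m a : vge m a -> vge m (- a).
Proof.
have [->|a0] := eqVneq a 0; first by rewrite oppr0.
case=> [/eqP|h]; first by rewrite (negPf a0).
by right; rewrite pf_valN.
Qed.

Lemma vgeD m a b : vge m a -> vge m b -> vge m (a + b).
Proof.
have [->|a0] := eqVneq a 0; first by rewrite add0r.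
have [->|b0] := eqVneq b 0; first by rewrite addr0.
case=> [/eqP|ha]; first by rewrite (negPf a0).
case=> [/eqP|hb]; first by rewrite (negPf b0).
have [->|ab] := eqVneq (a + b) 0; first by left.
by right; apply: le_trans (pf_valD a0 b0 ab); rewrite le_min ha.
Qed.

Lemma vgeM m k a b : vge m a -> vge k b -> vge (m + k) (a * b).
Proof.
have [->|a0] := eqVneq a 0; first by rewrite mul0r; left.
have [->|b0] := eqVneq b 0; first by rewrite mulr0; left.
case=> [/eqP|ha]; first by rewrite (negPf a0).
case=> [/eqP|hb]; first by rewrite (negPf b0).
by right; rewrite pf_valM // lerD.
Qed.

Lemma vge_sum m (I : Type) (r : seq I) (P : pred I) (f : I -> F) :
  (forall i, P i -> vge m (f i)) -> vge m (\sum_(i <- r | P i) f i).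
Proof. by move=> h; elim/big_ind: _ => //; [exact: vge0|move=> *; exact: vgeD]. Qed.

Definition mx_vge n (m : int) (A : 'M[F]_n) : Prop := forall i j, vge m (A i j).

Lemma mx_vge_le n m k (A : 'M[F]_n) : k <= m -> mx_vge m A -> mx_vge k A.
Proof. by move=> km h i j; apply: vge_le (h i j). Qed.

Lemma mx_vgeD n m (A B : 'M[F]_n) : mx_vge m A -> mx_vge m B -> mx_vge m (A + B).
Proof. by move=> hA hB i j; rewrite mxE; apply: vgeD. Qed.

Lemma mx_vgeN n m (A : 'M[F]_n) : mx_vge m A -> mx_vge m (- A).
Proof. by move=> hA i j; rewrite mxE; apply: vgeN. Qed.

Lemma mx_vgeM n m k (A B : 'M[F]_n) : mx_vge m A -> mx_vge k B -> mx_vge (m + k) (A *m B).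
Proof. by move=> hA hB i j; rewrite mxE; apply: vge_sum => l _; apply: vgeM. Qed.

Lemma mx_vge_ex n (A : 'M[F]_n) : exists m, mx_vge m A.
Proof.
exists (- (\sum_i \sum_j `|pf_val (A i j)|)) => i j; right.
rewrite lerNl (bigD1 i) //= (bigD1 j) //=.
apply: le_trans (_ : `|pf_val (A i j)| <= _); first by rewrite -normrN ler_norm.
rewrite -addrA lerDl addr_ge0 // ?sumr_ge0 // => *; exact: sumr_ge0.
Qed.

(** With [A = g - 1] and [B = g^-1 - 1] this keeps congruence subgroups stable
    under inversion: each use of the equation improves a lower bound on the
    valuations of [B] by at least one, until the bound of [A] is reached. *)
Lemma mx_vge_bootstrap n m (A B : 'M[F]_n) : 1 <= m -> mx_vge m A ->
  B = - A - A *m B -> mx_vge m B.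
Proof.
move=> m1 hA eB; have [k hk] := mx_vge_ex B.
have step (l : nat) j : j <= m -> j <= k + l%:Z -> mx_vge j B.
  elim: l j => [|l IH] j jm jk; first by apply: mx_vge_le hk; rewrite addr0 in jk.
  rewrite eB; apply: mx_vgeD; apply: mx_vgeN; first exact: mx_vge_le jm hA.
  by apply: mx_vge_le (mx_vgeM hA (IH (j - 1) _ _)); lia.
by apply: (step `|m - k|%N) => //; lia.
Qed.

End Valuation.

Section RationalPoints.
Variables (F : padicField) (Fbar : closedFieldType) (iota : {rmorphism F -> Fbar}).
Variables (n : nat) (G : algGroup iota n).
Local Notation GF := (points G).
Implicit Types (g h : GF) (U : set GF).

Lemma pt_nearE m g h : pt_near m g h <-> mx_vge m (pt_val h - pt_val g).
Proof. by split=> hh i j; move: (hh i j); rewrite !mxE. Qed.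

Lemma pt_openE U : open U <-> forall g, U g -> exists m, forall h, pt_near m g h -> U h.
Proof. by []. Qed.

Lemma pt_valM g h : pt_val (g * h)%g = pt_val g *m pt_val h. Proof. by []. Qed.
Lemma pt_val1 : pt_val (1%g : GF) = 1%:M. Proof. by []. Qed.
Lemma pt_valV g : pt_val (g^-1)%g = invmx (pt_val g). Proof. by []. Qed.

(** The small subgroups are the intersections of [K] with the congruence
    subgroups [g = 1] modulo the [m]-th power of the uniformizer. They are open,
    and closed in [K], because membership only depends on [g] modulo that power. *)
Lemma points_small_subgroups : small_subgroups GF.
Proof.
split.
- move=> g U /pt_openE oU; apply/pt_openE => h /oU[m hm].
  have [k hk] := mx_vge_ex (pt_val g).
  exists (m - k) => h' /pt_nearE hh'; apply: hm; apply/pt_nearE.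
  by rewrite !pt_valM -mulmxBr -[m](subrKC k); apply: mx_vgeM.
- move=> g U /pt_openE oU; apply/pt_openE => h /oU[m hm].
  have [k hk] := mx_vge_ex (pt_val g).
  exists (m - k) => h' /pt_nearE hh'; apply: hm; apply/pt_nearE.
  by rewrite !pt_valM -mulmxBl -[m](subrK k); apply: mx_vgeM.
move=> U K /pt_openE oU U1 oK.
have [m0 hm0] := oU _ U1.
(* A level of at least 1 is what makes inverses stay in the congruence subgroup. *)
pose m := Num.max m0 1.
have m1 : 1 <= m by rewrite le_max lexx orbT.
pose N := [set g : GF | pt_near m 1%g g].
have NE g : N g <-> mx_vge m (pt_val g - 1%:M) by rewrite -pt_val1; exact: pt_nearE.
have nearN g h : pt_near m g h -> N g <-> N h.
  move=> /pt_nearE gh; split=> /NE hN; apply/NE.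
    by rewrite -(subrKA (pt_val g)); apply: mx_vgeD.
  by rewrite -(subrKA (pt_val h)); apply: mx_vgeD => //; rewrite -opprB; apply: mx_vgeN.
exists (N `&` K); split; last first.
  move=> g [hN hK]; split=> //; apply: hm0; apply/pt_nearE.
  by apply: mx_vge_le (proj1 (NE g) hN); rewrite le_max lexx.
split.
- apply: openI (ocs_open oK); apply/pt_openE => g hg; exists m => h gh.
  exact/(nearN _ _ gh).
- rewrite setIC; apply: compact_closedI (ocs_compact oK) _.
  rewrite -(setCK N); apply: open_closedC; apply/pt_openE => g hg; exists m => h gh.
  by move=> /(nearN _ _ gh).
- by split; [apply/NE; rewrite pt_val1 subrr => i j; rewrite mxE; exact: vge0|exact: ocs_one oK].
- move=> g h [/NE gN gK] [/NE hN hK]; split; last exact: ocs_mul oK _ _ _ _.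
  apply/NE; rewrite pt_valM.
  have -> : pt_val g *m pt_val h - 1%:M = (pt_val g - 1%:M) *m (pt_val h - 1%:M) +
    ((pt_val g - 1%:M) + (pt_val h - 1%:M)).
    by rewrite mulmxBr mulmx1 mulmxBl mul1mx addrA subrK addrA subrK.
  apply: mx_vgeD; last exact: mx_vgeD.
  by apply: mx_vge_le (mx_vgeM gN hN); lia.
move=> g [/NE gN gK]; split; last exact: ocs_inv oK _ _.
apply/NE; rewrite pt_valV; apply: (mx_vge_bootstrap m1 gN).
rewrite mulmxBr mulmx1 mulmxBl mul1mx mulmxV ?pt_unit //.
by move: (_ - 1%:M in RHS) => A; rewrite (opprB _ A) addKr opprB.
Qed.

End RationalPoints.

(** * Cosets of open compact subgroups *)

Section Cosets.
Variables (gT : preTopGroupType).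
Implicit Types (K : set gT) (g h : gT) (s r : seq gT).

(** The shape of this condition is the one in [haar_integral]. *)
Definition coset_free K s := pairwise (fun a b => `[< ~ K (a^-1 * b)%g >]) s.
Definition coset_cover K (S : set gT) s :=
  forall g, S g -> exists2 a, a \in s & K (a^-1 * g)%g.

Definition coset_reps K' K r :=
  [/\ coset_free K' r, (forall k, k \in r -> K k) & coset_cover K' K r].

(** Go through [s] and drop an element whose coset has already been met. *)
Lemma separate K s : (forall g, K g -> K g^-1%g) -> (forall g h, K g -> K h -> K (g * h)%g) ->
  K 1%g -> exists s', [/\ coset_free K s', {subset s' <= s} & coset_cover K [set` s] s'].
Proof.
move=> Ki Km K1; elim: s => [|x s [s' [sep sub cov]]].
  by exists [::]; split=> // g; rewrite /= in_nil.
have [[b bs xb]|nb] := pselect (exists2 b, b \in s' & K (b^-1 * x)%g).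
  exists s'; split=> //; first by move=> y /sub; rewrite inE orbC => ->.
  by move=> g /=; rewrite inE => /orP[/eqP->|gs]; [exists b|exact: cov].
exists (x :: s'); split.
- rewrite /coset_free /= -/(coset_free K s') sep andbT.
  apply/allP => b bs; apply/asboolP => xb; apply: nb; exists b => //.
  by have := Ki _ xb; rewrite invgM invgK.
- by move=> y; rewrite !inE => /orP[->//|/sub ->]; rewrite orbT.
move=> g /=; rewrite inE => /orP[/eqP->|gs].
  by exists x; rewrite ?mulVg // mem_head.
by have [a as' aK] := cov g gs; exists a => //; rewrite inE as' orbT.
Qed.

Lemma coset_free_inj K s a b : coset_free K s -> a \in s -> b \in s ->
  (forall g, K g -> K g^-1%g) -> K (a^-1 * b)%g -> a = b.
Proof.
move=> + + + Ki; elim: s => // x s IH /=; rewrite /coset_free /= => /andP[/allP xs ss].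
rewrite !inE => /orP[/eqP->|sa] /orP[/eqP->|sb] ab //.
- by move/asboolP: (xs _ sb) => /(_ ab).
- by move/asboolP: (xs _ sa); case; have := Ki _ ab; rewrite invgM invgK.
- exact: IH.
Qed.

Lemma coset_free_uniq K s : coset_free K s -> K 1%g -> uniq s.
Proof.
move=> + K1; elim: s => // x s IH /=; rewrite /coset_free /= => /andP[/allP xs ss].
rewrite IH // andbT; apply/negP => /xs /asboolP; by rewrite mulVg.
Qed.

End Cosets.

Section SmallSubgroups.
Variables (gT : preTopGroupType) (ssG : small_subgroups gT).
Implicit Types (K : set gT) (g h : gT) (s r : seq gT).
Local Notation ocs := open_compact_subgroup.

Lemma open_coset K g : ocs K -> open [set h | K (g^-1 * h)%g].
Proof. by move=> oK; apply: (ss_mull ssG g^-1%g); exact: ocs_open oK. Qed.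

(** The complement is a union of cosets, which are open. *)
Lemma ocs_closed K : ocs K -> closed K.
Proof.
move=> oK; rewrite -(setCK K); apply: open_closedC.
have -> : ~` K = \bigcup_(g in ~` K) [set h | K (g^-1 * h)%g].
  apply/seteqP; split=> [g Kg|h [g Kg /= gh] Kh].
    by exists g => //=; rewrite mulVg; exact: ocs_one oK.
  apply: Kg; have := ocs_mul oK Kh (ocs_inv oK gh).
  by rewrite invgM invgK mulVKg.
by apply: bigcup_open => g _; exact: open_coset.
Qed.

Lemma ocsI K K' : ocs K -> ocs K' -> ocs (K `&` K').
Proof.
move=> oK oK'; split.
- by apply: openI; [exact: ocs_open oK|exact: ocs_open oK'].
- by apply: (compact_closedI (ocs_compact oK)); exact: ocs_closed.
- by split; [exact: ocs_one oK|exact: ocs_one oK'].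
- by move=> g h [Kg Kg'] [Kh Kh']; split; [exact: (ocs_mul oK)|exact: (ocs_mul oK')].
- by move=> g [Kg Kg']; split; [exact: (ocs_inv oK)|exact: (ocs_inv oK')].
Qed.

Lemma ocs_inter_seq (I : eqType) (s : seq I) (Kf : I -> set gT) K :
  ocs K -> (forall i, i \in s -> ocs (Kf i)) ->
  exists K', [/\ ocs K', K' `<=` K & forall i, i \in s -> K' `<=` Kf i].
Proof.
move=> oK; elim: s => [|x s IH] os; first by exists K; split=> // i; rewrite in_nil.
have [|K' [oK' K'K K's]] := IH.
  by move=> i si; apply: os; rewrite inE si orbT.
have ox : ocs (Kf x) by apply: os; rewrite mem_head.
exists (Kf x `&` K'); split; first exact: ocsI.
  by move=> g [_ /K'K].
move=> i; rewrite inE => /orP[/eqP->|si]; first by move=> g [].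
by move=> g [_ /(K's _ si)].
Qed.

Lemma ocs_conj K g : ocs K -> ocs [set h | K (g^-1 * h * g)%g].
Proof.
move=> oK; split=> /=.
- apply: (ss_mull ssG g^-1%g (U := [set h | K (h * g)%g])).
  by apply: (ss_mulr ssG g); exact: ocs_open oK.
- have -> : [set h | K (g^-1 * h * g)%g] = (fun h => g * h * g^-1)%g @` K.
    apply/seteqP; split=> [h /= Kh|_ [h Kh <-] /=].
      by exists (g^-1 * h * g)%g => //; rewrite !mulgA mulgV mul1g mulgK.
    by rewrite !mulgA mulVg mul1g mulgVK.
  apply: continuous_compact (ocs_compact oK).
  apply: continuous_subspaceT; apply/continuousP => U oU.
  apply: (ss_mull ssG g (U := [set h | U (h * g^-1)%g])).
  exact: ss_mulr ssG g^-1%g _ oU.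
- by rewrite mulg1 mulVg; exact: ocs_one oK.
- move=> h h' Kh Kh'; have := ocs_mul oK Kh Kh'.
  by rewrite !mulgA mulgK.
- by move=> h Kh; have := ocs_inv oK Kh; rewrite !invgM invgK mulgA.
Qed.

Lemma compact_coset_cover K (S : set gT) : ocs K -> compact S ->
  exists s, coset_free K s /\ coset_cover K S s.
Proof.
move=> oK; rewrite compact_cover => cS.
have [||D _ SD] := cS gT setT (fun g => [set h | K (g^-1 * h)%g]).
- by move=> g _; exact: open_coset.
- by move=> g _; exists g => //=; rewrite mulVg; exact: ocs_one oK.
have [s [sep _ cov]] := separate (enum_fset D) (ocs_inv oK) (ocs_mul oK) (ocs_one oK).
exists s; split=> // g /SD[a aD ag].
have [b bs ba] := cov a aD; exists b => //.
by have := ocs_mul oK ba ag; rewrite -mulgA mulVKg.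
Qed.

Lemma coset_reps_ex K' K : ocs K' -> ocs K -> K' `<=` K -> exists r, coset_reps K' K r.
Proof.
move=> oK' oK K'K.
have [s [sep cov]] := compact_coset_cover oK' (ocs_compact oK).
exists [seq a <- s | `[< K a >]]; split.
- exact: pairwise_filter.
- by move=> k; rewrite mem_filter => /andP[/asboolP].
move=> g Kg; have [a as_ ag] := cov g Kg; exists a => //.
rewrite mem_filter as_ andbT; apply/asboolP.
have := ocs_mul oK Kg (ocs_inv oK (K'K _ ag)).
by rewrite invgM invgK mulVKg.
Qed.

Lemma coset_reps_size K' K r : ocs K -> coset_reps K' K r -> (0 < size r)%N.
Proof.
by move=> oK [_ _ cov]; have [a] := cov _ (ocs_one oK); case: r cov.
Qed.

(** Used for [op g k = g * k] and for [op g k = k * g], with [dv] the matching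
    division. Around each point of its support [f] is constant on a coset of a small
    subgroup; finitely many of these cosets cover the support, and the intersection
    of their subgroups works everywhere on it. *)
Lemma locally_constant_invariant (L : nzRingType) (f : gT -> L) K
    (op dv : gT -> gT -> gT) : ocs K -> hecke_fun f ->
  (forall g U, open U -> open [set k | U (op g k)]) ->
  (forall g U, open U -> open [set h | U (dv g h)]) ->
  (forall g h, op g (dv g h) = h) -> (forall g, dv g g = 1%g) -> (forall g, op g 1%g = g) ->
  (forall K' g h k, ocs K' -> K' (dv g h) -> K' k -> K' (dv g (op h k))) ->
  exists K', [/\ ocs K', K' `<=` K &
    forall g k, g \in closure [set g | f g != 0] -> K' k -> f (op g k) = f g].
Proof.
move=> oK [lc cf] o_op o_dv opK dv1 op1 dvM.
have /choice[U hU] : forall g, exists U, [/\ open U, U g & forall h, U h -> f h = f g].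
  move=> g; have : nbhs g [set h | f h = f g] := lc g; rewrite nbhsE => -[U [oU Ug] UA].
  by exists U; split=> // h /UA.
have /choice[Kf hK] : forall g, exists K', ocs K' /\ K' `<=` [set k | U g (op g k)] `&` K.
  move=> g; have [oU Ug _] := hU g; apply: (ss_small ssG) => //; first exact: o_op.
  by rewrite /= op1.
move: cf; rewrite compact_cover => cf.
have [||D _ SD] := cf gT setT (fun g => [set h | Kf g (dv g h)]).
- by move=> g _; apply: o_dv; have [/ocs_open] := hK g.
- by move=> g _; exists g => //=; rewrite dv1; have [/ocs_one] := hK g.
have [|K' [oK' K'K K'D]] := @ocs_inter_seq _ (enum_fset D) Kf _ oK.
  by move=> g _; case: (hK g).
exists K'; split=> // g k; rewrite inE => /SD[a aD /= ag] K'k.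
have [oKa KaU] := hK a; have [_ _ fU] := hU a.
have val h : Kf a (dv a h) -> f h = f a.
  by move=> /KaU[/= + _]; rewrite opK; exact: fU.
rewrite (val _ ag) val //; apply: dvM => //; exact: K'D K'k.
Qed.

Lemma hecke_bi_invariant (L : nzRingType) (f : gT -> L) K : ocs K -> hecke_fun f ->
  exists K', [/\ ocs K', K' `<=` K & bi_invariant_fun K' f].
Proof.
move=> oK hf.
have [||||||Kr [oKr KrK hr]] := locally_constant_invariant (op := fun g k => (g * k)%g)
    (dv := fun g h => (g^-1 * h)%g) oK hf.
- by move=> g U; exact: ss_mull.
- by move=> g U; exact: ss_mull.
- by move=> g h; rewrite mulVKg.
- by move=> g; rewrite mulVg.
- by move=> g; rewrite mulg1.
- by move=> K' g h k oK' Kg Kk; rewrite mulgA; exact: ocs_mul.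
have [||||||Kl [oKl KlK hl]] := locally_constant_invariant (op := fun g k => (k * g)%g)
    (dv := fun g h => (h * g^-1)%g) oK hf.
- by move=> g U; exact: ss_mulr.
- by move=> g U; exact: ss_mulr.
- by move=> g h; rewrite mulgVK.
- by move=> g; rewrite mulgV.
- by move=> g; rewrite mul1g.
- by move=> K' g h k oK' Kg Kk; rewrite -mulgA; exact: ocs_mul.
have supp g : f g != 0 -> g \in closure [set g | f g != 0].
  by move=> fg; rewrite inE; exact: subset_closure.
(* Off the support, a non-zero value of [f] at [op g k] would be carried back to [g]. *)
have inv_ext (op : gT -> gT -> gT) K' : ocs K' ->
    (forall g k, op (op g k) k^-1%g = g) ->
    (forall g k, g \in closure [set g | f g != 0] -> K' k -> f (op g k) = f g) ->
    forall g k, K' k -> f (op g k) = f g.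
  move=> oK' opK h g k Kk; have [fg|/supp fg] := eqVneq (f g) 0; last exact: h.
  have [->//|/supp fgk] := eqVneq (f (op g k)) 0.
  by rewrite -(h (op g k) k^-1%g) ?opK //; exact: ocs_inv.
exists (Kr `&` Kl); split; [exact: ocsI|by move=> g [/KrK]|].
move=> k k' g [_ Kk] [Kk' _].
rewrite (inv_ext (fun g k => g * k)%g Kr) //; last by move=> *; rewrite mulgK.
rewrite (inv_ext (fun g k => k * g)%g Kl) //; by move=> *; rewrite mulKg.
Qed.

Lemma hecke_cover (L : nzRingType) (f : gT -> L) K : ocs K -> hecke_fun f ->
  exists s, coset_free K s /\ coset_cover K [set g | f g != 0] s.
Proof.
move=> oK [_ cf]; have [s [sep cov]] := compact_coset_cover oK cf.
by exists s; split=> // g /subset_closure /cov.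
Qed.

End SmallSubgroups.

(** * Coset sums and Haar integrals *)

Section CosetSums.
Variables (gT : preTopGroupType) (ssG : small_subgroups gT).
Implicit Types (K : set gT) (g h : gT) (s r : seq gT).
Local Notation ocs := open_compact_subgroup.

Definition right_invariant (T : Type) K (phi : gT -> T) : Prop :=
  forall g k, K k -> phi (g * k)%g = phi g.

Definition coset_system (V : nmodType) K (phi : gT -> V) s : Prop :=
  coset_free K s /\ coset_cover K [set g | phi g != 0] s.

(** Both sides are the sum over the pairs of representatives of a common coset,
    as [phi] is constant on cosets. *)
Lemma coset_sum_unique (V : nmodType) K (phi : gT -> V) s s' : ocs K ->
  right_invariant K phi -> coset_system K phi s -> coset_system K phi s' ->
  \sum_(a <- s) phi a = \sum_(a <- s') phi a.
Proof.
move=> oK iK.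
have half s1 s2 : coset_free K s1 -> coset_system K phi s2 ->
    \sum_(a <- s1) phi a = \sum_(a <- s1) \sum_(b <- s2 | `[< K (b^-1 * a)%g >]) phi a.
  move=> sep1 [sep2 cov]; apply: eq_bigr => a _.
  have [->|fa] := eqVneq (phi a) 0; first by rewrite big1.
  have [b bs ba] := cov a fa.
  rewrite big_mkcond (bigD1_seq b) //=; last exact: coset_free_uniq sep2 (ocs_one oK).
  rewrite (asboolT ba) big1_seq ?addr0 // => b' /andP[nbb' b's].
  case: asboolP => // b'a; case/eqP: nbb'.
  apply: (coset_free_inj sep2 b's bs (ocs_inv oK)).
  have := ocs_mul oK b'a (ocs_inv oK ba).
  by rewrite invgM invgK mulgA mulgK.
move=> [sep cov] [sep' cov'].
rewrite (half s s') // (half s' s) // (exchange_big_dep predT) //=.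
apply: eq_bigr => b _; apply: eq_big => a.
  apply/asboolP/asboolP => /(ocs_inv oK); by rewrite invgM invgK.
by move=> /asboolP ba; rewrite -{1}(mulVKg b a) iK.
Qed.

Lemma coset_system_refine (V : nmodType) K K' (phi : gT -> V) s r :
  ocs K -> ocs K' -> K' `<=` K -> coset_reps K' K r -> coset_system K phi s ->
  coset_system K' phi [seq (a * k)%g | a <- s, k <- r].
Proof.
move=> oK oK' K'K [sepr rK covr] [sep cov]; split; last first.
  move=> g /cov[a as_ ag]; have [k kr kg] := covr _ ag.
  exists (a * k)%g; first by apply/allpairsP; exists (a, k).
  by rewrite invgM -mulgA.
have sepM a : coset_free K' [seq (a * k)%g | k <- r].
  rewrite /coset_free pairwise_map; apply: sub_pairwise sepr => k k' /asboolP h.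
  by apply/asboolP; rewrite /= invgM -mulgA mulKg.
elim: s sep {cov} => // x s IH; rewrite {1}/coset_free /= => /andP[/allP xs ss].
rewrite /coset_free pairwise_cat -!/(coset_free _ _) IH // andbT.
apply/andP; split; last exact: sepM.
apply/allrelP => _ _ /mapP[k kr ->] /allpairsP[[b k'] /= [bs k'r ->]].
apply/asboolP; rewrite invgM => h; move/asboolP: (xs _ bs); apply.
have := ocs_mul oK (ocs_mul oK (rK _ kr) (K'K _ h)) (ocs_inv oK (rK _ k'r)).
by rewrite !mulgA mulgV mul1g mulgK.
Qed.

(** A coset of [K] splits into [size r] cosets of [K'], and [phi] is constant on it. *)
Lemma coset_sum_index (V : nmodType) K K' (phi : gT -> V) s s' r :
  ocs K -> ocs K' -> K' `<=` K -> coset_reps K' K r -> right_invariant K phi ->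
  coset_system K phi s -> coset_system K' phi s' ->
  \sum_(a <- s') phi a = (\sum_(a <- s) phi a) *+ size r.
Proof.
move=> oK oK' K'K tr iK sys sys'.
have iK' : right_invariant K' phi by move=> g k /K'K; exact: iK.
rewrite (coset_sum_unique oK' iK' sys' (coset_system_refine oK oK' K'K tr sys)).
rewrite big_allpairs_dep -sumrMnl; apply: eq_bigr => a _.
have [_ rK _] := tr; rewrite (eq_big_seq (fun=> phi a)).
  by rewrite big_const_seq count_predT iter_addr_0.
by move=> k /rK Kk; rewrite iK.
Qed.

End CosetSums.

Section Volumes.
Variables (gT : preTopGroupType) (ssG : small_subgroups gT).
Variables (RT : realType) (mu : {measure set (borel_type gT) -> \bar RT}).
Hypothesis mu_haar : rational_haar mu.
Implicit Types (K : set gT) (g h : gT) (s r : seq gT).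
Local Notation ocs := open_compact_subgroup.

Lemma open_borel (U : set gT) : open U -> measurable (U : set (borel_type gT)).
Proof. by move=> oU; apply: sub_sigma_algebra. Qed.

Lemma volE K : ocs K -> mu K = (ratr (vol mu K))%:E.
Proof.
move=> oK; rewrite /vol; have [q hq] := haar_rational mu_haar oK.
exact: (@xgetPex _ 0 [set q | mu K = (ratr q)%:E] (ex_intro _ q hq)).
Qed.

Lemma measure_cosets K s : ocs K -> coset_free K s ->
  mu [set g | exists2 a, a \in s & K (a^-1 * g)%g] = ((ratr (vol mu K *+ size s))%:E)%E.
Proof.
move=> oK; elim: s => [|x s IH].
  move=> _; rewrite mulr0n rmorph0; apply: etrans (measure0 mu); congr (mu _).
  by apply/seteqP; split=> // g [].
rewrite /coset_free /= => /andP[/allP xs ss].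
have oc g : open [set h | K (g^-1 * h)%g] by exact: open_coset.
pose U s : set gT := [set g | exists2 a, a \in s & K (a^-1 * g)%g].
have oU : open (U s).
  have -> : U s = \bigcup_(a in [set` s]) [set h | K (a^-1 * h)%g].
    by apply/seteqP; split=> g [a as_ ag]; exists a.
  by apply: bigcup_open => a _.
rewrite -/(U (x :: s)).
have -> : U (x :: s) = [set h | K (x^-1 * h)%g] `|` U s.
  apply/seteqP; split=> [g [a]|g [xg|[a as_ ag]]].
  - by rewrite inE => /orP[/eqP->|as_] ag; [left|right; exists a].
  - by exists x; rewrite ?mem_head.
  - by exists a; rewrite // inE as_ orbT.
rewrite measureU; [|exact: open_borel|exact: open_borel|]; last first.
  apply/seteqP; split=> // g [/= xg [a as_ ag]].
  move/asboolP: (xs _ as_); apply.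
  have := ocs_mul oK xg (ocs_inv oK ag).
  by rewrite invgM invgK mulgA mulgK.
have xK : mu [set h | K (x^-1 * h)%g] = mu K.
  rewrite -(haar_inv mu_haar x (open_borel (ocs_open oK))); congr (mu _).
  apply/seteqP; split=> [g xg|_ [a Ka <-] /=]; last by rewrite mulKg.
  by exists (x^-1 * g)%g => //; rewrite mulVKg.
apply: (@etrans _ _ (mu K + (ratr (vol mu K *+ size s))%:E)%E).
  by congr (_ + _)%E; [exact: xK|exact: IH].
by rewrite (volE oK) -EFinD -rmorphD /= mulrS.
Qed.

(** [K] is the disjoint union of the cosets [a K'], which have the volume of [K']. *)
Lemma vol_index K K' r : ocs K -> ocs K' -> coset_reps K' K r -> K' `<=` K ->
  vol mu K = vol mu K' *+ size r.
Proof.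
move=> oK oK' [sep rK cov] K'K; have := measure_cosets oK' sep.
have -> : [set g | exists2 a, a \in r & K' (a^-1 * g)%g] = K.
  apply/seteqP; split=> [g [a /rK Ka /K'K ag]|g /cov //].
  by rewrite -(mulVKg a g); exact: ocs_mul.
by rewrite volE // => -[/fmorph_inj].
Qed.

Section Integral.
Variables (L : fieldType) (C : numFieldType) (tau : {rmorphism L -> C}).
Implicit Type V : lmodType L.

(** Additivity of [ratr] needs characteristic zero, which [tau] provides. *)
Lemma ratr_mulrn (q : rat) n : ratr (q *+ n) = ratr q *+ n :> L.
Proof. by apply: (fmorph_inj tau); rewrite rmorphMn /= !fmorph_rat rmorphMn. Qed.

(** For two subgroups, the intersection is a common refinement: it multiplies each
    sum by an index and divides the volume by the same index. *)
Lemma haar_integralE V (phi : gT -> V) K s : ocs K -> right_invariant K phi ->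
  coset_system K phi s ->
  haar_integral mu phi = \sum_(a <- s) ratr (vol mu K) *: phi a.
Proof.
move=> oK iK [sep cov]; rewrite /haar_integral; set A := [set w | _].
have A0 : A (\sum_(a <- s) ratr (vol mu K) *: phi a) by exists K, s.
have [K' [s' [oK' iK' cov' sep' ->]]] : A (xget 0 A) by apply: xgetPex; eexists; exact: A0.
have oI := ocsI ssG oK oK'.
have [r tr] := coset_reps_ex ssG oI oK (@subIsetl _ _ _).
have [r' tr'] := coset_reps_ex ssG oI oK' (@subIsetr _ _ _).
have sys : coset_system K phi s by [].
have sys' : coset_system K' phi s' by [].
have sysI := coset_system_refine oK oI (@subIsetl _ _ _) tr sys.
rewrite (vol_index oK oI tr (@subIsetl _ _ _)) (vol_index oK' oI tr' (@subIsetr _ _ _)).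
rewrite !ratr_mulrn -!scaler_sumr -!scalerMnl !scalerMnr.
rewrite -(coset_sum_index oK oI (@subIsetl _ _ _) tr iK sys sysI).
by rewrite -(coset_sum_index oK' oI (@subIsetr _ _ _) tr' iK' sys' sysI).
Qed.

End Integral.
End Volumes.

(** * Tensors over a change of rings *)

Section TensorCalculus.
Variables (R L : comNzRingType) (chi : {rmorphism R -> L}).

Section Pure.
Variable M : lmodType R.
Implicit Types (m : M) (a : L) (t : tens chi M).

(** The map out of the tensor product given by its universal property. *)
Definition tens_lift (U : zmodType) (b : M -> L -> U) t : U :=
  \sum_(x <- repr t) b x.1 x.2.

Lemma tens_liftD (U : zmodType) (b : M -> L -> U) : balanced chi b ->
  {morph tens_lift b : t u / t + u}.
Proof. by move=> bb t u; rewrite /tens_lift tens_repr // big_cat. Qed.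

Lemma tens_lift_pure (U : zmodType) (b : M -> L -> U) m a : balanced chi b ->
  tens_lift b (tens_pure chi m a) = b m a.
Proof. by move=> bb; rewrite /tens_lift tens_repr // big_seq1. Qed.

Lemma tens_lift0 (U : zmodType) (b : M -> L -> U) : balanced chi b ->
  tens_lift b 0 = 0.
Proof. by move=> bb; rewrite /tens_lift tens_repr // big_nil. Qed.

Lemma tens_pureDl m m' a : tens_pure chi (m + m') a = tens_pure chi m a + tens_pure chi m' a.
Proof.
by apply/tens_eqP => U b bb; rewrite big_cat /= !tens_repr // !big_seq1; case: bb => -> _ _.
Qed.

Lemma tens_pureDr m a a' : tens_pure chi m (a + a') = tens_pure chi m a + tens_pure chi m a'.
Proof.
by apply/tens_eqP => U b bb; rewrite big_cat /= !tens_repr // !big_seq1; case: bb => _ -> _.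
Qed.

Lemma tens_pureZ r m a : tens_pure chi (r *: m) a = tens_pure chi m (chi r * a).
Proof. by apply/tens_eqP => U b bb; rewrite !big_seq1; case: bb => _ _ ->. Qed.

Lemma scale_tens_pure c m a : c *: tens_pure chi m a = tens_pure chi m (c * a).
Proof.
apply/tens_eqP => U b bb; rewrite big_map (tens_repr _ (balanced_scale c bb)).
by rewrite !big_seq1.
Qed.

Lemma tens_pureE m a : tens_pure chi m a = a *: tens_pure chi m 1.
Proof. by rewrite scale_tens_pure mulr1. Qed.

Lemma tens_pure0 a : tens_pure chi (0 : M) a = 0.
Proof. by apply: (addrI (tens_pure chi 0 a)); rewrite -tens_pureDl !addr0. Qed.

Lemma tens_pure_scale r m : tens_pure chi (r *: m) 1 = chi r *: tens_pure chi m 1.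
Proof. by rewrite tens_pureZ mulr1 -tens_pureE. Qed.

Lemma tens_pure_sum (I : Type) (s : seq I) (P : pred I) (f : I -> M) a :
  tens_pure chi (\sum_(i <- s | P i) f i) a = \sum_(i <- s | P i) tens_pure chi (f i) a.
Proof. exact: (big_morph _ (fun m m' => tens_pureDl m m' a) (tens_pure0 a)). Qed.

Lemma tens_sum_pure t : t = \sum_(x <- repr t) tens_pure chi x.1 x.2.
Proof.
rewrite -[t in LHS]reprK; elim: (repr t) => [|x s IH]; first by rewrite big_nil.
rewrite big_cons -IH; apply/tens_eqP => U b bb.
by rewrite big_cat !tens_repr // big_cons big_seq1.
Qed.

Lemma tens_ind (P : tens chi M -> Prop) : P 0 ->
  (forall t u, P t -> P u -> P (t + u)) -> (forall m a, P (tens_pure chi m a)) ->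
  forall t, P t.
Proof.
by move=> P0 PD Pp t; rewrite (tens_sum_pure t); elim/big_ind: _.
Qed.

(** As [m ⊗ chi r = (r m) ⊗ 1], sums of pure tensors are pure. *)
Lemma tens_surj_pure : (forall a : L, exists r, chi r = a) ->
  forall t, exists m, t = tens_pure chi m 1.
Proof.
move=> chi_surj; elim/tens_ind=> [|_ _ [m ->] [m' ->]|m a].
- by exists 0; rewrite tens_pure0.
- by exists (m + m'); rewrite tens_pureDl.
- by have [r <-] := chi_surj a; exists (r *: m); rewrite tens_pureZ mulr1.
Qed.

Lemma tens_map_pure (f : M -> M) m a : linear f ->
  tens_map f (tens_pure chi m a) = tens_pure chi (f m) a.
Proof.
move=> lf; apply/tens_eqP => U b bb.
by rewrite big_map (tens_repr _ (balanced_map lf bb)) !big_seq1.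
Qed.

Definition tens_functional (l : M -> R) : tens chi M -> L :=
  tens_lift (fun m a => chi (l m) * a).

Lemma functional_balanced (l : M -> R) : (forall r m m', l (r *: m + m') = r * l m + l m') ->
  balanced chi (fun m a => chi (l m) * a).
Proof.
move=> ll; have lD m m' : l (m + m') = l m + l m' by rewrite -{1}[m]scale1r ll mul1r.
have l0 : l 0 = 0 by apply: (addrI (l 0)); rewrite -lD !addr0.
split=> [m m' a|m a a'|r m a]; first by rewrite lD rmorphD mulrDl.
  by rewrite mulrDr.
by rewrite -[r *: m]addr0 ll l0 addr0 rmorphM; ring.
Qed.

Section Functional.
Variable l : M -> R.
Hypothesis ll : forall r m m', l (r *: m + m') = r * l m + l m'.

Lemma tens_functional_pure m a : tens_functional l (tens_pure chi m a) = chi (l m) * a.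
Proof. by rewrite /tens_functional tens_lift_pure //; exact: functional_balanced. Qed.

Lemma tens_functional_linear c t u :
  tens_functional l (c *: t + u) = c * tens_functional l t + tens_functional l u.
Proof.
have bb := functional_balanced ll; rewrite /tens_functional tens_liftD //; congr (_ + _).
elim/tens_ind: t => [|t t' IH IH'|m a].
- by rewrite scaler0 tens_lift0 // mulr0.
- by rewrite scalerDr !tens_liftD // IH IH' mulrDr.
- by rewrite scale_tens_pure !tens_lift_pure // mulrCA.
Qed.
End Functional.

End Pure.

Section Pairing.
Variables (M N : lmodType R) (p : M -> N -> R).
Hypothesis bp : bilinear_map idfun p.

Let bal1 n c : balanced chi (fun (m : M) a => chi (p m n) * (a * c)).
Proof.
have [pl _] := bp.
have pD m m' : p (m + m') n = p m n + p m' n.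
  by have := pl 1 m m' n; rewrite scale1r /= mul1r.
have p0 : p 0 n = 0 by apply: (addrI (p 0 n)); rewrite -pD !addr0.
split=> [m m' a|m a a'|r m a]; first by rewrite pD rmorphD mulrDl.
  by rewrite mulrDl mulrDr.
have := pl r m 0 n; rewrite addr0 p0 addr0 /= => ->.
by rewrite rmorphM; ring.
Qed.

Let bal2 m a : balanced chi (fun (n : N) c => chi (p m n) * (a * c)).
Proof.
have [_ pr] := bp.
have pD n n' : p m (n + n') = p m n + p m n'.
  by have := pr 1 m n n'; rewrite scale1r /= mul1r.
have p0 : p m 0 = 0 by apply: (addrI (p m 0)); rewrite -pD !addr0.
split=> [n n' c|n c c'|r n c]; first by rewrite pD rmorphD mulrDl.
  by rewrite !mulrDr.
have := pr r m n 0; rewrite addr0 p0 addr0 /= => ->.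
by rewrite rmorphM; ring.
Qed.

Lemma tens_pairing_pure m a n c :
  tens_pairing p (tens_pure chi m a) (tens_pure chi n c) = chi (p m n) * (a * c).
Proof.
rewrite /tens_pairing exchange_big /=.
rewrite (eq_bigr (fun y => chi (p m y.1) * (a * y.2))); first last.
  by move=> y _; rewrite (tens_repr _ (bal1 y.1 y.2)) big_seq1.
by rewrite (tens_repr _ (bal2 m a)) big_seq1.
Qed.

Lemma tens_pairingDl (t t' : tens chi M) (u : tens chi N) :
  tens_pairing p (t + t') u = tens_pairing p t u + tens_pairing p t' u :> L.
Proof.
rewrite /tens_pairing [LHS]exchange_big [X in _ = X + _]exchange_big.
rewrite [X in _ = _ + X]exchange_big /=.
rewrite -big_split; apply: eq_bigr => y _.
by rewrite (tens_repr _ (bal1 y.1 y.2)) big_cat.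
Qed.

Lemma tens_pairingDr (t : tens chi M) (u u' : tens chi N) :
  tens_pairing p t (u + u') = tens_pairing p t u + tens_pairing p t u' :> L.
Proof.
rewrite /tens_pairing -big_split; apply: eq_bigr => y _.
by rewrite (tens_repr _ (bal2 y.1 y.2)) big_cat.
Qed.

Lemma tens_pairing0l (u : tens chi N) : tens_pairing p (0 : tens chi M) u = 0.
Proof. by apply: (addrI (tens_pairing p (0 : tens chi M) u)); rewrite -tens_pairingDl !addr0. Qed.
Lemma tens_pairing0r (t : tens chi M) : tens_pairing p t (0 : tens chi N) = 0.
Proof. by apply: (addrI (tens_pairing p t (0 : tens chi N))); rewrite -tens_pairingDr !addr0. Qed.

Lemma tens_pairing_bilinear : bilinear_map idfun (@tens_pairing _ _ chi M N p).
Proof.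
split=> c t t' u.
  rewrite tens_pairingDl; congr (_ + _).
  elim/tens_ind: t => [|t1 t2 IH1 IH2|m a].
  - by rewrite scaler0 tens_pairing0l mulr0.
  - by rewrite scalerDr !tens_pairingDl IH1 IH2 mulrDr.
  elim/tens_ind: u => [|u1 u2 IH1 IH2|n d].
  - by rewrite !tens_pairing0r mulr0.
  - by rewrite !tens_pairingDr IH1 IH2 mulrDr.
  by rewrite scale_tens_pure !tens_pairing_pure /=; ring.
rewrite tens_pairingDr; congr (_ + _).
elim/tens_ind: t => [|t1 t2 IH1 IH2|m a].
- by rewrite !tens_pairing0l mulr0.
- by rewrite !tens_pairingDl IH1 IH2 mulrDr.
elim/tens_ind: t' => [|u1 u2 IH1 IH2|n d].
- by rewrite scaler0 tens_pairing0r mulr0.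
- by rewrite scalerDr !tens_pairingDr IH1 IH2 mulrDr.
by rewrite scale_tens_pure !tens_pairing_pure /=; ring.
Qed.

End Pairing.
End TensorCalculus.

(** * Averaging over open compact subgroups *)

Section GModuleCalculus.
Variables (gT : preTopGroupType) (R : comNzRingType) (M : gmodule gT R).
Implicit Types (g : gT) (v : M).

Lemma gm_act0 g : gm_act g (0 : M) = 0.
Proof.
by have := @gm_act_linear _ _ M g (-1) 0 0; rewrite scaleN1r oppr0 addr0 scaleN1r addNr.
Qed.
Lemma gm_actD g v v' : gm_act g (v + v') = gm_act g v + gm_act g v'.
Proof. by have := gm_act_linear g 1 v v'; rewrite !scale1r. Qed.
Lemma gm_actZ g a v : gm_act g (a *: v) = a *: gm_act g v.
Proof. by have := gm_act_linear g a v 0; rewrite gm_act0 !addr0. Qed.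
Lemma gm_act_sum g (I : Type) (s : seq I) (f : I -> M) :
  gm_act g (\sum_(i <- s) f i) = \sum_(i <- s) gm_act g (f i).
Proof. exact: (big_morph _ (gm_actD g) (gm_act0 g)). Qed.
Lemma gm_actK g v : gm_act g (gm_act g^-1%g v) = v.
Proof. by rewrite -gm_actM mulgV gm_act1. Qed.
Lemma gm_actKV g v : gm_act g^-1%g (gm_act g v) = v.
Proof. by rewrite -gm_actM mulVg gm_act1. Qed.

Lemma fixedP (K : set gT) v : (v \in fixed M K) <-> forall k, K k -> gm_act k v = v.
Proof. by split=> [/asboolP|h]; last exact/asboolP. Qed.

Lemma fixed_linear (K : set gT) a v v' :
  v \in fixed M K -> v' \in fixed M K -> a *: v + v' \in fixed M K.
Proof.
by move=> /fixedP h /fixedP h'; apply/fixedP => k Kk; rewrite gm_act_linear h ?h'.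
Qed.

Lemma fixed0 (K : set gT) : 0 \in fixed M K.
Proof. by apply/fixedP => k _; exact: gm_act0. Qed.

Lemma fixedS (K K' : set gT) v : K' `<=` K -> v \in fixed M K -> v \in fixed M K'.
Proof. by move=> KK /fixedP h; apply/fixedP => k /KK; exact: h. Qed.

Lemma fixedD (K : set gT) v v' :
  v \in fixed M K -> v' \in fixed M K -> v + v' \in fixed M K.
Proof. by move=> h h'; rewrite -[v]scale1r; exact: fixed_linear. Qed.

Lemma fixedZ (K : set gT) a v : v \in fixed M K -> a *: v \in fixed M K.
Proof. by move=> h; rewrite -[_ *: _]addr0; apply: fixed_linear => //; exact: fixed0. Qed.

Lemma fixed_sum (K : set gT) (I : Type) (s : seq I) (P : pred I) (f : I -> M) :
  (forall i, P i -> f i \in fixed M K) -> \sum_(i <- s | P i) f i \in fixed M K.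
Proof. by move=> h; elim/big_ind: _ => //; [exact: fixed0|exact: fixedD]. Qed.

End GModuleCalculus.

(** What is needed to average over finite orbits. *)
Definition rational_algebra (R : comNzRingType) : Prop :=
  forall n, (0 < n)%N -> exists c : R, c * n%:R = 1.

Lemma rational_algebra_ext (R L : comNzRingType) (chi : {rmorphism R -> L}) :
  rational_algebra R -> rational_algebra L.
Proof.
move=> QR n n0; have [c cn] := QR n n0; exists (chi c).
by rewrite -(rmorph_nat chi) -rmorphM cn rmorph1.
Qed.

Section Averaging.
Variables (gT : preTopGroupType) (ssG : small_subgroups gT).
Variables (R : comNzRingType) (QR : rational_algebra R).
Local Notation ocs := open_compact_subgroup.

Section OneModule.
Variable M : gmodule gT R.
Implicit Types (g : gT) (v w : M) (K : set gT).

(** [w] is the mean of the orbit [K v], which is finite: it is counted through a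
    subgroup [K'] fixing [v]. *)
Definition is_average K v w : Prop := exists K' r c,
  [/\ ocs K', K' `<=` K, v \in fixed M K', coset_reps K' K r /\ c * (size r)%:R = 1 &
      w = c *: \sum_(k <- r) gm_act k v].

Definition average K v : M := xget 0 (is_average K v).

(* Extended by zero, so that orbit sums are coset sums. *)
Let orbit_fun K v g : M := if `[< K g >] then gm_act g v else 0.

Let orbit_inv K K' v : ocs K -> K' `<=` K -> v \in fixed M K' ->
  right_invariant K' (orbit_fun K v).
Proof.
move=> oK K'K /fixedP fv g k K'k; rewrite /orbit_fun.
have -> : `[< K (g * k)%g >] = `[< K g >].
  apply/asboolP/asboolP => [Kgk|Kg]; last by apply: ocs_mul oK _ _ Kg (K'K _ K'k).
  by rewrite -(mulgK k g); apply: (ocs_mul oK) => //; apply: (ocs_inv oK); exact: K'K.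
by case: ifP => // _; rewrite gm_actM fv.
Qed.

(** Two subgroups fixing [v] are compared with their intersection. By
    [coset_sum_index] this multiplies the orbit sum and the number of
    representatives by the same index, so the means agree. *)
Lemma is_average_unique K v w w' : ocs K -> is_average K v w -> is_average K v w' -> w = w'.
Proof.
move=> oK [K1 [r1 [c1 [oK1 K1K fv1 [tr1 e1] ->]]]] [K2 [r2 [c2 [oK2 K2K fv2 [tr2 e2] ->]]]].
have oI := ocsI ssG oK1 oK2.
have I1 : K1 `&` K2 `<=` K1 by exact: subIsetl.
have I2 : K1 `&` K2 `<=` K2 by exact: subIsetr.
have [t1 trt1] := coset_reps_ex ssG oI oK1 I1.
have [t2 trt2] := coset_reps_ex ssG oI oK2 I2.
have sys (V : nmodType) (phi : gT -> V) K' r : coset_reps K' K r -> (forall g, ~ K g -> phi g = 0) ->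
    coset_system K' phi r.
  move=> [sep _ cov] h; split=> // g /= fg; apply: cov; apply: contrapT => /h e.
  by rewrite e eqxx in fg.
have out g : ~ K g -> orbit_fun K v g = 0 by move=> Kg; rewrite /orbit_fun asboolF.
have val K' r : coset_reps K' K r ->
    \sum_(k <- r) gm_act k v = \sum_(k <- r) orbit_fun K v k.
  by move=> [_ rK _]; apply: eq_big_seq => k /rK Kk; rewrite /orbit_fun asboolT.
(* The numbers of representatives are themselves coset sums, of the indicator of [K]. *)
pose one g : nat := `[< K g >].
have onei K' : K' `<=` K -> right_invariant K' one.
  move=> K'K g k K'k; rewrite /one; congr nat_of_bool.
  apply/asboolP/asboolP => [Kgk|Kg]; last by apply: ocs_mul oK _ _ Kg (K'K _ K'k).
  by rewrite -(mulgK k g); apply: (ocs_mul oK) => //; apply: (ocs_inv oK); exact: K'K.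
have oneo g : ~ K g -> one g = 0%N by move=> Kg; rewrite /one asboolF.
have onev K' r : coset_reps K' K r -> \sum_(k <- r) one k = size r.
  move=> [_ rK _]; rewrite (eq_big_seq (fun=> 1%N)).
    exact: sum1_size.
  by move=> k /rK Kk; rewrite /one asboolT.
have comp (V : nmodType) (phi : gT -> V) : right_invariant K1 phi -> right_invariant K2 phi ->
    (forall g, ~ K g -> phi g = 0) ->
    (\sum_(k <- r1) phi k) *+ size t1 = (\sum_(k <- r2) phi k) *+ size t2.
  move=> i1 i2 ho.
  have sI := coset_system_refine oK1 oI I1 trt1 (sys _ _ _ _ tr1 ho).
  rewrite -(coset_sum_index oK1 oI I1 trt1 i1 (sys _ _ _ _ tr1 ho) sI).
  by rewrite -(coset_sum_index oK2 oI I2 trt2 i2 (sys _ _ _ _ tr2 ho) sI).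
have := comp nat one (onei _ K1K) (onei _ K2K) oneo.
rewrite (onev _ _ tr1) (onev _ _ tr2) => eN.
have := comp _ _ (orbit_inv oK K1K fv1) (orbit_inv oK K2K fv2) out.
rewrite -(val _ _ tr1) -(val _ _ tr2).
set S1 := \sum_(k <- r1) _; set S2 := \sum_(k <- r2) _ => eS.
have [d1 ed1] := QR (coset_reps_size oK1 trt1).
have [d2 ed2] := QR (coset_reps_size oK2 trt2).
have -> : S1 = d1 *: (S1 *+ size t1) by rewrite -scaler_nat scalerA ed1 scale1r.
have -> : S2 = d2 *: (S2 *+ size t2) by rewrite -scaler_nat scalerA ed2 scale1r.
rewrite -eS !scalerA; congr (_ *: _).
have eN' : (size r1)%:R * (size t1)%:R = (size r2)%:R * (size t2)%:R :> R.
  have mulE a b : a *+ b = (a * b)%N :> nat by elim: b => [|b IH]; rewrite ?muln0 // mulrS IH mulnS.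
  by rewrite -!natrM -!mulE eN.
have E1 : c1 * d1 * ((size r1)%:R * (size t1)%:R) = 1 by rewrite mulrACA e1 ed1 mulr1.
have E2 : c2 * d2 * ((size r2)%:R * (size t2)%:R) = 1 by rewrite mulrACA e2 ed2 mulr1.
by rewrite -[LHS]mulr1 -E2 -eN' mulrCA E1 mulr1.
Qed.

Hypothesis smM : smooth M.

Lemma is_average_ex K v : ocs K -> exists w, is_average K v w.
Proof.
move=> oK; have [K1 oK1 fv] := smM v.
have I2 : K1 `&` K `<=` K by exact: subIsetr.
have oI := ocsI ssG oK1 oK.
have [r tr] := coset_reps_ex ssG oI oK I2.
have [c ec] := QR (coset_reps_size oK tr).
exists (c *: \sum_(k <- r) gm_act k v), (K1 `&` K), r, c; split=> //.
by apply: fixedS fv; exact: subIsetl.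
Qed.

Lemma averageP K v : ocs K -> is_average K v (average K v).
Proof. by move=> oK; apply: xgetPex; exact: is_average_ex. Qed.

Lemma averageE K v w : ocs K -> is_average K v w -> average K v = w.
Proof. by move=> oK; apply: is_average_unique oK (averageP _ oK). Qed.

(** An element of [K] permutes the cosets of [K'] in [K]. *)
Lemma average_fixed K v : ocs K -> average K v \in fixed M K.
Proof.
move=> oK; have [K' [r [c [oK' K'K fv [[sep rK cov] ec] ->]]]] := averageP v oK.
apply: fixedZ; apply/fixedP => g Kg; rewrite gm_act_sum.
under eq_bigr => k _ do rewrite -gm_actM.
rewrite -(big_map (fun k => g * k)%g xpredT (fun k => gm_act k v)).
have inv : right_invariant K' (orbit_fun K v) by exact: orbit_inv.
have e s : (forall k, k \in s -> K k) ->
    \sum_(k <- s) gm_act k v = \sum_(k <- s) orbit_fun K v k.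
  by move=> sK; apply: eq_big_seq => k /sK Kk; rewrite /orbit_fun asboolT.
rewrite !e //; last by move=> _ /mapP[k /rK Kk ->]; exact: ocs_mul.
have suppK h : orbit_fun K v h != 0 -> K h.
  by rewrite /orbit_fun; case: asboolP => //; rewrite eqxx.
apply: (coset_sum_unique oK' inv); split=> //.
- rewrite /coset_free pairwise_map; apply: sub_pairwise sep => a b /asboolP h.
  by apply/asboolP; rewrite /= invgM -mulgA mulKg.
- move=> h /suppK Kh; have [|a ar aK] := cov (g^-1 * h)%g.
    by apply: (ocs_mul oK) => //; exact: ocs_inv.
  by exists (g * a)%g; [exact: map_f|rewrite invgM -mulgA].
- by move=> h /suppK /cov.
Qed.

Lemma average_id K v : ocs K -> v \in fixed M K -> average K v = v.
Proof.
move=> oK fv; apply: averageE => //; exists K, [:: 1%g], 1; split=> //.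
  split; last by rewrite mulr1.
  split=> // [k|g Kg]; first by rewrite inE => /eqP ->; exact: ocs_one oK.
  by exists 1%g; rewrite ?mem_head // invg1 mul1g.
by rewrite big_seq1 gm_act1 scale1r.
Qed.

Lemma average_linear K a v w : ocs K ->
  average K (a *: v + w) = a *: average K v + average K w.
Proof.
move=> oK; have [K1 oK1 fv] := smM v; have [K2 oK2 fw] := smM w.
have oI := ocsI ssG (ocsI ssG oK1 oK2) oK.
have I1 : (K1 `&` K2) `&` K `<=` K1 by move=> g [[]].
have I2 : (K1 `&` K2) `&` K `<=` K2 by move=> g [[]].
have I : (K1 `&` K2) `&` K `<=` K by move=> g [[]].
have [r tr] := coset_reps_ex ssG oI oK I.
have [c ec] := QR (coset_reps_size oK tr).
have avg u : u \in fixed M ((K1 `&` K2) `&` K) -> average K u = c *: \sum_(k <- r) gm_act k u.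
  by move=> fu; apply: averageE => //; exists ((K1 `&` K2) `&` K), r, c.
have fv' := fixedS I1 fv; have fw' := fixedS I2 fw.
rewrite !avg //; last exact: fixed_linear.
under eq_bigr => k _ do rewrite gm_act_linear.
by rewrite big_split -scaler_sumr scalerDr !scalerA mulrC.
Qed.

(** If [K'] fixes [v] then its conjugate by [k] fixes [k v], and translates of the
    representatives of [K'] represent the cosets of the conjugate. *)
Lemma average_act K k v : ocs K -> K k -> average K (gm_act k v) = average K v.
Proof.
move=> oK Kk; have [K' [r [c [oK' K'K fv [[sep rK cov] ec] e]]]] := averageP v oK.
apply: averageE => //; exists [set h | K' (k^-1 * h * k)%g], [seq (a * k^-1)%g | a <- r], c.
split=> //.
- exact: ocs_conj.
- move=> h /= /K'K Kh; have := ocs_mul oK (ocs_mul oK Kk Kh) (ocs_inv oK Kk).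
  by rewrite !mulgA mulgV mul1g mulgK.
- apply/fixedP => h /= K'h; rewrite -gm_actM -[(h * k)%g](mulVKg k) gm_actM mulgA.
  by move/fixedP: fv => ->.
- split; last by rewrite size_map.
  split.
  + rewrite /coset_free pairwise_map; apply: sub_pairwise sep => a b /asboolP h.
    by apply/asboolP; rewrite /= invgM invgK !mulgA mulVg mul1g mulgVK.
  + by move=> _ /mapP[a /rK Ka ->]; apply: (ocs_mul oK) => //; exact: ocs_inv.
  + move=> g Kg; have [|a ar aK] := cov (g * k)%g; first exact: ocs_mul.
    exists (a * k^-1)%g; first by apply/mapP; exists a.
    by rewrite /= invgM invgK !mulgA mulVg mul1g -mulgA.
rewrite e big_map; congr (_ *: _); apply: eq_bigr => a _.
by rewrite -gm_actM mulgVK.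
Qed.

End OneModule.

(** As [w] is fixed, all terms [p (k v) w] of the mean are equal to [p v w]. *)
Lemma average_pairing (V W : gmodule gT R) (p : V -> W -> R) (K : set gT) v w :
  ocs K -> smooth V -> bilinear_map idfun p -> invariant_pairing p -> w \in fixed W K ->
  p (average K v) w = p v w.
Proof.
move=> oK smV [pl _] pinv /fixedP fw.
have [K' [r [c [oK' K'K fv [[sep rK cov] ec] ->]]]] := averageP smV v oK.
have p0 : p 0 w = 0 by have := pl (-1) 0 0 w; rewrite scaleN1r oppr0 addr0 mulN1r addNr.
have pD u u' : p (u + u') w = p u w + p u' w by have := pl 1 u u' w; rewrite scale1r mul1r.
have -> u : p (c *: u) w = c * p u w by have := pl c u 0 w; rewrite p0 !addr0.
rewrite (big_morph (fun u => p u w) pD p0) (eq_big_seq (fun=> p v w)).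
  by rewrite big_const_seq count_predT iter_addr_0 -mulr_natl mulrA ec mul1r.
by move=> k /rK Kk; rewrite -{1}(fw k Kk) pinv.
Qed.

End Averaging.

Section BaseChange.
Variables (gT : preTopGroupType) (ssG : small_subgroups gT).
Variables (R L : comNzRingType) (chi : {rmorphism R -> L}) (QR : rational_algebra R).
Variable M : gmodule gT R.
Local Notation ocs := open_compact_subgroup.
Local Notation ME := (gm_ext chi M).

Lemma gm_ext_act g m a : gm_act g (tens_pure chi m a : ME) = tens_pure chi (gm_act g m) a.
Proof. by rewrite /= tens_map_pure //; exact: gm_act_linear. Qed.

Lemma fixed_tens_pure (K : set gT) m a : m \in fixed M K -> (tens_pure chi m a : ME) \in fixed ME K.
Proof. by move=> /fixedP fm; apply/fixedP => k Kk; rewrite gm_ext_act fm. Qed.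

Lemma smooth_ext : smooth M -> smooth ME.
Proof.
move=> sm; apply: tens_ind => [|t u [K oK ft] [K' oK' fu]|m a].
- by have [K oK _] := sm 0; exists K => //; exact: fixed0.
- exists (K `&` K'); first exact: ocsI.
  apply: (@fixedD _ _ ME); [exact: fixedS ft|exact: fixedS fu].
- by have [K oK fm] := sm m; exists K => //; exact: fixed_tens_pure.
Qed.

Hypothesis sm : smooth M.

Lemma average_tens_pure (K : set gT) m a : ocs K ->
  average K (tens_pure chi m a : ME) = tens_pure chi (average K m) a.
Proof.
move=> oK; have QL := rational_algebra_ext chi QR.
have [K' [r [c [oK' K'K fv [tr ec] ->]]]] := averageP ssG QR sm m oK.
apply: (averageE ssG QL (smooth_ext sm)) => //.
exists K', r, (chi c); split=> //; first exact: fixed_tens_pure.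
  by split=> //; rewrite -(rmorph_nat chi) -rmorphM ec rmorph1.
under [in RHS]eq_bigr => k _ do rewrite gm_ext_act.
by rewrite -tens_pure_sum tens_pureZ scale_tens_pure.
Qed.

(** An invariant tensor is its own average, and averaging a pure tensor averages its
    first factor. *)
Lemma fixed_ext_ind (K : set gT) (P : ME -> Prop) : ocs K -> P 0 ->
  (forall t u, P t -> P u -> P (t + u)) ->
  (forall m a, m \in fixed M K -> P (tens_pure chi m a)) ->
  forall t, t \in fixed ME K -> P t.
Proof.
move=> oK P0 PD Pp t ft; have QL := rational_algebra_ext chi QR.
rewrite -(average_id ssG QL (smooth_ext sm) oK ft).
have avgD u u' : average K (u + u' : ME) = average K u + average K u'.
  rewrite -{1}[u]scale1r (average_linear ssG QL (smooth_ext sm) _ _ _ oK).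
  by rewrite scale1r.
elim/tens_ind: t {ft} => [|t u IHt IHu|m a].
- by rewrite (average_id ssG QL (smooth_ext sm) oK) // fixed0.
- by rewrite avgD; exact: PD.
- rewrite average_tens_pure //; apply: Pp.
  exact: average_fixed.
Qed.

End BaseChange.

(** * Dual families of vectors *)

Section Bilinear.
Variables (R S : comNzRingType) (f : {rmorphism R -> S}) (V W : lmodType R).
Variable p : V -> W -> S.
Hypothesis bp : bilinear_map f p.

Lemma bil0l w : p 0 w = 0.
Proof. by have [pl _] := bp; have := pl (-1) 0 0 w; rewrite scaleN1r oppr0 addr0 rmorphN1 mulN1r addNr. Qed.
Lemma bil0r v : p v 0 = 0.
Proof. by have [_ pr] := bp; have := pr (-1) v 0 0; rewrite scaleN1r oppr0 addr0 rmorphN1 mulN1r addNr. Qed.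
Lemma bilDl v v' w : p (v + v') w = p v w + p v' w.
Proof. by have [pl _] := bp; have := pl 1 v v' w; rewrite scale1r rmorph1 mul1r. Qed.
Lemma bilDr v w w' : p v (w + w') = p v w + p v w'.
Proof. by have [_ pr] := bp; have := pr 1 v w w'; rewrite scale1r rmorph1 mul1r. Qed.
Lemma bilZl a v w : p (a *: v) w = f a * p v w.
Proof. by have [pl _] := bp; have := pl a v 0 w; rewrite bil0l !addr0. Qed.
Lemma bilZr a v w : p v (a *: w) = f a * p v w.
Proof. by have [_ pr] := bp; have := pr a v w 0; rewrite bil0r !addr0. Qed.
Lemma bilNl v w : p (- v) w = - p v w.
Proof. by rewrite -scaleN1r bilZl rmorphN1 mulN1r. Qed.
Lemma bilNr v w : p v (- w) = - p v w.
Proof. by rewrite -scaleN1r bilZr rmorphN1 mulN1r. Qed.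
Lemma bil_suml (I : Type) (s : seq I) (P : pred I) (F : I -> V) w :
  p (\sum_(i <- s | P i) F i) w = \sum_(i <- s | P i) p (F i) w.
Proof. exact: (big_morph (fun v => p v w) (fun v v' => bilDl v v' w) (bil0l w)). Qed.
Lemma bil_sumr (I : Type) (s : seq I) (P : pred I) (F : I -> W) v :
  p v (\sum_(i <- s | P i) F i) = \sum_(i <- s | P i) p v (F i).
Proof. exact: (big_morph (p v) (bilDr v) (bil0r v)). Qed.
End Bilinear.

Section DualBases.
Variables (k : fieldType) (V W : lmodType k) (p : V -> W -> k).
Hypothesis bp : bilinear_map idfun p.

Record dual_families (A : set V) (B : set W) d (e : 'I_d -> V) (e' : 'I_d -> W) : Prop := {
  db_l : forall i, A (e i);
  db_r : forall i, B (e' i);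
  db_dual : forall i j, p (e i) (e' j) = (i == j)%:R;
  db_spanl : forall v, A v -> v = \sum_i p v (e' i) *: e i;
  db_spanr : forall w, B w -> w = \sum_i p (e i) w *: e' i
}.

(** A pairing of two finite-dimensional spaces that is non-degenerate on both
    sides puts the Gram matrix of any two spanning families into the form
    [pid_mx r]; the vectors of index at least [r] then vanish. *)
Lemma dual_families_ex (s : seq V) (t : seq W) (A : set V) (B : set W) :
  A = lin_span s -> B = lin_span t ->
  (forall v, A v -> (forall w, B w -> p v w = 0) -> v = 0) ->
  (forall w, B w -> (forall v, A v -> p v w = 0) -> w = 0) ->
  exists d (e : 'I_d -> V) (e' : 'I_d -> W), dual_families A B e e'.
Proof.
move=> eA eB ndl ndr.
pose m := size s; pose n := size t.
have spanA (c : 'I_m -> k) : A (\sum_i c i *: s`_i).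
  rewrite eA; exists (fun i => if insub i is Some j then c j else 0).
  by apply: eq_bigr => i _; rewrite insubT //= => lt_i; congr (c _ *: _); apply: val_inj.
have spanB (c : 'I_n -> k) : B (\sum_i c i *: t`_i).
  rewrite eB; exists (fun i => if insub i is Some j then c j else 0).
  by apply: eq_bigr => i _; rewrite insubT //= => lt_i; congr (c _ *: _); apply: val_inj.
pose P : 'M[k]_(m, n) := \matrix_(i, j) p s`_i t`_j.
pose r : nat := \rank P.
pose Lm := invmx (col_ebase P); pose Um := invmx (row_ebase P).
have LPU : Lm *m P *m Um = pid_mx r.
  rewrite -{1}(mulmx_ebase P) !mulmxA mulVmx ?col_ebase_unit // mul1mx.
  by rewrite -!mulmxA mulmxV ?row_ebase_unit // mulmx1.
pose f (i : 'I_m) : V := \sum_a Lm i a *: s`_a.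
pose g (j : 'I_n) : W := \sum_b Um b j *: t`_b.
have fA i : A (f i) by exact: spanA.
have gB j : B (g j) by exact: spanB.
have pfg i j : p (f i) (g j) = @pid_mx k m n r i j.
  rewrite -LPU mxE (bil_sumr bp); apply: eq_bigr => b _; rewrite (bilZr bp) mxE mulrC /=.
  congr (_ * _); rewrite (bil_suml bp); apply: eq_bigr => a _.
  by rewrite (bilZl bp) mxE.
have spanf v : A v -> exists c, v = \sum_i c i *: f i.
  rewrite eA => -[c ->]; exists (fun i => \sum_(a < m) c a * col_ebase P a i).
  under [RHS]eq_bigr => i _ do rewrite scaler_suml.
  rewrite exchange_big /=; apply: eq_bigr => a _.
  under eq_bigr => i _ do rewrite -scalerA scaler_sumr.
  under eq_bigr => i _ do rewrite scaler_sumr.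
  rewrite exchange_big /=.
  rewrite (eq_bigr (fun b => (c a * (col_ebase P *m Lm) a b) *: s`_b)); last first.
    by move=> b _; rewrite mxE mulr_sumr scaler_suml; apply: eq_bigr => i _; rewrite !scalerA mulrA.
  rewrite mulmxV ?col_ebase_unit // (bigD1 a) //= mxE eqxx mulr1 big1 ?addr0 // => b ba.
  by rewrite mxE eq_sym (negPf ba) mulr0 scale0r.
have spang w : B w -> exists c, w = \sum_i c i *: g i.
  rewrite eB => -[c ->]; exists (fun i => \sum_(a < n) c a * row_ebase P i a).
  under [RHS]eq_bigr => i _ do rewrite scaler_suml.
  rewrite exchange_big /=; apply: eq_bigr => a _.
  under eq_bigr => i _ do rewrite -scalerA scaler_sumr.
  under eq_bigr => i _ do rewrite scaler_sumr.
  rewrite exchange_big /=.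
  rewrite (eq_bigr (fun b => (c a * (Um *m row_ebase P) b a) *: t`_b)); last first.
    move=> b _; rewrite mxE mulr_sumr scaler_suml; apply: eq_bigr => i _.
    by rewrite !scalerA mulrA mulrAC -mulrA.
  rewrite mulVmx ?row_ebase_unit // (bigD1 a) //= mxE eqxx mulr1 big1 ?addr0 // => b ba.
  by rewrite mxE (negPf ba) mulr0 scale0r.
have f0 (i : 'I_m) : (r <= i)%N -> f i = 0.
  move=> ri; apply: ndl => // w /spang[c ->]; rewrite (bil_sumr bp) big1 // => j _.
  by rewrite (bilZr bp) pfg mxE [(i < r)%N]ltnNge ri andbF mulr0.
have g0 (j : 'I_n) : (r <= j)%N -> g j = 0.
  move=> rj; apply: ndr => // v /spanf[c ->]; rewrite (bil_suml bp) big1 // => i _.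
  by rewrite (bilZl bp) pfg mxE; case: eqP => [->|_]; rewrite ?[(j < r)%N]ltnNge ?rj ?mulr0.
pose wm := widen_ord (rank_leq_row P); pose wn := widen_ord (rank_leq_col P).
have pe i j : p (f (wm i)) (g (wn j)) = (i == j)%:R.
  by rewrite pfg mxE /= ltn_ord andbT.
have wmE (i : 'I_m) : (i < r)%N -> exists i', i = wm i'.
  by move=> ir; exists (Ordinal ir); apply: val_inj.
have wnE (i : 'I_n) : (i < r)%N -> exists i', i = wn i'.
  by move=> ir; exists (Ordinal ir); apply: val_inj.
exists r, (f \o wm), (g \o wn); split=> [i|i|i j|v Av|].
- exact: fA.
- exact: gB.
- exact: pe.
- apply/eqP; rewrite -subr_eq0; apply/eqP.
  have eS : \sum_i p v (g (wn i)) *: f (wm i) = \sum_a (\sum_i p v (g (wn i)) * Lm (wm i) a) *: s`_a.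
    under [RHS]eq_bigr => a _ do rewrite scaler_suml.
    rewrite exchange_big; apply: eq_bigr => i _ /=.
    by rewrite /f scaler_sumr; apply: eq_bigr => a _; rewrite scalerA.
  apply: ndl => [|w /spang[c ->]].
    move: Av; rewrite eS eA => -[c ->]; rewrite -sumrB.
    rewrite -eA; under eq_bigr => i _ do rewrite -scalerBl; exact: spanA.
  rewrite (bil_sumr bp) big1 // => j _; rewrite (bilZr bp).
  have [/wnE[j' ->]|/g0 ->] := ltnP j r; last by rewrite (bil0r bp) mulr0.
  rewrite (bilDl bp) (bilNl bp) (bil_suml bp) (bigD1 j') //= (bilZl bp) pe eqxx mulr1.
  rewrite big1 ?addr0 ?subrr ?mulr0 // => i ij.
  by rewrite (bilZl bp) pe (negPf ij) mulr0.
move=> w Bw; apply/eqP; rewrite -subr_eq0; apply/eqP.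
have eS : \sum_i p (f (wm i)) w *: g (wn i) = \sum_a (\sum_i p (f (wm i)) w * Um a (wn i)) *: t`_a.
  under [RHS]eq_bigr => a _ do rewrite scaler_suml.
  rewrite exchange_big; apply: eq_bigr => i _ /=.
  by rewrite /g scaler_sumr; apply: eq_bigr => a _; rewrite scalerA.
apply: ndr => [|v /spanf[c ->]].
  move: Bw; rewrite eS eB => -[c ->]; rewrite -sumrB.
  rewrite -eB; under eq_bigr => i _ do rewrite -scalerBl; exact: spanB.
rewrite (bil_suml bp) big1 // => j _; rewrite (bilZl bp).
have [/wmE[j' ->]|/f0 ->] := ltnP j r; last by rewrite (bil0l bp) mulr0.
rewrite (bilDr bp) (bilNr bp) (bil_sumr bp) (bigD1 j') //= (bilZr bp) pe eqxx mulr1.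
rewrite big1 ?addr0 ?subrr ?mulr0 // => i ij.
by rewrite (bilZr bp) pe eq_sym (negPf ij) mulr0.
Qed.

End DualBases.

(** * Hecke functions and traces of periods *)

Section HeckeAction.
Variables (gT : preTopGroupType) (ssG : small_subgroups gT).
Variables (RT : realType) (mu : {measure set (borel_type gT) -> \bar RT}).
Hypothesis mu_haar : rational_haar mu.
Variables (k : fieldType) (C : numFieldType) (tau : {rmorphism k -> C}).
Local Notation ocs := open_compact_subgroup.
Implicit Types (K : set gT) (f : gT -> k).

Lemma rational_field : rational_algebra k.
Proof.
move=> n n0; exists n%:R^-1; apply: mulVf.
by rewrite -(fmorph_eq0 tau) rmorph_nat pnatr_eq0 -lt0n.
Qed.
Local Notation Qk := rational_field.

Section OneModule.
Variable V : gmodule gT k.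
Implicit Types v w : V.

Lemma hecke_actE K f v s : ocs K -> right_invariant K f -> v \in fixed V K ->
  coset_free K s -> coset_cover K [set g | f g != 0] s ->
  hecke_act mu f v = \sum_(a <- s) ratr (vol mu K) *: (f a *: gm_act a v).
Proof.
move=> oK fK /fixedP vK sep cov; apply: (haar_integralE ssG mu_haar tau oK).
  by move=> g a Ka; rewrite fK // gm_actM vK.
split=> // g /= fg; apply: cov; apply: contra fg => /eqP ->.
by rewrite scale0r.
Qed.

Hypothesis smV : smooth V.

Lemma common_level f v w (K : set gT) : ocs K -> right_invariant K f -> exists K',
  [/\ ocs K', K' `<=` K, right_invariant K' f, v \in fixed V K' & w \in fixed V K'].
Proof.
move=> oK fK; have [K1 oK1 v1] := smV v; have [K2 oK2 v2] := smV w.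
exists (K `&` (K1 `&` K2)); split.
- exact: (ocsI ssG oK (ocsI ssG oK1 oK2)).
- by move=> g [].
- by move=> g a [Ka _]; exact: fK.
- by apply: fixedS v1 => g [_ []].
- by apply: fixedS v2 => g [_ []].
Qed.

Lemma hecke_act_linear f a v w : hecke_fun f ->
  hecke_act mu f (a *: v + w) = a *: hecke_act mu f v + hecke_act mu f w.
Proof.
move=> hf; have [K0 oK0 _] := smV v.
have [K [oK _ fK]] := hecke_bi_invariant ssG oK0 hf.
have rK : right_invariant K f.
  by move=> g b Kb; rewrite -(fK 1%g b g) ?mul1g //; exact: ocs_one oK.
have [K' [oK' _ fK' vK' wK']] := common_level v w oK rK.
have [s [sep cov]] := hecke_cover ssG oK' hf.
rewrite !(hecke_actE oK' fK' _ sep cov) //; last exact: fixed_linear.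
rewrite scaler_sumr -big_split; apply: eq_bigr => g _ /=.
by rewrite gm_act_linear !scalerDr !scalerA; congr (_ *: _ + _); ring.
Qed.

Lemma hecke_act_linear_fun f f' a v : hecke_fun f -> hecke_fun f' ->
  hecke_act mu (fun g => a * f g + f' g) v = a *: hecke_act mu f v + hecke_act mu f' v.
Proof.
move=> hf hf'; have [K0 oK0 vK0] := smV v.
have [K [oK KK0 fK]] := hecke_bi_invariant ssG oK0 hf.
have [K' [oK' K'K fK']] := hecke_bi_invariant ssG oK hf'.
have rK' : right_invariant K' f'.
  by move=> g b Kb; rewrite -(fK' 1%g b g) ?mul1g //; exact: ocs_one oK'.
have rK : right_invariant K' f.
  by move=> g b /K'K Kb; rewrite -(fK 1%g b g) ?mul1g //; exact: ocs_one oK.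
have vK' : v \in fixed V K' by apply: fixedS vK0 => g /K'K /KK0.
have cSS : compact (closure [set g | f g != 0] `|` closure [set g | f' g != 0]).
  by apply: compactU; [case: hf|case: hf'].
have [s [sep cov]] := compact_coset_cover ssG oK' cSS.
have c1 : coset_cover K' [set g | f g != 0] s.
  by move=> g /subset_closure hg; apply: cov; left.
have c2 : coset_cover K' [set g | f' g != 0] s.
  by move=> g /subset_closure hg; apply: cov; right.
rewrite (hecke_actE oK' rK vK' sep c1) (hecke_actE oK' rK' vK' sep c2).
rewrite (hecke_actE (s := s) oK' _ vK' sep) /=.
- rewrite scaler_sumr -big_split; apply: eq_bigr => g _ /=.
  by rewrite scalerDl scalerDr !scalerA; congr (_ *: _ + _); ring.
- by move=> g b Kb; rewrite rK ?rK'.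
move=> g /= hg; have [fg|fg] := eqVneq (f g) 0; last exact: c1.
by apply: c2 => /=; move: hg; rewrite fg mulr0 add0r.
Qed.

(** [f] acts through the projection onto the [K]-invariants: sum first over a
    coset [a K] of the support, on which [f] is constant. *)
Lemma hecke_act_average f K v : ocs K -> hecke_fun f -> right_invariant K f ->
  hecke_act mu f (average K v) = hecke_act mu f v.
Proof.
move=> oK hf fK; have fixA := average_fixed ssG Qk smV v oK.
have [K' [r [c [oK' K'K vK' [tr ec] eA]]]] := averageP ssG Qk smV v oK.
have [s [sep cov]] := hecke_cover ssG oK hf.
have fK' : right_invariant K' f by move=> g b /K'K; exact: fK.
have [sep' cov'] := coset_system_refine oK oK' K'K tr (conj sep cov : coset_system K f s).
rewrite (hecke_actE oK fK fixA sep cov) (hecke_actE oK' fK' vK' sep' cov').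
rewrite big_allpairs_dep eA; apply: eq_bigr => a _.
have [_ rK _] := tr.
rewrite gm_actZ gm_act_sum !scaler_sumr; apply: eq_big_seq => b /rK Kb.
rewrite fK // gm_actM !scalerA; congr (_ *: _).
rewrite (vol_index ssG mu_haar oK oK' tr K'K) (ratr_mulrn tau) -mulr_natr.
have -> : ratr (vol mu K') * (size r)%:R * f a * c = ratr (vol mu K') * f a * (c * (size r)%:R) by ring.
by rewrite ec mulr1.
Qed.

End OneModule.

Section Pairing.
Variables (V W : gmodule gT k) (p : V -> W -> k).
Hypotheses (smV : smooth V) (smW : smooth W) (adV : admissible V) (adW : admissible W).
Hypotheses (bp : bilinear_map idfun p) (ip : invariant_pairing p) (ndp : Defs.nondegenerate p).

Definition level_bases K d (e : 'I_d -> V) (e' : 'I_d -> W) : Prop :=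
  dual_families p [set v | v \in fixed V K] [set w | w \in fixed W K] e e'.

Lemma flip_bilinear : bilinear_map idfun (fun w v => p v w).
Proof. by case: bp => h1 h2; split=> *; [exact: h2|exact: h1]. Qed.

Lemma average_pairing_r K v w : ocs K -> v \in fixed V K -> p v (average K w) = p v w.
Proof.
move=> oK vK; apply: (average_pairing ssG Qk (p := fun w v => p v w) w oK smW flip_bilinear _ vK).
by move=> g w' v'; exact: ip.
Qed.

Lemma level_bases_ex K : ocs K -> exists d (e : 'I_d -> V) (e' : 'I_d -> W), level_bases K e e'.
Proof.
move=> oK; have [s es] := adV oK; have [t et] := adW oK.
apply: (dual_families_ex bp es et) => [v vK h|w wK h].
  apply: (proj1 ndp) => w; rewrite -(average_pairing_r w oK vK).
  exact/h/(average_fixed ssG Qk).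
apply: (proj2 ndp) => v; rewrite -(average_pairing ssG Qk v oK smV bp ip wK).
exact/h/(average_fixed ssG Qk).
Qed.

(** The inverse of the Gram matrix turns [l] into the family dual to [e], which spans
    the invariants of [W] because the pairing is non-degenerate. *)
Lemma level_bases_of_gram K d (e : 'I_d -> V) (l : 'I_d -> W) (P Q : 'M[k]_d) : ocs K ->
  (forall i, e i \in fixed V K) -> (forall j, l j \in fixed W K) ->
  (forall v, v \in fixed V K -> exists a : 'I_d -> k, v = \sum_i a i *: e i) ->
  (forall i j, p (e i) (l j) = P i j) -> P *m Q = 1%:M ->
  level_bases K e (fun j => \sum_i Q i j *: l i).
Proof.
move=> oK eK lK spe gram PQ; set e' := fun j => _.
have e'K j : e' j \in fixed W K by apply: fixed_sum => i _; exact: fixedZ.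
have dual i j : p (e i) (e' j) = (i == j)%:R.
  have /matrixP /(_ i j) := PQ; rewrite !mxE => <-.
  rewrite (bil_sumr bp); apply: eq_bigr => a _.
  by rewrite (bilZr bp) gram mulrC.
have coord (a : 'I_d -> k) j : p (\sum_i a i *: e i) (e' j) = a j.
  rewrite (bil_suml bp) (bigD1 j) //= (bilZl bp) dual eqxx mulr1 big1 ?addr0 // => i ij.
  by rewrite (bilZl bp) dual (negPf ij) mulr0.
split=> // [v /spe[a ->]|w wK]; first by apply: eq_bigr => i _; rewrite coord.
apply/eqP; rewrite -subr_eq0; apply/eqP; apply: (proj2 ndp) => v.
set w' := w - _; have w'K : w' \in fixed W K.
  by rewrite /w' -scaleN1r addrC; apply: fixed_linear => //; apply: fixed_sum => i _; exact: fixedZ.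
rewrite -(average_pairing ssG Qk v oK smV bp ip w'K).
have [a ->] := spe _ (average_fixed ssG Qk smV v oK).
rewrite (bil_suml bp) big1 // => i _; suff -> : p (a i *: e i) w' = a i * 0 by rewrite mulr0.
rewrite (bilZl bp); congr (_ * _).
rewrite /w' (bilDr bp) (bilNr bp) (bil_sumr bp _ _ (fun j => p (e j) w *: e' j)) (bigD1 i) //=.
rewrite (bilZr bp) dual eqxx mulr1 big1 ?addr0 ?subrr // => j ji.
by rewrite (bilZr bp) dual eq_sym (negPf ji) mulr0.
Qed.

(** The element [\sum_i e_i ⊗ e'_i] at a smaller level projects to the one at
    the larger level. *)
Lemma level_trace K K' (B : V -> W -> k) d (e : 'I_d -> V) (e' : 'I_d -> W)
    d' (f : 'I_d' -> V) (f' : 'I_d' -> W) :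
  ocs K -> ocs K' -> K' `<=` K -> level_bases K e e' -> level_bases K' f f' ->
  bilinear_map idfun B -> (forall v w, B (average K v) w = B v w) ->
  \sum_j B (f j) (f' j) = \sum_i B (e i) (e' i).
Proof.
move=> oK oK' K'K de df bB BK.
have eK i : e' i \in fixed W K by exact: (db_r de).
transitivity (\sum_j \sum_i p (f j) (e' i) * B (e i) (f' j)).
  apply: eq_bigr => j _; rewrite -BK.
  rewrite {1}(db_spanl de (v := average K (f j))); last exact: (average_fixed ssG Qk smV _ oK).
  rewrite (bil_suml bB); apply: eq_bigr => i _; rewrite (bilZl bB) /=; congr (_ * _).
  exact: (average_pairing ssG Qk _ oK smV bp ip).
rewrite exchange_big; apply: eq_bigr => i _ /=.
rewrite [in RHS](db_spanr df (w := e' i)); last by apply: fixedS (eK i).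
by rewrite (bil_sumr bB); apply: eq_bigr => j _; rewrite (bilZr bB).
Qed.

Definition character_sum f (B : V -> W -> k) d (e : 'I_d -> V) (e' : 'I_d -> W) : k :=
  \sum_i B (hecke_act mu f (e i)) (e' i).

(** Both levels are compared with their intersection through [level_trace], which
    applies because [f] acts through the projections to the invariants. *)
Lemma character_sum_unique f (B : V -> W -> k) K1 d1 (e1 : 'I_d1 -> V) (e1' : 'I_d1 -> W)
    K2 d2 (e2 : 'I_d2 -> V) (e2' : 'I_d2 -> W) : hecke_fun f -> bilinear_map idfun B ->
  ocs K1 -> right_invariant K1 f -> level_bases K1 e1 e1' ->
  ocs K2 -> right_invariant K2 f -> level_bases K2 e2 e2' ->
  character_sum f B e1 e1' = character_sum f B e2 e2'.
Proof.
move=> hf bB oK1 f1 b1 oK2 f2 b2; have oI := ocsI ssG oK1 oK2.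
have [d [e [e' be]]] := level_bases_ex oI.
have bB' : bilinear_map idfun (fun v w => B (hecke_act mu f v) w).
  case: bB => h1 h2; split=> [a v v' w|a v w w']; last exact: h2.
  by rewrite hecke_act_linear.
rewrite /character_sum.
rewrite -(level_trace oK1 oI (@subIsetl _ _ _) b1 be bB'); last first.
  by move=> v w; rewrite hecke_act_average.
rewrite (level_trace oK2 oI (@subIsetr _ _ _) b2 be bB') //.
by move=> v w; rewrite hecke_act_average.
Qed.

Lemma level_bases_is_basis K d (e : 'I_d -> V) (e' : 'I_d -> W) : level_bases K e e' ->
  is_basis [set v | v \in fixed V K] e /\ is_basis [set w | w \in fixed W K] e'.
Proof.
case=> h1 h2 h3 h4 h5; split; split=> //.
- by move=> v vK; eexists; exact: h4.
- move=> c c0 i; have := bil0l bp (e' i); rewrite -c0 (bil_suml bp) (bigD1 i) //=.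
  rewrite (bilZl bp) h3 eqxx mulr1 big1 ?addr0 // => j ji.
  by rewrite (bilZl bp) h3 (negPf ji) mulr0.
- by move=> v vK; eexists; exact: h5.
move=> c c0 i; have := bil0r bp (e i); rewrite -c0 (bil_sumr bp) (bigD1 i) //=.
rewrite (bilZr bp) h3 eqxx mulr1 big1 ?addr0 // => j ji.
by rewrite (bilZr bp) h3 eq_sym (negPf ji) mulr0.
Qed.

Lemma is_basis_level_bases K d (e : 'I_d -> V) (e' : 'I_d -> W) :
  is_basis [set v | v \in fixed V K] e -> is_basis [set w | w \in fixed W K] e' ->
  (forall i j, p (e i) (e' j) = (i == j)%:R) -> level_bases K e e'.
Proof.
move=> [h1 h2 _] [h1' h2' _] h3; split=> // [v /h2[c ->]|w /h2'[c ->]].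
  apply: eq_bigr => i _; congr (_ *: _).
  rewrite (bil_suml bp) (bigD1 i) //= (bilZl bp) h3 eqxx mulr1 big1 ?addr0 // => j ji.
  by rewrite (bilZl bp) h3 (negPf ji) mulr0.
apply: eq_bigr => i _; congr (_ *: _).
rewrite (bil_sumr bp) (bigD1 i) //= (bilZr bp) h3 eqxx mulr1 big1 ?addr0 // => j ji.
by rewrite (bilZr bp) h3 eq_sym (negPf ji) mulr0.
Qed.

End Pairing.

(** Contragredients are unique: [w] goes to the vector of [W'] representing
    [p _ w], which exists at every finite level. *)
Lemma contragredient_unique (V W W' : gmodule gT k) (p : V -> W -> k) (p' : V -> W' -> k) :
  smooth V -> admissible V -> contragredient p -> contragredient p' ->
  exists2 u : W -> W', gm_iso u & forall v w, p' v (u w) = p v w.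
Proof.
move=> smV adV [smW adW bp ip ndp] [smW' adW' bp' ip' ndp'].
have tr (A A' : gmodule gT k) (q : V -> A -> k) (q' : V -> A' -> k) :
    smooth A -> smooth A' -> admissible A' -> bilinear_map idfun q -> bilinear_map idfun q' ->
    invariant_pairing q -> invariant_pairing q' ->
    Defs.nondegenerate q' -> forall w, exists w', forall v, q' v w' = q v w.
  move=> sA sA' aA' bq bq' iq iq' nq' w; have [K oK wK] := sA w.
  have [d [e [e' b]]] := level_bases_ex smV sA' adV aA' bq' iq' nq' oK.
  exists (\sum_i q (e i) w *: e' i) => v.
  have fK : \sum_i q (e i) w *: e' i \in fixed A' K.
    by apply: fixed_sum => i _; apply: fixedZ; exact: (db_r b).
  rewrite -(average_pairing ssG Qk v oK smV bq' iq' fK).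
  rewrite -(average_pairing ssG Qk v oK smV bq iq wK).
  have aK := average_fixed ssG Qk smV v oK.
  rewrite (bil_sumr bq') [in RHS](db_spanl b aK) (bil_suml bq).
  by apply: eq_bigr => i _; rewrite (bilZr bq') (bilZl bq) mulrC.
have sep (A : gmodule gT k) (q : V -> A -> k) : bilinear_map idfun q -> Defs.nondegenerate q ->
    forall w w', (forall v, q v w = q v w') -> w = w'.
  move=> bq nq w w' h; apply/eqP; rewrite -subr_eq0; apply/eqP; apply: (proj2 nq) => v.
  by rewrite (bilDr bq) (bilNr bq) h subrr.
have /choice[u hu] := tr _ _ _ _ smW smW' adW' bp bp' ip ip' ndp'.
have /choice[u' hu'] := tr _ _ _ _ smW' smW adW bp' bp ip' ip ndp.
exists u => //; split.
- move=> a w w'; apply: (sep _ _ bp' ndp') => v.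
  by rewrite hu (bilDr bp) (bilZr bp) (bilDr bp') (bilZr bp') !hu.
- exists u' => w; [apply: (sep _ _ bp ndp)|apply: (sep _ _ bp' ndp')] => v.
    by rewrite hu' hu.
  by rewrite hu hu'.
move=> g w; apply: (sep _ _ bp' ndp') => v.
rewrite hu -{1}(gm_actK g v) ip -hu.
by rewrite -{2}(gm_actK g v) ip'.
Qed.

End HeckeAction.

(** * Extension of scalars and complex spherical characters *)

Section Span.
Variables (R : comNzRingType) (V : lmodType R).
Implicit Types (s : seq V) (S : set V).

Lemma lin_spanP s v : lin_span s v <-> exists c : 'I_(size s) -> R, v = \sum_i c i *: s`_i.
Proof.
split=> [[c ->]|[c ->]]; first by exists (fun i => c i).
exists (fun i => if insub i is Some j then c j else 0).
by apply: eq_bigr => i _; rewrite insubT //= => lt_i; congr (c _ *: _); apply: val_inj.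
Qed.

Lemma lin_span_linear s a v w : lin_span s v -> lin_span s w -> lin_span s (a *: v + w).
Proof.
move=> [c ->] [d ->]; exists (fun i => a * c i + d i).
rewrite scaler_sumr -big_split; apply: eq_bigr => i _.
by rewrite scalerDl scalerA.
Qed.

Lemma lin_span0 s : lin_span s 0.
Proof. by exists (fun=> 0); rewrite big1 // => i _; rewrite scale0r. Qed.

Lemma lin_span_mem s v : v \in s -> lin_span s v.
Proof.
move=> vs; apply/lin_spanP; have iv : (index v s < size s)%N by rewrite index_mem.
exists (fun i => (i == Ordinal iv)%:R).
rewrite (bigD1 (Ordinal iv)) //= eqxx scale1r nth_index // big1 ?addr0 // => i ne.
by rewrite (negPf ne) scale0r.
Qed.

Lemma lin_span_min s S : S 0 -> (forall a v w, S v -> S w -> S (a *: v + w)) ->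
  (forall v, v \in s -> S v) -> lin_span s `<=` S.
Proof.
move=> S0 SD sS _ [c ->]; elim/big_ind: _ => // [v w Sv Sw|i _].
  by rewrite -[v]scale1r; exact: SD.
by rewrite -[_ *: _]addr0; apply: SD => //; apply/sS/mem_nth.
Qed.

End Span.

Section ExtAdmissible.
Variables (gT : preTopGroupType) (ssG : small_subgroups gT).
Variables (R L : comNzRingType) (chi : {rmorphism R -> L}) (QR : rational_algebra R).
Variable M : gmodule gT R.

(** The invariants are spanned by the [m ⊗ 1], with [m] among generators of [M^K]. *)
Lemma admissible_ext : smooth M -> admissible M -> admissible (gm_ext chi M).
Proof.
move=> sm ad K oK; have [s es] := ad K oK.
exists [seq (tens_pure chi m 1 : gm_ext chi M) | m <- s].
apply/seteqP; split=> [t|t].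
  apply: (fixed_ext_ind (M := M) ssG QR sm oK).
  - exact: lin_span0.
  - by move=> t1 t2 h1 h2; rewrite -[t1]scale1r; exact: lin_span_linear.
  move=> m a mK; have : lin_span s m by rewrite -es.
  move: m {mK}; apply: lin_span_min.
  - by rewrite tens_pure0; exact: lin_span0.
  - move=> r v w hv hw; rewrite tens_pureDl tens_pureZ -scale_tens_pure.
    exact: lin_span_linear.
  move=> v vs; rewrite tens_pureE -[_ *: _]addr0.
  apply: lin_span_linear; last exact: lin_span0.
  by apply: lin_span_mem; exact: map_f.
apply: lin_span_min.
- exact: fixed0.
- by move=> a v w; exact: fixed_linear.
move=> _ /mapP[m ms ->]; apply: fixed_tens_pure.
have := lin_span_mem ms; by rewrite -es.
Qed.

Lemma invariant_pairing_ext (N : gmodule gT R) (p : M -> N -> R) :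
  bilinear_map idfun p -> invariant_pairing p ->
  invariant_pairing (V := gm_ext chi M) (W := gm_ext chi N) (@tens_pairing _ _ chi M N p).
Proof.
move=> bp ip; have bC := tens_pairing_bilinear chi bp.
move=> g t u; elim/tens_ind: t => [|t1 t2 IH1 IH2|m a].
- by rewrite gm_act0 !(bil0l bC).
- by rewrite gm_actD !(bilDl bC) IH1 IH2.
elim/tens_ind: u => [|u1 u2 IH1 IH2|n c].
- by rewrite gm_act0 !(bil0r bC).
- by rewrite gm_actD !(bilDr bC) IH1 IH2.
by rewrite !gm_ext_act !tens_pairing_pure // ip.
Qed.
End ExtAdmissible.

Lemma hecke_fun_ext (gT : preTopGroupType) (k L : fieldType) (tau : {rmorphism k -> L})
    (f : gT -> k) : hecke_fun f -> hecke_fun (tau \o f).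
Proof.
move=> [lc cf]; split.
  move=> g; have h : nbhs g [set h | f h = f g] := lc g.
  have sub : [set h | f h = f g] `<=` [set h | tau (f h) = tau (f g)] by move=> h' /= ->.
  exact: filterS sub h.
suff -> : [set g | (tau \o f) g != 0] = [set g | f g != 0] by [].
by apply/seteqP; split=> g /=; rewrite fmorph_eq0.
Qed.

Section FieldExtension.
Variables (gT : preTopGroupType) (ssG : small_subgroups gT).
Variables (k : fieldType) (C : numFieldType) (tau : {rmorphism k -> C}).
Variables (V W : gmodule gT k) (p : V -> W -> k).
Hypotheses (smV : smooth V) (smW : smooth W) (adV : admissible V) (adW : admissible W).
Hypotheses (bp : bilinear_map idfun p) (ip : invariant_pairing p) (ndp : Defs.nondegenerate p).
Local Notation ocs := open_compact_subgroup.
Local Notation VC := (gm_ext tau V).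
Local Notation WC := (gm_ext tau W).
Local Notation pC := (@tens_pairing _ _ tau V W p : VC -> WC -> C).
Local Notation Qk := (rational_field tau).

Lemma bilinear_ext : bilinear_map idfun pC.
Proof. exact: tens_pairing_bilinear. Qed.

Lemma invariant_ext : invariant_pairing pC.
Proof. exact: invariant_pairing_ext. Qed.

Lemma level_bases_ext (K : set gT) d (e : 'I_d -> V) (e' : 'I_d -> W) : ocs K ->
  level_bases p K e e' ->
  level_bases pC K (fun i => tens_pure tau (e i) 1) (fun i => tens_pure tau (e' i) 1).
Proof.
move=> oK [eK e'K dd spl spr]; have bC := bilinear_ext; split.
- by move=> i; apply: fixed_tens_pure; exact: eK.
- by move=> i; apply: fixed_tens_pure; exact: e'K.
- by move=> i j; rewrite tens_pairing_pure // !mulr1 dd rmorph_nat.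
- apply: (fixed_ext_ind (M := V) ssG Qk smV oK).
  + by rewrite big1 // => i _; rewrite (bil0l bC) scale0r.
  + move=> t u {1}-> {1}->; rewrite -big_split; apply: eq_bigr => i _ /=.
    by rewrite (bilDl bC) scalerDl.
  move=> m a mK; rewrite {1}(spl _ mK) tens_pure_sum; apply: eq_bigr => i _.
  by rewrite tens_pairing_pure // tens_pureZ scale_tens_pure !mulr1.
apply: (fixed_ext_ind (M := W) ssG Qk smW oK).
+ by rewrite big1 // => i _; rewrite (bil0r bC) scale0r.
+ move=> t u {1}-> {1}->; rewrite -big_split; apply: eq_bigr => i _ /=.
  by rewrite (bilDr bC) scalerDl.
move=> m a mK; rewrite {1}(spr _ mK) tens_pure_sum; apply: eq_bigr => i _.
by rewrite tens_pairing_pure // tens_pureZ scale_tens_pure !mulr1 mul1r.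
Qed.

(** A vector lies at some level, where its coordinates are given by pairing with a
    dual basis that is defined over [k]. *)
Lemma nondegenerate_ext : Defs.nondegenerate pC.
Proof.
split=> t h.
  have [K oK tK] := smooth_ext ssG (chi := tau) smV t.
  have [d [e [e' b]]] := level_bases_ex ssG tau smV smW adV adW bp ip ndp oK.
  by rewrite (db_spanl (level_bases_ext oK b) tK) big1 // => i _; rewrite h scale0r.
have [K oK tK] := smooth_ext ssG (chi := tau) smW t.
have [d [e [e' b]]] := level_bases_ex ssG tau smV smW adV adW bp ip ndp oK.
by rewrite (db_spanr (level_bases_ext oK b) tK) big1 // => i _; rewrite h scale0r.
Qed.

Lemma contragredient_ext : contragredient pC.
Proof.
split.
- exact: smooth_ext.
- exact (admissible_ext ssG tau Qk smW adW).
- exact: bilinear_ext.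
- exact: invariant_ext.
- exact: nondegenerate_ext.
Qed.

Variables (RT : realType) (mu : {measure set (borel_type gT) -> \bar RT}).
Hypothesis mu_haar : rational_haar mu.

Lemma hecke_act_ext (f : gT -> k) v : hecke_fun f ->
  hecke_act mu (tau \o f) (tens_pure tau v 1 : VC) = tens_pure tau (hecke_act mu f v) 1.
Proof.
move=> hf; have [K0 oK0 vK0] := smV v.
have [K [oK KK0 fK]] := hecke_bi_invariant ssG oK0 hf.
have rK : right_invariant K f.
  by move=> g b Kb; rewrite -(fK 1%g b g) ?mul1g //; exact: ocs_one oK.
have vK := fixedS KK0 vK0.
have [s [sep cov]] := hecke_cover ssG oK hf.
rewrite (hecke_actE ssG mu_haar tau oK rK vK sep cov).
rewrite (hecke_actE (s := s) ssG mu_haar (idfun : {rmorphism C -> C}) oK _ _ sep).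
- rewrite tens_pure_sum; apply: eq_bigr => g _.
  by rewrite !tens_pure_scale gm_ext_act fmorph_rat.
- by move=> g b Kb /=; rewrite rK.
- exact: fixed_tens_pure.
- by move=> g /=; rewrite fmorph_eq0 => /cov.
Qed.

Lemma character_sum_ext (f : gT -> k) (B : V -> W -> k) (B' : VC -> WC -> C)
    d (e : 'I_d -> V) (e' : 'I_d -> W) : hecke_fun f ->
  (forall v w, tau (B v w) = B' (tens_pure tau v 1) (tens_pure tau w 1)) ->
  tau (character_sum mu f B e e') = character_sum mu (tau \o f) B'
    (fun i => tens_pure tau (e i) 1) (fun i => tens_pure tau (e' i) 1).
Proof.
move=> hf hB; rewrite rmorph_sum; apply: eq_bigr => i _.
by rewrite hecke_act_ext.
Qed.

End FieldExtension.

Section SphericalCharacter.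
Variables (F : padicField) (Fbar : closedFieldType) (iota : {rmorphism F -> Fbar}).
Variables (n : nat) (G H : algGroup iota n) (RT : realType).
Local Notation C := (complex RT).
Local Notation GF := (points G).
Variables (D : plancherel G H RT) (Z : local_periods D).
Variable mu : {measure set (borel_type GF) -> \bar RT}.
Hypothesis mu_haar : rational_haar mu.
Let ssG : small_subgroups GF := points_small_subgroups G.

Lemma right_of_bi_invariant (T : Type) K (f : GF -> T) : open_compact_subgroup K ->
  bi_invariant_fun K f -> right_invariant K f.
Proof.
by move=> oK fK g b Kb; rewrite -(fK 1%g b g) ?mul1g //; exact: ocs_one oK.
Qed.

(** The choices in the definition do not matter: two contragredients are isomorphic
    and periods are compatible with isomorphisms; the level and the bases are
    covered by [character_sum_unique]. *)
Lemma spherical_characterE (V W : gmodule GF C) (p : V -> W -> C) K (f : GF -> C)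
    d (e : 'I_d -> V) (e' : 'I_d -> W) :
  smooth V -> admissible V -> appears D V -> contragredient p ->
  open_compact_subgroup K -> hecke_fun f -> bi_invariant_fun K f -> level_bases p K e e' ->
  spherical_character Z mu V f = character_sum mu f (lp_Z Z p) e e'.
Proof.
move=> smV adV apV cp oK hf fK be; rewrite /spherical_character; set A := [set c | _].
have [smW adW bp ip ndp] := cp.
(* The given data show that the set of values is not empty. *)
have Ae : A (character_sum mu f (lp_Z Z p) e e').
  exists K, W, p, d, e, e'; split=> //; first exact: (level_bases_is_basis bp be).
  exact: (db_dual be).
have [K0 [W0 [p0 [d0 [e0 [e0' [[oK0 fK0] cp0 [b0 b0'] dd0 ->]]]]]]] : A (xget 0 A).
  by apply: xgetPex; eexists; exact: Ae.
have [smW0 adW0 bp0 ip0 ndp0] := cp0.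
have tid : {rmorphism C -> C} := idfun.
have [u isou hu] := contragredient_unique ssG tid smV adV cp cp0.
have [ulin [u' uK u'K] uact] := isou.
have be0 := is_basis_level_bases bp0 b0 b0' dd0.
have u0 : u 0 = 0 by have := ulin (-1) 0 0; rewrite scaleN1r oppr0 addr0 scaleN1r addNr.
have beu : level_bases p0 K e (u \o e').
  case: be => eK e'K dd spl spr; split=> //.
  - move=> i; apply/fixedP => b Kb; rewrite /= -uact; congr (u _).
    by move/fixedP: (e'K i) => ->.
  - by move=> i j; rewrite /= hu.
  - by move=> v vK; rewrite {1}(spl v vK); apply: eq_bigr => i _; rewrite /= hu.
  move=> w /fixedP wK; rewrite -{1}(u'K w).
  have /spr {1}-> : [set w | w \in fixed W K] (u' w).
    by apply/fixedP => b Kb; apply: (can_inj uK); rewrite uact u'K wK.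
  rewrite (big_morph u (id1 := 0) (op1 := +%R)) //; last first.
    by move=> w1 w2; have := ulin 1 w1 w2; rewrite !scale1r.
  apply: eq_bigr => i _ /=; have := ulin (p (e i) (u' w)) (e' i) 0.
  by rewrite u0 !addr0 -hu u'K.
have bil0 : bilinear_map idfun (lp_Z Z p0) by exact: lp_bilinear.
rewrite -/(character_sum mu f (lp_Z Z p0) e0 e0').
rewrite (character_sum_unique ssG mu_haar tid smV smW0 adV adW0 bp0 ip0 ndp0 hf bil0
  oK0 (right_of_bi_invariant oK0 fK0) be0 oK (right_of_bi_invariant oK fK) beu).
apply: eq_bigr => i _ /=.
by apply: (lp_iso Z (u := idfun) (u' := u) apV cp).
Qed.

End SphericalCharacter.

(** * Spherical characters of fibres *)

Section FiberCharacters.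
Variables (F : padicField) (Fbar : closedFieldType) (iota : {rmorphism F -> Fbar}).
Variables (n : nat) (G H : algGroup iota n) (RT : realType).
Local Notation C := (complex RT).
Local Notation GF := (points G).
Variables (D : plancherel G H RT) (Z : local_periods D).
Variable mu : {measure set (borel_type GF) -> \bar RT}.
Hypothesis mu_haar : rational_haar mu.
Variables (E : fieldType) (R : comAlgType E).
Hypothesis QR : rational_algebra R.
Let ssG : small_subgroups GF := points_small_subgroups G.
Local Notation ocs := open_compact_subgroup.

Variables (Sigma : set (closed_point R)) (M M' : gmodule GF R) (p : M -> M' -> R).
Hypotheses (smM : smooth M) (adM : admissible M) (dp : dual_datum Sigma p).
Variable x : closed_point R.
Hypothesis Sx : Sigma x.
Variable tau0 : {rmorphism residue_field x -> C}.
Local Notation Mx := (fiber M x).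
Local Notation Mx' := (fiber M' x).
Local Notation px := (@fiber_pairing _ _ _ _ _ _ _ M M' p x).

Lemma fiber_smooth (N : gmodule GF R) : smooth N -> smooth (fiber N x).
Proof. exact: smooth_ext. Qed.

Lemma fiber_admissible (N : gmodule GF R) : smooth N -> admissible N -> admissible (fiber N x).
Proof. exact: admissible_ext. Qed.

Lemma fiber_pairing_bilinear : bilinear_map idfun px.
Proof. exact: tens_pairing_bilinear (dual_bilinear dp). Qed.

Lemma fiber_pairing_invariant : invariant_pairing px.
Proof. exact: invariant_pairing_ext (dual_bilinear dp) (dual_invariant dp). Qed.

Let smMx := fiber_smooth smM.
Let adMx := fiber_admissible smM adM.
Let smMx' := fiber_smooth (dual_smooth dp).
Let adMx' := fiber_admissible (dual_smooth dp) (dual_admissible dp).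
Let bpx := fiber_pairing_bilinear.
Let ipx := fiber_pairing_invariant.
Let ndx : Defs.nondegenerate px := dual_nondegenerate dp Sx.

Variable Zx : Mx -> Mx' -> residue_field x.
Hypothesis Zx_period : fiber_period Z p Zx.

Definition fiber_character_set (f : GF -> residue_field x) : set (residue_field x) :=
  [set c | exists K d (e : 'I_d -> Mx) (e' : 'I_d -> Mx'),
    [/\ ocs K, bi_invariant_fun K f, level_bases px K e e' & c = character_sum mu f Zx e e']].

Definition fiber_character_of f := xget 0 (fiber_character_set f).

Lemma fiber_character_ofE f K d (e : 'I_d -> Mx) (e' : 'I_d -> Mx') :
  hecke_fun f -> ocs K -> bi_invariant_fun K f -> level_bases px K e e' ->
  fiber_character_of f = character_sum mu f Zx e e'.
Proof.
move=> hf oK fK be; have [bZ _ _] := Zx_period.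
have [K0 [d0 [e0 [e0' [oK0 fK0 be0 ->]]]]] : fiber_character_set f (fiber_character_of f).
  by apply: xgetPex; exists (character_sum mu f Zx e e'), K, d, e, e'.
exact: (character_sum_unique ssG mu_haar tau0 smMx smMx' adMx adMx' bpx ipx ndx hf bZ
  oK0 (right_of_bi_invariant oK0 fK0) be0 oK (right_of_bi_invariant oK fK) be).
Qed.

Lemma some_ocs : exists K : set GF, ocs K.
Proof. by have [K oK _] := smM 0; exists K. Qed.

(** Additivity holds at a level common to the two functions. An embedding [tau]
    carries dual bases over [k(x)] to dual bases over the complex numbers, and the
    period [Zx] to the canonical one. *)
Lemma fiber_character_ofP : fiber_character Z mu M fiber_character_of.
Proof.
have [bZ _ hZ] := Zx_period; have [K0 oK0] := some_ocs.
split=> [a f f' hf hf'|tau f [irr app] hf].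
  have [K1 [oK1 _ fK1]] := hecke_bi_invariant ssG oK0 hf.
  have [K [oK KK1 f'K]] := hecke_bi_invariant ssG oK1 hf'.
  have fK : bi_invariant_fun K f by move=> k k' g /KK1 h /KK1 h'; exact: fK1.
  have [d [e [e' be]]] := level_bases_ex ssG tau0 smMx smMx' adMx adMx' bpx ipx ndx oK.
  rewrite (fiber_character_ofE hf oK fK be) (fiber_character_ofE hf' oK f'K be).
  have hff : hecke_fun (fun g => a * f g + f' g).
    split.
      move=> g; have h1 : nbhs g [set h | f h = f g] by case: hf => + _; apply.
      have h2 : nbhs g [set h | f' h = f' g] by case: hf' => + _; apply.
      have : nbhs g ([set h | f h = f g] `&` [set h | f' h = f' g]) by exact: filterI.
      have sub : [set h | f h = f g] `&` [set h | f' h = f' g] `<=`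
        [set h | a * f h + f' h = a * f g + f' g] by move=> h [/= -> ->].
      exact: filterS sub.
    have cc : compact (closure [set g | f g != 0] `|` closure [set g | f' g != 0]).
      by apply: compactU; [case: hf|case: hf'].
    apply: (subclosed_compact (@closed_closure _ _) cc); rewrite -closureU.
    apply: closure_subset => g /= hg.
    have [fg|fg] := eqVneq (f g) 0; last by left.
    by right; move: hg; rewrite /= fg mulr0 add0r.
  rewrite (fiber_character_ofE hff oK _ be); last first.
    by move=> k k' g Kk Kk'; rewrite fK // f'K.
  rewrite /character_sum mulr_sumr -big_split; apply: eq_bigr => i _ /=.
  by rewrite (hecke_act_linear_fun ssG mu_haar tau0 smMx) // (bilDl bZ) (bilZl bZ).
have [K [oK _ fK]] := hecke_bi_invariant ssG oK0 hf.
have [d [e [e' be]]] := level_bases_ex ssG tau0 smMx smMx' adMx adMx' bpx ipx ndx oK.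
rewrite (fiber_character_ofE hf oK fK be).
have cp := contragredient_ext ssG tau smMx smMx' adMx adMx' bpx ipx ndx.
have Qx := rational_field tau.
have b' := level_bases_ext ssG tau smMx smMx' bpx oK be.
rewrite (spherical_characterE (K := K) Z mu_haar (smooth_ext ssG (chi := tau) smMx)
   (admissible_ext ssG tau Qx smMx adMx) app cp oK (hecke_fun_ext tau hf) _ b'); last first.
  by move=> k k' g Kk Kk' /=; rewrite fK.
apply: (character_sum_ext ssG smMx mu_haar) => //.
by move=> v v'; apply: hZ.
Qed.

End FiberCharacters.

(** * Noetherian reduced rings *)

Section Noetherian.
Variables (E : fieldType) (R : comAlgType E).
Hypothesis noethR : noetherian R.

Definition is_ideal (I : set R) : Prop :=
  I 0 /\ forall a b c, I b -> I c -> I (a * b + c).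

Lemma ascending_chain (I : nat -> set R) : (forall n, is_ideal (I n)) ->
  (forall n, I n `<=` I n.+1) -> exists n, I n.+1 `<=` I n.
Proof.
move=> idI asc.
have mono m n : (m <= n)%N -> I m `<=` I n.
  by move=> /subnK <-; elim: (n - m)%N => [//|d IH] a /IH; exact: asc.
have [||s es] := noethR (I := \bigcup_n I n).
- by exists 0%N => //; case: (idI 0%N).
- move=> a b c [m _ Ib] [m' _ Ic]; exists (maxn m m') => //.
  apply: (proj2 (idI _)); first exact: (mono _ _ (leq_maxl m m')).
  exact: (mono _ _ (leq_maxr m m')).
have [N hN] : exists N, forall a, a \in s -> I N a.
  have : forall a, a \in s -> (\bigcup_n I n) a by move=> a ha; rewrite es; exact: (lin_span_mem (V := R^o) ha).
  elim: (s) => [|x t IH] ht; first by exists 0%N => a; rewrite in_nil.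
  have [|N hN] := IH; first by move=> a ta; apply: ht; rewrite inE ta orbT.
  have [m _ Ix] := ht x (mem_head _ _).
  exists (maxn m N) => a; rewrite inE => /orP[/eqP->|/hN].
    exact: (mono _ _ (leq_maxl m N)).
  exact: (mono _ _ (leq_maxr m N)).
exists N => a Ia.
have : (\bigcup_n I n) a by exists N.+1.
rewrite es; apply: (lin_span_min (V := R^o)) => //; first by case: (idI N).
by move=> c v w; apply: (proj2 (idI N)).
Qed.

Lemma maximal_ideal_ex (P : set (set R)) : (forall J, P J -> is_ideal J) -> P !=set0 ->
  exists J, P J /\ forall J', P J' -> J `<=` J' -> J' `<=` J.
Proof.
move=> idP [J0 PJ0]; apply: contrapT => nomax.
have bigger (J : {J | P J}) : exists J' : {J | P J}, sval J `<=` sval J' /\ ~ sval J' `<=` sval J.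
  case: J => J PJ /=; apply: contrapT => nobig; apply: nomax; exists J; split=> // J' PJ' JJ'.
  by apply: contrapT => nJ'J; apply: nobig; exists (exist _ J' PJ').
have [next hnext] := choice bigger.
pose I n := sval (iter n next (exist _ J0 PJ0)).
have [n|n|n hn] := @ascending_chain I; first exact: idP (svalP (iter n next _)).
  by rewrite /I iterS; case: (hnext (iter n next (exist _ J0 PJ0))).
by move: hn; rewrite /I iterS; case: (hnext (iter n next (exist _ J0 PJ0))).
Qed.

(** An ideal that is maximal among those containing no power of [a] is prime. *)
Lemma prime_avoiding (a : R) : (forall k, a ^+ k != 0) -> exists P : prime_point R, ~~ P a.
Proof.
move=> a0.
pose Fam : set (set R) := [set J | is_ideal J /\ forall k, ~ J (a ^+ k)].
have [||J [[idJ aJ] maxJ]] := @maximal_ideal_ex Fam; first by move=> J [].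
  exists [set 0]; split; last by move=> k /eqP; rewrite (negPf (a0 k)).
  by split=> // b c d /= -> ->; rewrite mulr0 addr0.
pose Q : R -> bool := fun b => `[< J b >].
have QP b : reflect (J b) (b \in (Q : {pred R})) by exact: asboolP.
have J1 : ~ J 1 by have := aJ 0%N; rewrite expr0.
have JM b c : J b -> J (c * b).
  by move=> Jb; rewrite -[_ * _]addr0; apply: (proj2 idJ) => //; case: idJ.
have JD b c : J b -> J c -> J (b + c).
  by move=> Jb Jc; rewrite -[b]mul1r; exact: (proj2 idJ).
have idQ : idealr_closed Q.
  split; first by apply/QP; case: idJ.
    exact/QP.
  by move=> c u v /QP Ju /QP Jv; apply/QP; exact: (proj2 idJ).
have add b : ~ J b -> exists k c d, J d /\ a ^+ k = c * b + d.
  move=> Jb; apply: contrapT => no; apply: Jb.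
  pose J' : set R := [set t | exists c d, J d /\ t = c * b + d].
  have JJ' : J `<=` J' by move=> t Jt; exists 0, t; rewrite mul0r add0r.
  apply: (maxJ J') => //; last by exists 1, 0; split; [case: idJ|rewrite mul1r addr0].
  split; last by move=> k [c [d [Jd e]]]; apply: no; exists k, c, d.
  split; first by apply: JJ'; case: idJ.
  move=> r _ _ [c [d [Jd ->]]] [c' [d' [Jd' ->]]].
  exists (r * c + c'), (r * d + d'); split; [exact: (proj2 idJ)|ring].
have prQ : prime_idealr_closed Q.
  move=> u v /QP Juv; apply/orP; apply: contrapT => nor.
  have [|k [c [d [Jd eu]]]] := add u; first by move=> Ju; apply: nor; left; exact/QP.
  have [|k' [c' [d' [Jd' ev]]]] := add v; first by move=> Jv; apply: nor; right; exact/QP.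
  apply: (aJ (k + k')%N); rewrite exprD eu ev.
  have -> : (c * u + d) * (c' * v + d') = (c * c') * (u * v) + ((c * u + d) * d' + (c' * v) * d).
    by ring.
  by apply: (JD _ _ (JM _ _ _) (JD _ _ (JM _ _ _) (JM _ _ _))).
exists (PrimePoint idQ prQ) => /=; apply/asboolP.
by have := aJ 1%N; rewrite expr1.
Qed.

Hypothesis redR : reduced_ring R.

(** By density such an [a] lies in all primes, so it is nilpotent. *)
Lemma dense_vanish (Sigma : set (closed_point R)) (a : R) : zariski_dense Sigma ->
  (forall x, Sigma x -> x a) -> a = 0.
Proof.
move=> dense h; apply: contrapT => a0.
have [|P Pa] := @prime_avoiding a.
  by move=> k; apply/eqP => /redR.
by have [|x Sx] := dense a; [exists P|rewrite h].
Qed.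

(** While [b] in [I] has a non-zero annihilator [c], some [e] in [I] has [c e <> 0];
    adding [c e] to [b] shrinks the annihilator, as the ring is reduced. *)
Lemma ideal_regular_element (I : set R) : is_ideal I ->
  (forall c, (forall b, I b -> c * b = 0) -> c = 0) ->
  exists2 b, I b & GRing.lreg b.
Proof.
move=> [I0 ID] annI; apply: contrapT => noreg.
have step (b : {b | I b}) : exists d : {b | I b}, sval b * sval d = 0 /\ sval d != 0.
  case: b => b Ib /=; apply: contrapT => no; apply: noreg; exists b => // u v buv.
  apply/eqP; rewrite -subr_eq0; apply/eqP; apply: annI => e Ie.
  have Ice : I ((u - v) * e) by rewrite -[_ * _]addr0; exact: ID.
  apply/eqP; apply: contrapT => /negP ne; apply: no; exists (exist _ _ Ice) => /=.
  by rewrite mulrA mulrBr buv subrr mul0r.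
have [D hD] := choice step.
have Ibd (b : {b | I b}) : I (sval b + sval (D b)).
  by rewrite -[sval b]mul1r; apply: ID; exact: svalP.
pose bs n := iter n (fun b => exist I _ (Ibd b)) (exist I 0 I0).
pose An n : set R := [set t | forall s, sval (bs n) * s = 0 -> t * s = 0].
have red2 (t : R) : t * t = 0 -> t = 0 by move=> e; apply: (redR (k := 2)); rewrite expr2.
have bsS n s : sval (bs n.+1) * s = 0 -> sval (bs n) * s = 0 /\ sval (D (bs n)) * s = 0.
  rewrite /bs iterS -/(bs n) /=; have [bd _] := hD (bs n).
  set b := sval (bs n); set d := sval (D (bs n)) => e.
  have bs0 : b * s = 0.
    apply: red2; have -> : b * s * (b * s) = b * s * ((b + d) * s) - (b * d) * s * s by ring.
    by rewrite e bd; ring.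
  by split=> //; rewrite -[RHS]e mulrDl bs0 add0r.
(* The annihilators of the annihilators of the [bs n] ascend strictly. *)
have [n|n|n hn] := @ascending_chain An.
- split=> [s _|a b c hb hc s hs]; first by rewrite mul0r.
  by rewrite mulrDl -mulrA (hb _ hs) (hc _ hs) mulr0 addr0.
- by move=> t ht s /bsS[/ht].
have [bd d0] := hD (bs n).
have : An n.+1 (sval (D (bs n))) by move=> s /bsS[].
by move=> /hn /(_ _ bd) /red2 e; rewrite e eqxx in d0.
Qed.

(** A module on which finitely many linear forms separate points embeds in a
    free module of finite rank; the values of one of the forms are an ideal, and the
    others handle its kernel. *)
Lemma noetherian_submodule (V : lmodType R) n (ev : 'I_n -> V -> R) (S : set V) :
  (forall i a v w, ev i (a *: v + w) = a * ev i v + ev i w) ->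
  S 0 -> (forall a v w, S v -> S w -> S (a *: v + w)) ->
  (forall v, S v -> (forall i, ev i v = 0) -> v = 0) ->
  exists s, S = lin_span s.
Proof.
elim: n ev S => [|n IH] ev S lev S0 SD inj.
  exists [::]; apply/seteqP; split=> [v Sv|_ [c ->]]; last by rewrite big_ord0.
  by rewrite (inj v Sv); [exact: lin_span0|case].
have ev0 i : ev i 0 = 0.
  by have := lev i (-1) 0 0; rewrite scaleN1r oppr0 addr0 mulN1r addNr.
have SZ a v : S v -> S (a *: v) by move=> Sv; rewrite -[_ *: _]addr0; exact: SD.
have [||s es] := noethR (I := [set ev ord0 v | v in S]).
- by exists 0.
- move=> a _ _ [v Sv <-] [w Sw <-]; exists (a *: v + w); [exact: SD|exact: lev].
have [s' es'] : exists s' : seq V, (forall v, v \in s' -> S v) /\ s = map (ev ord0) s'.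
  have : forall a, a \in s -> exists2 v, S v & ev ord0 v = a.
    move=> a ha; have : [set ev ord0 v | v in S] a by rewrite es; exact: (lin_span_mem (V := R^o) ha).
    by [].
  elim: (s) => [|a t IHt] ht; first by exists [::].
  have [|t' [h1 ->]] := IHt; first by move=> b bt; apply: ht; rewrite inE bt orbT.
  have [v Sv <-] := ht a (mem_head _ _).
  by exists (v :: t'); split=> // w; rewrite inE => /orP[/eqP->//|/h1].
have [Ss' es2] := es'.
have [||||t et] := IH (fun i => ev (lift ord0 i)) [set v | S v /\ ev ord0 v = 0].
- by move=> i; exact: lev.
- by split.
- by move=> a v w [Sv ev_] [Sw ew]; split; [exact: SD|rewrite lev ev_ ew mulr0 addr0].
- move=> v [Sv v0] h; apply: inj => // i.
  by have [j ->|->] := unliftP ord0 i.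
exists (s' ++ t); apply/seteqP; split=> v; last first.
  apply: lin_span_min => // w; rewrite mem_cat => /orP[/Ss'//|/lin_span_mem].
  by rewrite -et => -[].
move=> Sv; have : [set ev ord0 v | v in S] (ev ord0 v) by exists v.
rewrite es es2 => /lin_spanP; rewrite size_map => -[c ec].
pose w := \sum_(i < size s') c i *: s'`_i.
have sp u : lin_span t u -> lin_span (s' ++ t) u.
  apply: lin_span_min; [exact: lin_span0|by move=> *; exact: lin_span_linear|].
  by move=> z zt; apply: lin_span_mem; rewrite mem_cat zt orbT.
have Ww : lin_span (s' ++ t) w.
  have : lin_span s' w by apply/lin_spanP; exists c.
  apply: lin_span_min; [exact: lin_span0|by move=> *; exact: lin_span_linear|].
  by move=> z zt; apply: lin_span_mem; rewrite mem_cat zt.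
have Sw : S w.
  rewrite /w; elim/big_ind: _ => // [a b Sa Sb|i _].
    by rewrite -[a]scale1r; exact: SD.
  by apply/SZ/Ss'/mem_nth.
have ew : ev ord0 w = ev ord0 v.
  rewrite ec /w (big_morph (ev ord0) (id1 := 0) (op1 := +%R)) //.
    by apply: eq_bigr => i _; rewrite (nth_map 0) //; have := lev ord0 (c i) s'`_i 0; rewrite ev0 !addr0.
  by move=> a b; have := lev ord0 1 a b; rewrite scale1r mul1r.
have : lin_span t (v - w).
  rewrite -et; split; last first.
    by rewrite addrC -scaleN1r lev ew mulN1r addNr.
  by rewrite addrC -scaleN1r; exact: SD.
move=> /sp h; have -> : v = 1 *: (v - w) + w by rewrite scale1r subrK.
exact: lin_span_linear.
Qed.

End Noetherian.

(** * Total fractions with prescribed values *)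

Lemma cross_ratio (A : comNzRingType) (t s t' s' a a' : A) :
  t * s = 1 -> t' * s' = 1 -> a * s' = a' * s -> t * a = t' * a'.
Proof.
move=> e e' h; have -> : t * a = t * (t' * s') * a by rewrite e' mulr1.
have -> : t' * a' = t' * (t * s) * a' by rewrite e mulr1.
have -> : t * (t' * s') * a = t * t' * (a * s') by ring.
by rewrite h; ring.
Qed.

Section Points.
Variable R : comNzRingType.
Implicit Type x : closed_point R.

Lemma residue_neq0 x a : ~~ x a -> residue x a != 0.
Proof. by rewrite residue_eq0. Qed.

Lemma residue_eq0P x a : residue x a = 0 <-> x a.
Proof. by split=> [/eqP|xa]; [|apply/eqP]; rewrite residue_eq0. Qed.

Lemma point_mulP x a b : ~~ x a -> ~~ x b -> ~~ x (a * b).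
Proof.
move=> xa xb; have : residue x (a * b) != 0 by rewrite rmorphM mulf_neq0 ?residue_neq0.
by rewrite residue_eq0.
Qed.

End Points.

Section Fractions.
Local Open Scope quotient_scope.
Variables (E : fieldType) (R : comAlgType E).
Implicit Types (q : total_frac R) (x : closed_point R).

Lemma to_frac_inj : injective (@to_frac R).
Proof. by move=> a b /total_frac_eqP; rewrite !ratioE !mulr1. Qed.

Lemma to_frac_unit (s : R) : GRing.lreg s -> exists t : total_frac R, t * to_frac s = 1.
Proof.
move=> hs; exists (\pi_(total_frac R) (mk_ratio 1 hs)).
change (frac_mul (\pi_(total_frac R) (mk_ratio 1 hs)) (to_frac s) = to_frac 1).
rewrite /to_frac frac_mulE; apply/total_frac_eqP; rewrite !ratioE.
by rewrite /rnum /rden /= !mulr1 mul1r.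
Qed.

Lemma frac_numden q : exists a s : R, GRing.lreg s /\ to_frac s * q = to_frac a.
Proof.
elim/quotW: q => r; exists (rnum r), (rden r); split; first exact: rden_reg.
change (frac_mul (to_frac (rden r)) (\pi_(total_frac R) r) = to_frac (rnum r)).
by rewrite /to_frac frac_mulE; apply/total_frac_eqP; rewrite !ratioE; ring.
Qed.

(** Two denominators of [q] are compared in [R], as [to_frac] is injective. *)
Lemma has_value_den x q c a b : has_value q c -> to_frac b * q = to_frac a ->
  residue x a = residue x b * c.
Proof.
move=> [a' [b' [xb' e' ->]]] e; have nb' := residue_neq0 xb'.
have eR : b * a' = b' * a.
  by apply: to_frac_inj; rewrite !rmorphM /= -e' -e mulrCA.
apply: (mulfI nb'); rewrite -rmorphM -eR rmorphM /=.
by rewrite mulrCA; congr (_ * _); rewrite mulrC divfK.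
Qed.

Hypotheses (noethR : noetherian R) (redR : reduced_ring R).
Variable Sigma : set (closed_point R).
Hypothesis dense : zariski_dense Sigma.
Variable J : forall x, residue_field x.

(** The cross product of two such fractions vanishes on [Sigma]. *)
Lemma has_value_unique q q' : (forall x, Sigma x -> has_value q (J x)) ->
  (forall x, Sigma x -> has_value q' (J x)) -> q = q'.
Proof.
move=> h h'; have [a [s [ls e]]] := frac_numden q; have [a' [s' [ls' e']]] := frac_numden q'.
have eR : a * s' = a' * s.
  apply/eqP; rewrite -subr_eq0; apply/eqP; apply: (dense_vanish noethR redR dense) => x Sx.
  apply/residue_eq0P; rewrite rmorphB !rmorphM /=.
  by rewrite (has_value_den (h x Sx) e) (has_value_den (h' x Sx) e') mulrAC [X in _ - X]mulrAC [X in _ - X * _]mulrC subrr.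
have [t et] := to_frac_unit ls; have [t' et'] := to_frac_unit ls'.
have -> : q = t * to_frac a by rewrite -e mulrA et mul1r.
have -> : q' = t' * to_frac a' by rewrite -e' mulrA et' mul1r.
by apply: (cross_ratio et et'); rewrite -!rmorphM eR.
Qed.

(** The denominators of the function [J] form an ideal; it is contained in no
    point of [Sigma], so it contains a non-zero-divisor. *)
Lemma glue_values :
  (forall x, Sigma x -> exists b a, ~~ x b /\
     forall y, Sigma y -> ~~ y b -> residue y a = residue y b * J y) ->
  exists q, forall x, Sigma x -> has_value q (J x).
Proof.
move=> loc.
pose I : set R := [set b | exists a, forall y, Sigma y -> residue y a = residue y b * J y].
have locI x : Sigma x -> exists2 b, I b & ~~ x b.
  move=> Sx; have [b [a [xb hb]]] := loc x Sx.
  exists (b * b); last exact: point_mulP.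
  exists (b * a) => y Sy; rewrite !rmorphM /=.
  have [yb|yb] := boolP (y b); last by rewrite (hb y Sy yb) mulrA.
  by have /residue_eq0P -> := yb; rewrite !mul0r.
have idI : is_ideal I.
  split; first by exists 0 => y _; rewrite rmorph0 mul0r.
  move=> a b c [a1 h1] [a2 h2]; exists (a * a1 + a2) => y Sy.
  by rewrite !rmorphD !rmorphM /= (h1 y Sy) (h2 y Sy) mulrDl mulrA.
have [c hc|b [a hb] lb] := ideal_regular_element noethR redR idI.
  apply: (dense_vanish noethR redR dense) => x Sx; have [b Ib xb] := locI x Sx.
  apply/residue_eq0P; apply: (mulIf (residue_neq0 xb)).
  by rewrite -rmorphM hc // rmorph0 mul0r.
have [t et] := to_frac_unit lb.
exists (t * to_frac a) => x Sx; have [b' [a' hb'] xb'] := locI x Sx.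
exists a', b'; split=> //; last first.
  by rewrite (hb' x Sx) mulrC mulKf // residue_neq0.
have eR : b' * a = b * a'.
  apply/eqP; rewrite -subr_eq0; apply/eqP; apply: (dense_vanish noethR redR dense) => y Sy.
  apply/residue_eq0P; rewrite rmorphB !rmorphM /=.
  by rewrite (hb y Sy) (hb' y Sy) mulrCA subrr.
by rewrite mulrCA -rmorphM eR rmorphM mulrA et mul1r.
Qed.

End Fractions.

(** * Fibres of finitely generated modules *)

Section FiniteDimension.
Variables (k : fieldType) (V : lmodType k).

Definition spanning n (e : 'I_n -> V) : Prop := forall v, exists c : 'I_n -> k, v = \sum_i c i *: e i.

(** A spanning family of least size is a basis. *)
Lemma vdim_basis n0 (e0 : 'I_n0 -> V) : spanning e0 ->
  exists e : 'I_(vdim V) -> V, is_basis setT e.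
Proof.
move=> sp0; suff [d [e be]] : exists d (e : 'I_d -> V), is_basis setT e.
  have : [set d | exists e : 'I_d -> V, is_basis setT e] (vdim V).
    by apply: xgetPex; exists d, e.
  by [].
pose P n := `[< exists e : 'I_n -> V, spanning e >].
have exP : exists n, P n by exists n0; apply/asboolP; exists e0.
case: (ex_minnP exP) => d /asboolP[e spe] mind; exists d, e; split=> // c c0 i.
apply: contrapT => /eqP ci; case: d e spe mind c c0 i ci => [|d] e spe mind c c0 i ci.
  by case: i ci.
have : (d < d)%N; last by rewrite ltnn.
apply: mind; apply/asboolP; exists (fun j => e (lift i j)) => v.
have [a ->] := spe v.
have eqi : e i = \sum_j (- (c i)^-1 * c (lift i j)) *: e (lift i j).
  move: c0; rewrite (bigD1_ord i) //= => /(congr1 (fun v => (c i)^-1 *: v)).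
  rewrite scaler0 scalerDr scalerA mulVf // scale1r => /eqP; rewrite addr_eq0 => /eqP ->.
  rewrite scaler_sumr -sumrN; apply: eq_bigr => j _.
  by rewrite scalerA mulNr scaleNr.
exists (fun j => a i * (- (c i)^-1 * c (lift i j)) + a (lift i j)).
rewrite (bigD1_ord i) //= {1}eqi scaler_sumr -big_split; apply: eq_bigr => j _ /=.
by rewrite scalerA -scalerDl.
Qed.

Lemma basis_spanning n (e : 'I_n -> V) : is_basis setT e -> spanning e.
Proof. by case=> _ spe _ v; exact: spe. Qed.

(** The square matrices [A] and [B] expressing [e] and [m] in terms of each other
    satisfy [A B = 1], hence also [B A = 1]. *)
Lemma spanning_independent d (e m : 'I_d -> V) : is_basis setT e -> spanning m ->
  forall c : 'I_d -> k, \sum_i c i *: m i = 0 -> forall i, c i = 0.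
Proof.
move=> [_ spe inde] spm c c0.
have /choice[A hA] : forall i, exists a : 'I_d -> k, e i = \sum_j a j *: m j by move=> i; exact: spm.
have /choice[B hB] : forall i, exists a : 'I_d -> k, m i = \sum_j a j *: e j by move=> i; exact: spe.
pose MA : 'M[k]_d := \matrix_(i, j) A i j; pose MB : 'M[k]_d := \matrix_(i, j) B i j.
have comb (v : 'I_d -> k) (f g : 'I_d -> V) (D : 'I_d -> 'I_d -> k) :
    (forall i, f i = \sum_j D i j *: g j) ->
    \sum_i v i *: f i = \sum_j (\sum_i v i * D i j) *: g j.
  move=> h; under [RHS]eq_bigr => j _ do rewrite scaler_suml.
  rewrite exchange_big; apply: eq_bigr => i _ /=; rewrite h scaler_sumr.
  by apply: eq_bigr => j _; rewrite scalerA.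
have AB : MA *m MB = 1%:M.
  apply/matrixP => i j; apply/eqP; rewrite -subr_eq0; apply/eqP; move: j.
  apply: inde; under eq_bigr => j _ do rewrite scalerBl.
  rewrite sumrB; apply/eqP; rewrite subr_eq0; apply/eqP.
  have -> : \sum_j (1%:M : 'M[k]_d) i j *: e j = e i.
    rewrite (bigD1 i) //= mxE eqxx scale1r big1 ?addr0 // => j ji.
    by rewrite mxE eq_sym (negPf ji) scale0r.
  rewrite [RHS]hA (comb _ _ _ _ hB); apply: eq_bigr => j _; congr (_ *: _).
  by rewrite mxE; apply: eq_bigr => l _; rewrite !mxE.
pose cr : 'rV[k]_d := \row_i c i.
have crB : cr *m MB = 0.
  apply/rowP => j; rewrite mxE [in RHS]mxE; move: j.
  apply: (inde (fun j => \sum_l cr 0 l * MB l j)).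
  apply: etrans c0; rewrite (comb _ _ _ _ hB); apply: eq_bigr => j _; congr (_ *: _).
  by apply: eq_bigr => l _; rewrite !mxE.
move=> i; have -> : c i = cr 0 i by rewrite mxE.
by rewrite -[cr]mulmx1 -(mulmx1C AB) mulmxA crB mul0mx mxE.
Qed.

End FiniteDimension.

Section FiberKernel.
Variables (R : comNzRingType) (x : closed_point R) (N : lmodType R) (s : seq N).
Hypothesis sN : forall v, lin_span s v.

(** The submodule [x N], in terms of the generators [s]. *)
Definition ideal_span : {pred N} :=
  [pred v | `[< exists c : nat -> R, (forall i, x (c i)) /\
                 v = \sum_(i < size s) c i *: s`_i >]].

Fact ideal_span_zmod : zmod_closed ideal_span.
Proof.
split=> [|v w /asboolP[c [xc ->]] /asboolP[d [xd ->]]].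
  apply/asboolP; exists (fun=> 0); split; first by move=> _; apply/residue_eq0P; exact: rmorph0.
  by rewrite big1 // => i _; rewrite scale0r.
apply/asboolP; exists (fun i => c i - d i); split.
  by move=> i; apply/residue_eq0P; have /residue_eq0P ci := xc i; have /residue_eq0P di := xd i; rewrite rmorphB /= ci di subrr.
by rewrite -sumrB; apply: eq_bigr => i _; rewrite scalerBl.
Qed.
HB.instance Definition _ := GRing.isZmodClosed.Build N ideal_span ideal_span_zmod.

Lemma ideal_scale_span a v : x a -> a *: v \in ideal_span.
Proof.
move=> /residue_eq0P xa; have [c ->] := sN v; apply/asboolP; exists (fun i => a * c i); split.
  by move=> i; apply/residue_eq0P; rewrite rmorphM /= xa mul0r.
by rewrite scaler_sumr; apply: eq_bigr => i _; rewrite scalerA.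
Qed.

(** [N / x N] receives [N ⊗ k(x)], so a vector whose image in the fibre is zero
    is a combination of generators with coefficients in the ideal. *)
Lemma fiber_kernel v : tens_pure (residue x) v 1 = 0 -> v \in ideal_span.
Proof.
pose Q := Quotient.quot (ideal_span : zmodClosed N).
pose b (w : N) (c : residue_field x) : Q := \pi_Q%qT (repr c *: w).
have piE (w w' : N) : w - w' \in ideal_span -> \pi_Q%qT w = \pi_Q%qT w'.
  by rewrite Quotient.idealrBE => /eqP.
have resE (a a' : R) : residue x a = residue x a' -> x (a - a').
  by move=> e; apply/residue_eq0P; rewrite rmorphB /= e subrr.
have reprR (c : residue_field x) : residue x (repr c) = c by exact: reprK.
have bb : balanced (residue x) b.
  split=> [w w' c|w c c'|r w c]; rewrite /b.
  - by rewrite scalerDr raddfD.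
  - rewrite -raddfD; apply: piE; rewrite -scalerDl -scalerBl; apply: ideal_scale_span.
    by apply: resE; rewrite rmorphD /= !reprR.
  apply: piE; rewrite scalerA -scalerBl; apply: ideal_scale_span.
  by apply: resE; rewrite rmorphM /= !reprR mulrC.
move=> v0; have := tens_lift_pure v 1 bb; rewrite v0 tens_lift0 // /b => e.
have /eqP : \pi_Q%qT 0 = \pi_Q%qT v.
  rewrite raddf0 e; apply: piE; rewrite -{2}[v]scale1r -scalerBl; apply: ideal_scale_span.
  by apply: resE; rewrite reprR rmorph1.
by rewrite -Quotient.idealrBE sub0r rpredN.
Qed.

End FiberKernel.

(** * Local freeness where the fibre dimension is constant *)

Section LocallyFree.
Variables (E : fieldType) (R : comAlgType E).
Hypotheses (noethR : noetherian R) (redR : reduced_ring R).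
Variable Sigma : set (closed_point R).
Hypothesis dense : zariski_dense Sigma.
Variables (N : lmodType R) (s : seq N).
Hypothesis sN : forall v, lin_span s v.

Lemma residue_surj (x : closed_point R) (c : residue_field x) : exists a, residue x a = c.
Proof. by exists (repr c); exact: reprK. Qed.

Lemma tens_spanned (L : fieldType) (chi : {rmorphism R -> L}) d (m : 'I_d -> N) (c : R) :
  chi c != 0 -> (forall v, exists r : 'I_d -> R, c *: v = \sum_i r i *: m i) ->
  spanning (fun i => tens_pure chi (m i) 1).
Proof.
move=> c0 gen; elim/tens_ind => [|t u [a ->] [b ->]|v a].
- by exists (fun=> 0); rewrite big1 // => i _; rewrite scale0r.
- by exists (fun i => a i + b i); rewrite -big_split; apply: eq_bigr => i _; rewrite scalerDl.
have [r er] := gen v; exists (fun i => a / chi c * chi (r i)).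
have -> : tens_pure chi v a = (a / chi c) *: tens_pure chi (c *: v) 1.
  by rewrite tens_pure_scale scalerA divfK // -tens_pureE.
rewrite er tens_pure_sum scaler_sumr; apply: eq_bigr => i _.
by rewrite tens_pure_scale scalerA.
Qed.

Lemma fiber_spanned (x : closed_point R) :
  spanning (fun i : 'I_(size s) => tens_pure (residue x) s`_i 1).
Proof.
apply: (tens_spanned (c := 1)) => [|v]; first by rewrite rmorph1 oner_neq0.
by rewrite scale1r; apply/lin_spanP.
Qed.

(** Nakayama's lemma by the determinant trick. *)
Lemma nakayama (x : closed_point R) d (m : 'I_d -> N) :
  spanning (fun i => tens_pure (residue x) (m i) 1) ->
  exists2 c, ~~ x c & forall v, exists r : 'I_d -> R, c *: v = \sum_i r i *: m i.
Proof.
move=> spm; pose t := size s.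
have /choice[r hr] (j : 'I_t) : exists r : 'I_d -> R, exists z : 'I_t -> R,
    (forall l, x (z l)) /\ s`_j - \sum_i r i *: m i = \sum_l z l *: s`_l.
  have [c ec] := spm (tens_pure (residue x) s`_j 1).
  have /choice[r hr] : forall i, exists a, residue x a = c i by move=> i; exact: residue_surj.
  exists r.
  have /(fiber_kernel sN) /asboolP[z [xz ->]] :
      tens_pure (residue x) (s`_j - \sum_i r i *: m i) 1 = 0.
    rewrite tens_pureDl ec -scaleN1r tens_pure_scale tens_pure_sum rmorphN1 scaleN1r.
    apply/eqP; rewrite subr_eq0; apply/eqP; apply: eq_bigr => i _.
    by rewrite tens_pure_scale /= hr.
  by exists z.
have /choice[z hz] := hr.
(* The generators [n_j] satisfy [(1 - X) n = r m], with [X] zero at [x]. *)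
pose X : 'M[R]_t := \matrix_(j, l) z j l.
pose Y := 1%:M - X.
have rowY j : \sum_l Y j l *: s`_l = \sum_i r j i *: m i.
  have [_ e] := hz j.
  under eq_bigr => l _ do rewrite !mxE scalerBl.
  rewrite sumrB -e (bigD1 j) //= eqxx scale1r big1 ?addr0; last first.
    by move=> l lj; rewrite eq_sym (negPf lj) scale0r.
  by rewrite opprB addrC subrK.
have dY : residue x (\det Y) = 1.
  rewrite -det_map_mx -[RHS](det1 _ t); congr (\det _).
  apply/matrixP => j l; rewrite !mxE rmorphB rmorph_nat /=.
  by have /residue_eq0P -> := proj1 (hz j) l; rewrite subr0.
exists (\det Y).
  by apply/negP => /residue_eq0P e; move: dY; rewrite e => /eqP; rewrite eq_sym oner_eq0.
have gens (j : 'I_t) : \det Y *: s`_j = \sum_i (\sum_l \adj Y j l * r l i) *: m i :> N.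
  transitivity (\sum_l \adj Y j l *: (\sum_l' Y l l' *: s`_l')).
    under [RHS]eq_bigr => l _ do rewrite scaler_sumr.
    rewrite exchange_big /= (bigD1 j) //= [X in _ + X]big1 ?addr0 => [|l' lj].
      under [RHS]eq_bigr => l _ do rewrite scalerA.
      rewrite -scaler_suml; congr (_ *: _).
      by have /matrixP /(_ j j) := mul_adj_mx Y; rewrite !mxE eqxx.
    under [LHS]eq_bigr => l _ do rewrite scalerA.
    rewrite -scaler_suml.
    have /matrixP /(_ j l') := mul_adj_mx Y; rewrite !mxE eq_sym (negPf lj) => ->.
    by rewrite mulr0n scale0r.
  under [RHS]eq_bigr => i _ do rewrite scaler_suml.
  rewrite exchange_big; apply: eq_bigr => l _ /=; rewrite rowY scaler_sumr.
  by apply: eq_bigr => i _; rewrite scalerA.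
move=> v; have [a ->] := sN v; exists (fun i => \sum_(j < t) a j * \sum_l \adj Y j l * r l i).
rewrite scaler_sumr; under [RHS]eq_bigr => i _ do rewrite scaler_suml.
rewrite exchange_big; apply: eq_bigr => j _ /=.
rewrite scalerA mulrC -scalerA gens scaler_sumr.
by apply: eq_bigr => i _; rewrite scalerA.
Qed.

(** Where the fibre dimension is constant on the dense set [Sigma], lifts of a
    basis of a fibre generate [N] after inverting [c] and their relations vanish
    on [Sigma] after multiplication by [b c]: they have coordinate functionals. *)
Lemma locally_free (x : closed_point R) (b : R) : Sigma x -> ~~ x b ->
  (forall y, Sigma y -> ~~ y b -> vdim (tens (residue y) N) = vdim (tens (residue x) N)) ->
  exists d (m : 'I_d -> N) (lam : 'I_d -> N -> R) (u c : R),
    [/\ ~~ x u, ~~ x c, forall i r v w, lam i (r *: v + w) = r * lam i v + lam i w,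
        forall i j, lam i (m j) = u * (i == j)%:R &
        forall v, exists r : 'I_d -> R, c *: v = \sum_i r i *: m i].
Proof.
move=> Sx xb cst; move: cst (vdim_basis (@fiber_spanned x)).
move: (vdim (tens (residue x) N)) => d cst [e be].
have /choice[m hm] : forall i, exists m, e i = tens_pure (residue x) m 1.
  by move=> i; exact: (tens_surj_pure (@residue_surj x)).
have spm : spanning (fun i => tens_pure (residue x) (m i) 1).
  have -> : (fun i => tens_pure (residue x) (m i) 1) = e by apply/funext => i; rewrite hm.
  exact: basis_spanning be.
have [c xc gen] := nakayama spm.
have rel (r : 'I_d -> R) : \sum_i r i *: m i = 0 ->
    forall i, b * c * r i = 0.
  move=> r0 i; apply: (dense_vanish noethR redR dense) => y Sy.
  apply/residue_eq0P; rewrite !rmorphM /=.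
  have [yb|yb] := boolP (y b); first by have /residue_eq0P -> := yb; rewrite !mul0r.
  have [yc|yc] := boolP (y c); first by have /residue_eq0P -> := yc; rewrite mulr0 mul0r.
  suff -> : residue y (r i) = 0 by rewrite mulr0.
  move: (vdim_basis (@fiber_spanned y)); rewrite (cst y Sy yb) => -[ey bey].
  have spy : spanning (fun i => tens_pure (residue y) (m i) 1).
    exact: tens_spanned (residue_neq0 yc) gen.
  apply: (@spanning_independent _ _ _ _ _ bey spy (fun i => residue y (r i))).
  rewrite -[RHS](tens_pure0 (residue y) N 1) -r0 tens_pure_sum.
  by apply: eq_bigr => j _; rewrite tens_pure_scale.
have [r hr] := choice gen.
(* So coordinates [r v i] are unique, and linear in [v], after multiplication by [b c]. *)
have relE (a a' : 'I_d -> R) : \sum_i a i *: m i = \sum_i a' i *: m i ->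
    forall i, b * c * a i = b * c * a' i.
  move=> eaa i; apply/eqP; rewrite -subr_eq0 -mulrBr; apply/eqP.
  apply: (rel (fun i => a i - a' i)); under eq_bigr => j _ do rewrite scalerBl.
  by rewrite sumrB eaa subrr.
exists d, m, (fun i v => b * c * r v i), (b * c * c), c; split=> //.
- by apply: point_mulP => //; exact: point_mulP.
- move=> i a v w.
  rewrite (relE (r (a *: v + w)) (fun i => a * r v i + r w i)); first by ring.
  rewrite -hr scalerDr scalerA mulrC -scalerA !hr scaler_sumr -big_split.
  by apply: eq_bigr => j _ /=; rewrite scalerDl scalerA.
move=> i j; rewrite (relE (r (m j)) (fun i => c * (i == j)%:R)) ?mulrA //.
rewrite -hr (bigD1 j) //= eqxx mulr1 big1 ?addr0 // => l lj.
by rewrite (negPf lj) mulr0 scale0r.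
Qed.

End LocallyFree.

(** * Local bases of invariants *)

Section LocalBases.
Variables (F : padicField) (Fbar : closedFieldType) (iota : {rmorphism F -> Fbar}).
Variables (n : nat) (G : algGroup iota n).
Local Notation GF := (points G).
Variables (E : fieldType) (R : comAlgType E).
Hypothesis QR : rational_algebra R.
Hypotheses (noethR : noetherian R) (redR : reduced_ring R).
Let ssG : small_subgroups GF := points_small_subgroups G.
Local Notation ocs := open_compact_subgroup.
Variable M : gmodule GF R.
Hypotheses (smM : smooth M) (adM : admissible M).

Lemma lift_fixed (K : set GF) (s : seq M) : (forall v, v \in s -> v \in fixed M K) ->
  exists s' : seq (invariants M K), map val s' = s.
Proof.
elim: s => [|v s IH] hs; first by exists [::].
have [|s' <-] := IH; first by move=> w ws; apply: hs; rewrite inE ws orbT.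
by exists ((exist _ v (hs v (mem_head _ _)) : invariants M K) :: s').
Qed.

Lemma invariants_finite (K : set GF) : ocs K ->
  exists s : seq (invariants M K), forall v, lin_span s v.
Proof.
move=> oK; have [s es] := adM oK.
have [|s' es'] := @lift_fixed K s.
  by move=> v /lin_span_mem; rewrite -es.
exists s' => v; have : lin_span s (val v) by rewrite -es; exact: (valP v).
rewrite -es' => -[c ec]; exists c; apply: val_inj; rewrite ec size_map raddf_sum /=.
by apply: eq_bigr => i _; rewrite (nth_map 0).
Qed.

(** Where [lb_unit] and [lb_den] do not vanish, [lb_vec] is a basis of the
    [K]-invariants of the fibres and [lb_fun] divided by [lb_unit] gives the
    coordinates. The functionals [lb_fun] live on all of [M]: they enter the
    construction of the dual module. *)
Record local_basis (K : set GF) (x : closed_point R) d := LocalBasis {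
  lb_vec : 'I_d -> M;
  lb_fun : 'I_d -> M -> R;
  lb_unit : R;
  lb_den : R;
  lb_vecK : forall i, lb_vec i \in fixed M K;
  lb_unit_x : ~~ x lb_unit;
  lb_den_x : ~~ x lb_den;
  lb_lin : forall i r v w, lb_fun i (r *: v + w) = r * lb_fun i v + lb_fun i w;
  lb_funK : forall i k v, K k -> lb_fun i (gm_act k v) = lb_fun i v;
  lb_dual : forall i j, lb_fun i (lb_vec j) = lb_unit * (i == j)%:R;
  lb_gen : forall v, v \in fixed M K -> exists r : 'I_d -> R, lb_den *: v = \sum_i r i *: lb_vec i
}.

(** [locally_free] applies to [M^K]; its functionals are extended to [M] by averaging. *)
Lemma local_basis_ex (Sigma : set (closed_point R)) (K : set GF) (x : closed_point R) :
  zariski_dense Sigma -> locally_constant_fiber_dim Sigma M -> ocs K -> Sigma x ->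
  exists d, inhabited (local_basis K x d).
Proof.
move=> dense lc oK Sx; have [s sN] := invariants_finite oK.
have [b xb cst] := lc K oK x Sx.
have [d [m [lam [u [c [xu xc lin dual gen]]]]]] :=
  locally_free noethR redR dense sN Sx xb cst.
pose av (v : M) : invariants M K := exist _ (average K v) (average_fixed ssG QR smM v oK).
have avlin r v w : av (r *: v + w) = r *: av v + av w.
  by apply: val_inj; rewrite /= (average_linear ssG QR smM _ _ _ oK).
have avK v (vK : v \in fixed M K) : av v = exist _ v vK.
  by apply: val_inj; rewrite /= (average_id ssG QR smM oK vK).
exists d; constructor.
apply: (@LocalBasis K x d (fun i => val (m i)) (fun i v => lam i (av v)) u c) => //.
- by move=> i; exact: (valP (m i)).
- by move=> i r v w; rewrite avlin lin.
- move=> i k v Kk; congr (lam i _); apply: val_inj.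
  by rewrite /= (average_act ssG QR smM _ oK Kk).
- move=> i j; rewrite -dual; congr (lam i _); apply: val_inj.
  by rewrite /= (average_id ssG QR smM oK (valP (m j))).
move=> v vK; have [r er] := gen (exist _ v vK); exists r.
transitivity (val (c *: (exist _ v vK : invariants M K))); first by [].
by rewrite er raddf_sum; apply: eq_bigr.
Qed.

Section BasisExtension.
Variables (K : set GF) (oK : ocs K) (x : closed_point R) (d : nat) (lb : local_basis K x d).
Variables (L : comNzRingType) (chi : {rmorphism R -> L}).
Implicit Type t : gm_ext chi M.

Lemma local_basis_span c t : c * chi (lb_den lb) = 1 -> t \in fixed (gm_ext chi M) K ->
  exists a : 'I_d -> L, t = \sum_i a i *: tens_pure chi (lb_vec lb i) 1.
Proof.
move=> c0; move: t; apply: (fixed_ext_ind (M := M) ssG QR smM oK).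
- by exists (fun=> 0); rewrite big1 // => i _; rewrite scale0r.
- move=> t u [a ->] [b ->]; exists (fun i => a i + b i).
  by rewrite -big_split; apply: eq_bigr => i _; rewrite scalerDl.
move=> m a mK; have [r er] := lb_gen lb mK.
exists (fun i => a * c * chi (r i)).
have -> : tens_pure chi m a = (a * c) *: tens_pure chi (lb_den lb *: m) 1.
  by rewrite tens_pure_scale scalerA -mulrA c0 mulr1 -tens_pureE.
rewrite er tens_pure_sum scaler_sumr; apply: eq_bigr => i _.
by rewrite tens_pure_scale scalerA.
Qed.

Definition lb_functional (i : 'I_d) : gm_ext chi M -> L :=
  @tens_functional _ _ chi M (lb_fun lb i).

Lemma lb_functional_linear i c t u :
  lb_functional i (c *: t + u) = c * lb_functional i t + lb_functional i u.
Proof. by apply: tens_functional_linear; exact: lb_lin. Qed.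

Lemma lb_functional0 i : lb_functional i 0 = 0.
Proof. by apply: tens_lift0; apply: functional_balanced; exact: lb_lin. Qed.

Lemma lb_functional_sum i (a : 'I_d -> L) :
  lb_functional i (\sum_j a j *: tens_pure chi (lb_vec lb j) 1) = a i * chi (lb_unit lb).
Proof.
have f0 := lb_functional0 i.
rewrite (big_morph (lb_functional i) (id1 := 0) (op1 := +%R)) //; last first.
  by move=> t u; have := lb_functional_linear i 1 t u; rewrite scale1r mul1r.
have val j : lb_functional i (a j *: tens_pure chi (lb_vec lb j) 1) =
    a j * (chi (lb_unit lb) * (i == j)%:R).
  rewrite scale_tens_pure mulr1 /lb_functional tens_functional_pure; last exact: lb_lin.
  by rewrite lb_dual rmorphM rmorph_nat mulrC.
rewrite (bigD1 i) //= val eqxx mulr1 big1 ?addr0 // => j ji.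
by rewrite val eq_sym (negPf ji) !mulr0.
Qed.

Lemma local_basis_independent u (a : 'I_d -> L) : chi (lb_unit lb) * u = 1 ->
  \sum_j a j *: tens_pure chi (lb_vec lb j) 1 = 0 -> forall i, a i = 0.
Proof.
move=> u1 a0 i; have := lb_functional_sum i a; rewrite a0 lb_functional0.
by move=> /(congr1 ( *%R^~ u)); rewrite mul0r -mulrA u1 mulr1.
Qed.

End BasisExtension.

Section DualVectors.
Variables (M' : gmodule GF R) (p : M -> M' -> R).
Hypotheses (smM' : smooth M') (adM' : admissible M').
Hypotheses (bp : bilinear_map idfun p) (ip : invariant_pairing p).
Variables (K : set GF) (oK : ocs K) (x : closed_point R) (d : nat) (lb : local_basis K x d).
Local Notation px := (@fiber_pairing _ _ _ _ _ _ _ M M' p x).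
Hypothesis left_nondeg : forall v, (forall w, px v w = 0) -> v = 0.

Lemma fiber_pairingE v w : px (fiber_elt x v) (fiber_elt x w) = residue x (p v w).
Proof. by rewrite /fiber_pairing tens_pairing_pure // !mulr1. Qed.

(** The Gram matrix at [x] of [lb_vec] against generators of the [K]-invariants of
    [M'] has independent rows, hence a right inverse, which is lifted to [R]. *)
Lemma dual_vectors_ex : exists l : 'I_d -> M', (forall j, l j \in fixed M' K) /\
  forall i j, residue x (p (lb_vec lb i) (l j)) = (i == j)%:R.
Proof.
have [s es] := adM' oK.
have bpx : bilinear_map idfun px by exact: tens_pairing_bilinear.
have ipx : invariant_pairing px by exact: invariant_pairing_ext.
have smx : smooth (fiber M' x) by exact: smooth_ext.
pose Gr : 'M[residue_field x]_(d, size s) := \matrix_(i, k) residue x (p (lb_vec lb i) s`_k).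
have rf : row_free Gr.
  rewrite -kermx_eq0; apply/eqP/row_matrixP => i0.
  rewrite row0; set a := row i0 _.
  have aG : a *m Gr = 0 by rewrite /a -row_mul mulmx_ker row0.
  move: a aG => a aG.
  pose v := \sum_i a 0 i *: fiber_elt x (lb_vec lb i).
  have vK : v \in fixed (fiber M x) K.
    by apply: fixed_sum => i _; apply: fixedZ; apply: fixed_tens_pure; exact: lb_vecK.
  have vs k : (k < size s)%N -> px v (fiber_elt x s`_k) = 0.
    move=> ks; have /matrixP /(_ 0 (Ordinal ks)) := aG; rewrite !mxE => <-.
    rewrite (bil_suml bpx); apply: eq_bigr => i _.
    by rewrite (bilZl bpx) fiber_pairingE mxE.
  have v0 : v = 0.
    apply: left_nondeg => w.
    have QL := rational_algebra_ext (residue x) QR.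
    have -> : px v w = px v (average K w).
      symmetry; apply: (average_pairing ssG QL (p := fun w v => px v w) w oK smx) vK.
      - by case: bpx => h1 h2; split=> *; [exact: h2|exact: h1].
      - by move=> g w' v'; exact: ipx.
    have := average_fixed ssG QL smx w oK.
    move: (average K w); apply: (fixed_ext_ind (M := M') ssG QR smM' oK).
    - exact: (bil0r bpx).
    - by move=> t u ht hu; rewrite (bilDr bpx) ht hu addr0.
    move=> m c mK; have : lin_span s m by rewrite -es.
    move=> [b ->]; rewrite tens_pureE tens_pure_sum (bilZr bpx) (bil_sumr bpx) big1 ?mulr0 // => i _.
    by rewrite tens_pure_scale (bilZr bpx) vs // mulr0.
  apply/rowP => i; rewrite [RHS]mxE.
  exact: (local_basis_independent (mulfV (residue_neq0 (lb_unit_x lb))) v0 i).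
have [Q eQ] := row_freeP rf.
have /choice[q hq] : forall ij, exists r, residue x r = Q ij.1 ij.2 by move=> ij; exact: residue_surj.
exists (fun j => \sum_(k < size s) q (k, j) *: s`_k); split.
  move=> j; apply: fixed_sum => k _; apply: fixedZ.
  by have /lin_span_mem : s`_k \in s by [exact: mem_nth]; rewrite -es.
move=> i j; have /matrixP /(_ i j) := eQ; rewrite !mxE => <-.
rewrite (bil_sumr bp) rmorph_sum; apply: eq_bigr => k _.
by rewrite (bilZr bp) rmorphM /= hq mxE mulrC.
Qed.

End DualVectors.
End LocalBases.

(** * Modules of functionals *)

Section FunctionModule.
Variables (gT : preTopGroupType) (R : comNzRingType) (M : gmodule gT R).
Local Notation V := (M -> R^o).
Implicit Types (l : V) (g : gT) (A S : set V).

Definition fun_act g l : V := fun v => l (gm_act g^-1%g v).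

Lemma fun_act_linear g : linear (fun_act g).
Proof. by []. Qed.

Lemma fun_act1 l : fun_act 1%g l = l.
Proof. by apply/funext => v; rewrite /fun_act invg1 gm_act1. Qed.

Lemma fun_actM g h l : fun_act (g * h)%g l = fun_act g (fun_act h l).
Proof. by apply/funext => v; rewrite /fun_act invgM gm_actM. Qed.

Definition stable_submodule S : Prop :=
  [/\ S 0, forall a l l', S l -> S l' -> S (a *: l + l') & forall g l, S l -> S (fun_act g l)].

(** As an intersection of submodules, so that a property passes from [A] to all of
    the module as soon as it is stable. *)
Definition generated A : {pred V} :=
  [pred l | `[< forall S, stable_submodule S -> A `<=` S -> S l >]].

Section Generated.
Variable A : set V.

Lemma generatedP l : l \in generated A <-> forall S, stable_submodule S -> A `<=` S -> S l.
Proof. by split=> [/asboolP|h]; last exact/asboolP. Qed.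

Fact generated_submod_closed : submod_closed (generated A).
Proof.
split=> [|a l l' /generatedP h /generatedP h']; apply/generatedP => S sS AS.
  by case: sS.
by have [_ SD _] := sS; apply: SD; [exact: h|exact: h'].
Qed.
HB.instance Definition _ :=
  GRing.isSubmodClosed.Build R V (generated A) generated_submod_closed.

Definition generated_type := {l : V | l \in generated A}.
HB.instance Definition _ := SubChoice.on generated_type.
HB.instance Definition _ := [SubChoice_isSubLmodule of generated_type by <:].

Fact generated_act g (l : generated_type) : fun_act g (val l) \in generated A.
Proof.
apply/generatedP => S sS AS; have [_ _ Sa] := sS; apply: Sa.
by move/generatedP: (valP l); apply.
Qed.

Definition generated_fun_act g (l : generated_type) : generated_type :=
  exist (fun l => l \in generated A) _ (generated_act g l).

Fact generated_act_linear g : linear (generated_fun_act g).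
Proof. by move=> a l l'; apply: val_inj. Qed.
Fact generated_act1 (l : generated_type) : generated_fun_act 1%g l = l.
Proof. by apply: val_inj; exact: fun_act1. Qed.
Fact generated_actM g h (l : generated_type) :
  generated_fun_act (g * h)%g l = generated_fun_act g (generated_fun_act h l).
Proof. by apply: val_inj; exact: fun_actM. Qed.

Definition generated_module : gmodule gT R :=
  GModule generated_act_linear generated_act1 generated_actM.

Definition evaluation (v : M) (l : generated_module) : R := val (l : generated_type) v.

Lemma generated_mem l : A l -> l \in generated A.
Proof. by move=> Al; apply/generatedP => S _; exact. Qed.

Lemma generated_ind S (l : generated_module) :
  stable_submodule S -> A `<=` S -> S (val (l : generated_type)).
Proof. by move=> sS AS; move/generatedP: (valP l); apply. Qed.

Lemma evaluation_invariant : invariant_pairing evaluation.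
Proof. by move=> g v l; rewrite /evaluation /= /fun_act gm_actKV. Qed.

Hypothesis linA : forall l, A l -> forall r v w, l (r *: v + w) = r * l v + l w.

Lemma evaluation_bilinear : bilinear_map idfun evaluation.
Proof.
split=> [r v w l|r v l l']; last by [].
pose S : set V := [set l | forall r v w, l (r *: v + w) = r * l v + l w].
have := @generated_ind S l; apply; last exact: linA.
split=> [a u u'|a k k' h h' b u u'|g k h b u u'].
- by rewrite mulr0 addr0.
- have E z : (a *: k + k') z = a * k z + k' z by [].
  by rewrite !E h h'; ring.
- by rewrite /fun_act gm_act_linear h.
Qed.

Lemma generated_torsion_free : torsion_free generated_module.
Proof.
move=> r l lr e; apply: val_inj; apply/funext => v.
have e' : r *: val (l : generated_type) = 0 :> V by exact: (congr1 val e).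
by apply: lr; rewrite mulr0 -[LHS]/((r *: val (l : generated_type) : V) v) e'.
Qed.

Lemma generated_fixedP K (l : generated_module) : l \in fixed generated_module K <->
  forall k, K k -> fun_act k (val (l : generated_type)) = val (l : generated_type).
Proof.
split=> [/fixedP h k Kk|h].
  by have := congr1 (fun l' : generated_module => val (l' : generated_type)) (h k Kk).
by apply/fixedP => k Kk; apply: val_inj; exact: h.
Qed.

Hypothesis ssG : small_subgroups gT.
Local Notation ocs := open_compact_subgroup.

(** A translate by [g] of a [K]-invariant functional is invariant under [g K g^-1]. *)
Lemma generated_smooth K : ocs K ->
  (forall l, A l -> forall k, K k -> fun_act k l = l) -> smooth generated_module.
Proof.
move=> oK AK l.
pose S : set V := [set l | exists2 K, ocs K & forall k, K k -> fun_act k l = l].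
suff [K' oK' h] : S (val (l : generated_type)) by exists K' => //; exact/generated_fixedP.
apply: generated_ind; last by move=> k /AK; exists K.
split.
- by exists K.
- move=> a k k' [K1 oK1 h1] [K2 oK2 h2]; exists (K1 `&` K2); first exact: ocsI.
  by move=> g [g1 g2]; rewrite fun_act_linear h1 ?h2.
move=> g k [K1 oK1 h1]; exists [set h | K1 (g^-1 * h * g)%g]; first exact: ocs_conj.
move=> h /= Kh; rewrite -fun_actM.
have -> : (h * g)%g = (g * (g^-1 * h * g))%g by rewrite !mulgA mulgV mul1g.
by rewrite fun_actM h1.
Qed.

Lemma lin_span_sub (U : lmodType R) (s t : seq U) : {subset s <= t} ->
  lin_span s `<=` lin_span t.
Proof.
move=> st; apply: lin_span_min; [exact: lin_span0|by move=> *; exact: lin_span_linear|].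
by move=> v /st; exact: lin_span_mem.
Qed.

Lemma generated_finitely_generated (gens : seq V) : A = lin_span gens ->
  finitely_generated generated_module.
Proof.
move=> eA.
have [gens' egens] : exists gens' : seq generated_type, map val gens' = gens.
  have : forall l, l \in gens -> l \in generated A.
    by move=> l /lin_span_mem; rewrite -eA; exact: generated_mem.
  elim: (gens) => [|l t IH] ht; first by exists [::].
  have [|t' <-] := IH; first by move=> k kt; apply: ht; rewrite inE kt orbT.
  by exists ((exist _ l (ht l (mem_head _ _)) : generated_type) :: t').
exists (gens' : seq generated_module) => l0.
pose spn (gs : seq gT) := [seq gm_act g (w : generated_module) | g <- gs, w <- gens'].
pose S' : set generated_module := [set l | exists gs, lin_span (spn gs) l].
pose S : set V := [set l | exists2 l' : generated_module, val (l' : generated_type) = l & S' l'].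
suff [l' e] : S (val (l0 : generated_type)).
  by have -> : l' = l0 by exact: val_inj.
have spnS gs gs' : {subset gs <= gs'} -> {subset spn gs <= spn gs'}.
  move=> h _ /allpairsP[[g w] /= [gg ww ->]]; apply/allpairsP; exists (g, w); split=> //.
  exact: h.
apply: generated_ind; first split.
- by exists 0 => //; exists [::]; exact: lin_span0.
- move=> a _ _ [l <- [gs hl]] [l' <- [gs' hl']]; exists (a *: l + l') => //.
  exists (gs ++ gs'); apply: lin_span_linear.
    by apply: lin_span_sub hl; apply: spnS => g gg; rewrite mem_cat gg.
  by apply: lin_span_sub hl'; apply: spnS => g gg; rewrite mem_cat gg orbT.
- move=> g _ [l <- [gs hl]]; exists (gm_act g l) => //.
  exists [seq (g * h)%g | h <- gs].
  move: l hl; apply: lin_span_min.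
  + by rewrite gm_act0; exact: lin_span0.
  + by move=> a v w hv hw; rewrite gm_act_linear; exact: lin_span_linear.
  move=> _ /allpairsP[[h w] /= [hh ww ->]]; apply: lin_span_mem.
  apply/allpairsP; exists ((g * h)%g, w); split=> //; first exact: map_f.
  by rewrite /= -[LHS]generated_actM.
rewrite eA => l; rewrite -egens => -[c ->].
exists (\sum_(i < size gens') c i *: (gens'`_i : generated_module)).
  rewrite size_map (raddf_sum (val : generated_type -> V)); apply: eq_bigr => i _.
  by rewrite (nth_map 0).
exists [:: 1%g].
suff -> : spn [:: 1%g] = gens' by exists c.
by rewrite /spn /= cats0 -[RHS]map_id; apply: eq_map => w; exact: generated_act1.
Qed.

End Generated.
End FunctionModule.

(** * Existence of a dual module *)

Section DualDatum.
Variables (F : padicField) (Fbar : closedFieldType) (iota : {rmorphism F -> Fbar}).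
Variables (n : nat) (G H : algGroup iota n) (RT : realType).
Local Notation C := (complex RT).
Local Notation GF := (points G).
Variables (D : plancherel G H RT).
Variables (E : fieldType) (R : comAlgType E).
Hypothesis QR : rational_algebra R.
Let ssG : small_subgroups GF := points_small_subgroups G.
Local Notation ocs := open_compact_subgroup.
Variables (Sigma : set (closed_point R)) (M : gmodule GF R).
Hypotheses (st : setting D Sigma M) (lc : locally_constant_fiber_dim Sigma M).

Let noethR := set_noetherian st.
Let redR := set_reduced st.
Let dense := set_dense st.
Let smM := set_smooth st.
Let adM := set_admissible st.
Local Notation V := (M -> R^o).

Definition invariant_functionals (K : set GF) : set V :=
  [set l | (forall r v w, l (r *: v + w) = r * l v + l w) /\ forall k v, K k -> l (gm_act k v) = l v].

(** By averaging, such a functional is determined by its values on generators of [M^K]. *)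
Lemma invariant_functionals_finite K : ocs K -> exists gens, invariant_functionals K = lin_span gens.
Proof.
move=> oK; have [s es] := adM oK.
apply: (noetherian_submodule noethR (V := V) (ev := fun (i : 'I_(size s)) (l : V) => l s`_i)).
- by [].
- by split=> [r v w|k v _]; rewrite ?mulr0 ?addr0.
- move=> a l l' [h1 h2] [h1' h2']; have eq v : (a *: l + l') v = a * l v + l' v by [].
  by split=> [r v w|k v Kk]; rewrite !eq ?h1 ?h1' ?h2 ?h2' //; ring.
move=> l [h1 h2] l0; apply/funext => v /=.
have bl : bilinear_map idfun (fun (v : M) (c : R^o) => c * l v).
  split=> [r u u' c|r u c c']; first by rewrite h1 mulrDr mulrCA.
  by rewrite mulrDl mulrA.
have l00 : l 0 = 0.
  by have := h1 (-1) 0 0; rewrite scaleN1r oppr0 addr0 mulN1r addNr.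
have lZ r u : l (r *: u) = r * l u by have := h1 r u 0; rewrite l00 !addr0.
have lD u u' : l (u + u') = l u + l u' by have := h1 1 u u'; rewrite scale1r mul1r.
have avg : l (average K v) = l v.
  have [K' [r [c [oK' K'K fv [[sep rK cov] ec] ->]]]] := averageP ssG QR smM v oK.
  rewrite lZ (big_morph l lD l00) (eq_big_seq (fun=> l v)).
    by rewrite big_const_seq count_predT iter_addr_0 -mulr_natl mulrA ec mul1r.
  by move=> k /rK Kk; exact: h2.
rewrite -avg; have := average_fixed ssG QR smM v oK => avK.
have : lin_span s (average K v) by rewrite -es.
move=> [c ->]; rewrite (big_morph l lD l00) big1 // => i _.
by rewrite lZ l0 mulr0.
Qed.

Section Level.
Variable K0 : set GF.
Hypothesis oK0 : ocs K0.
Variable s0 : seq M.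
Hypothesis s0K : forall v, v \in s0 -> v \in fixed M K0.
Hypothesis s0gen : forall v, exists gs : seq GF, lin_span [seq gm_act g w | g <- gs, w <- s0] v.

Local Notation A := (invariant_functionals K0).
Local Notation M' := (generated_module A).
Local Notation p := (@evaluation _ _ M A).

Let linA l : A l -> forall r v w, l (r *: v + w) = r * l v + l w.
Proof. by case. Qed.

Let bp : bilinear_map idfun p.
Proof. exact: evaluation_bilinear. Qed.
Let ip : invariant_pairing p.
Proof. exact: evaluation_invariant. Qed.
Let smM' : smooth M'.
Proof.
apply: (generated_smooth ssG oK0) => l [_ lK] k Kk; apply/funext => v.
by rewrite /fun_act lK //; exact: ocs_inv oK0 _ _.
Qed.

Let evaluation_average K v (l : M') : ocs K -> l \in fixed M' K -> p (average K v) l = p v l.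
Proof. by move=> oK lK; exact: (average_pairing ssG QR v oK smM bp ip lK). Qed.

Let adM' : admissible M'.
Proof.
move=> K oK; have [s es] := adM oK.
apply: (noetherian_submodule noethR (V := M') (ev := fun (i : 'I_(size s)) (l : M') => p s`_i l)).
- by move=> i a l l'; rewrite (bilDr bp) (bilZr bp).
- exact: fixed0.
- by move=> a l l'; exact: fixed_linear.
move=> l lK l0; apply: val_inj; apply/funext => v; rewrite -[LHS]/(p v l).
rewrite -(evaluation_average v oK lK).
have avK := average_fixed ssG QR smM v oK.
have : lin_span s (average K v) by rewrite -es.
move=> [c ->]; rewrite (bil_suml bp) big1 // => i _.
by rewrite (bilZl bp) l0 mulr0.
Qed.

Section Point.
Variable x : closed_point R.
Hypothesis Sx : Sigma x.
Local Notation px := (@fiber_pairing _ _ _ _ _ _ _ M M' p x).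

(** If not, the local basis at level [K0] is empty. Then the generators [s0] of [M]
    vanish in the fibre at [x], while an irreducible module is not zero. *)
Lemma pairing_nonzero : exists v (l : M'), ~~ x (p v l).
Proof.
have [tau [[[t /eqP t0] _] _]] := set_embeddings st Sx.
apply: contrapT => no; apply: t0.
have [d [lb]] := local_basis_ex QR noethR redR smM adM dense lc oK0 Sx.
have noi (i : 'I_d) : False.
  apply: no; have Al : A (lb_fun lb i).
    by split=> [r v w|k v Kk]; [exact: lb_lin|exact: lb_funK].
  exists (lb_vec lb i), (exist (fun l => l \in generated A) _ (generated_mem Al) : generated_type A).
  by rewrite /evaluation /= lb_dual eqxx mulr1; exact: lb_unit_x.
have fib0 v : v \in fixed M K0 -> fiber_elt x v = 0 :> fiber M x.
  move=> vK; have [|a ->] := local_basis_span QR smM oK0 (mulVf (residue_neq0 (lb_den_x lb))) (t := fiber_elt x v).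
    exact: fixed_tens_pure.
  by rewrite big1 // => i; case: (noi i).
have fibM v : fiber_elt x v = 0 :> fiber M x.
  have [gs] := s0gen v; move: v; apply: lin_span_min.
  - exact: tens_pure0.
  - move=> a v w hv hw; rewrite /fiber_elt tens_pureDl tens_pure_scale.
    by rewrite -!/(fiber_elt x _) hv hw scaler0 addr0.
  move=> _ /allpairsP[[g w] /= [_ ws ->]].
  rewrite /fiber_elt -[LHS](gm_ext_act (residue x)).
  by have := fib0 w (s0K ws); rewrite /fiber_elt => ->; exact: (@gm_act0 _ _ (fiber M x) g).
have fib (u : fiber M x) : u = 0.
  by have [v ->] := tens_surj_pure (@residue_surj _ _ x) u; exact: fibM.
elim/tens_ind: (t) => [//|t1 t2 -> ->|u a]; first by rewrite addr0.
by rewrite (fib u) tens_pure0.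
Qed.

(** Over the complex numbers the left kernel is a subrepresentation of an irreducible
    one, and not everything by [pairing_nonzero]. Coordinate functionals show that no
    vector of the fibre is lost when passing to the complex numbers. *)
Lemma left_nondegenerate v : (forall w, px v w = 0) -> v = 0.
Proof.
have [tau [[_ irr] _]] := set_embeddings st Sx.
have bpx : bilinear_map idfun px by exact: tens_pairing_bilinear.
have ipx : invariant_pairing px by exact: invariant_pairing_ext.
pose pc : cfiber M tau -> cfiber M' tau -> C := @tens_pairing _ _ tau (fiber M x) (fiber M' x) px.
have bpc : bilinear_map idfun pc by exact: tens_pairing_bilinear.
have ipc : invariant_pairing pc by exact: invariant_pairing_ext.
pose N : set (cfiber M tau) := [set t | forall u, pc t u = 0].
have [|a t u ht hu w|g t ht u|N0|NT] := irr N.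
- by move=> u; exact: (bil0l bpc).
- by rewrite (bilDl bpc) (bilZl bpc) ht hu mulr0 addr0.
- by rewrite -(gm_actK g u) ipc.
- move=> v0; have Nv : N (tens_pure tau v 1).
    elim/tens_ind=> [|t t' h h'|w a]; first exact: (bil0r bpc).
      by rewrite (bilDr bpc) h h' addr0.
    by rewrite /pc tens_pairing_pure // v0 rmorph0 mul0r.
  have vt0 : tens_pure tau v 1 = 0 by move: Nv; rewrite N0.
  have [K oK vK] := smooth_ext ssG (chi := residue x) smM v.
  have [d [lb]] := local_basis_ex QR noethR redR smM adM dense lc oK Sx.
  have [a ev] := local_basis_span QR smM oK (mulVf (residue_neq0 (lb_den_x lb))) vK.
  rewrite ev big1 // => i _; suff -> : a i = 0 by rewrite scale0r.
  have lin := lb_functional_linear lb (chi := residue x) i.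
  have : tau (lb_functional lb (chi := residue x) i v) = 0.
    rewrite -[LHS]mulr1 -(tens_functional_pure tau lin v 1) vt0.
    by apply: tens_lift0; exact: functional_balanced.
  move=> /eqP; rewrite fmorph_eq0 ev lb_functional_sum mulf_eq0.
  by rewrite (negPf (residue_neq0 (lb_unit_x lb))) orbF => /eqP.
have [m [l xml]] := pairing_nonzero.
have : N (tens_pure tau (fiber_elt x m) 1) by rewrite NT.
move=> /(_ (tens_pure tau (fiber_elt x l) 1)).
rewrite /pc tens_pairing_pure // !mulr1 fiber_pairingE // => /eqP.
by rewrite fmorph_eq0 (negPf (residue_neq0 xml)).
Qed.

(** Let [lam] represent a vector of the right kernel, at level [K]. Choose [l] in the
    invariants of [M'] dual at [x] to a local basis of [M^K], with Gram matrix [P].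
    By Cramer's rule [det P lam] agrees on the local basis, hence after multiplication
    by [lb_den] everywhere, with a combination of the [l j] whose coefficients are
    combinations of the values of [lam] on the basis: they vanish at [x]. *)
Lemma right_nondegenerate t : (forall v, px v t = 0) -> t = 0.
Proof.
move=> t0; have bpx : bilinear_map idfun px by exact: tens_pairing_bilinear.
have [K oK tK] := smooth_ext ssG (chi := residue x) smM' t.
have [d [lb]] := local_basis_ex QR noethR redR smM adM dense lc oK Sx.
have [l [lK ldual]] := dual_vectors_ex QR smM' adM' bp ip oK lb left_nondegenerate.
have [lam lamK et] : exists2 lam : M', lam \in fixed M' K & t = fiber_elt x lam.
  move: (t) tK; apply: (fixed_ext_ind (M := M') ssG QR smM' oK).
  - by exists 0; [exact: fixed0|rewrite /fiber_elt tens_pure0].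
  - move=> t1 t2 [l1 h1 ->] [l2 h2 ->]; exists (l1 + l2); first exact: fixedD.
    by rewrite /fiber_elt tens_pureDl.
  move=> m a mK; have [r <-] := residue_surj a.
  by exists (r *: m); [exact: fixedZ|rewrite /fiber_elt tens_pureZ mulr1].
pose P : 'M[R]_d := \matrix_(i, j) p (lb_vec lb i) (l j).
have PE i j : P i j = p (lb_vec lb i) (l j) by rewrite mxE.
have dP : residue x (\det P) = 1.
  rewrite -det_map_mx -[RHS](det1 _ d); congr (\det _).
  by apply/matrixP => i j; rewrite !mxE /= ldual.
pose c j := \sum_i \adj P j i * p (lb_vec lb i) lam.
pose nu : M' := \sum_j c j *: l j.
have nuK : nu \in fixed M' K by apply: fixed_sum => j _; apply: fixedZ.
have cramer i i' : \sum_j \adj P j i' * p (lb_vec lb i) (l j) = \det P *+ (i == i').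
  have /matrixP /(_ i i') := mul_mx_adj P; rewrite [RHS]mxE => <-; rewrite mxE.
  by apply: eq_bigr => j _; rewrite PE mulrC.
have agree i : p (lb_vec lb i) nu = \det P * p (lb_vec lb i) lam.
  rewrite (bil_sumr bp) /c; under eq_bigr => j _ do rewrite (bilZr bp) /= mulr_suml.
  rewrite exchange_big /= (bigD1 i) //= [X in _ + X]big1 ?addr0 => [|i' ne];
    under eq_bigr => j _ do rewrite mulrAC; rewrite -mulr_suml cramer.
    by rewrite eqxx.
  by rewrite eq_sym (negPf ne) mul0r.
have eqM' : (lb_den lb * \det P) *: lam = lb_den lb *: nu.
  apply: val_inj; apply/funext => v.
  have lK' : (lb_den lb * \det P) *: lam \in fixed M' K by exact: fixedZ.
  have nK' : lb_den lb *: nu \in fixed M' K by exact: fixedZ.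
  rewrite -[LHS]/(p v _) -[RHS]/(p v (lb_den lb *: nu)).
  rewrite -(evaluation_average v oK lK') -(evaluation_average v oK nK').
  have [r er] := lb_gen lb (average_fixed ssG QR smM v oK).
  have h (u : M') : p (average K v) (lb_den lb *: u) = \sum_i r i * p (lb_vec lb i) u.
    rewrite (bilZr bp) -(bilZl bp) er (bil_suml bp).
    by apply: eq_bigr => i _; rewrite (bilZl bp).
  rewrite -scalerA !h; apply: eq_bigr => i _; congr (_ * _).
  by rewrite (bilZr bp) agree.
have c0 j : residue x (c j) = 0.
  rewrite rmorph_sum big1 // => i _; rewrite rmorphM /=.
  have := t0 (fiber_elt x (lb_vec lb i)); rewrite et fiber_pairingE // => ->.
  by rewrite mulr0.
rewrite et; have e0 : residue x (lb_den lb * \det P) *: fiber_elt x lam = 0.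
  rewrite /fiber_elt -tens_pure_scale eqM' tens_pure_scale tens_pure_sum big1 ?scaler0 // => j _.
  by rewrite tens_pure_scale /= c0 scale0r.
have nz : residue x (lb_den lb * \det P) != 0.
  by rewrite rmorphM /= dP mulr1; exact: residue_neq0 (lb_den_x lb).
by rewrite -[LHS](scalerK nz) e0 scaler0.
Qed.

End Point.

Lemma level_dual_datum : dual_datum Sigma p.
Proof.
split=> //.
- have [gens eA] := invariant_functionals_finite oK0.
  exact: generated_finitely_generated eA.
- exact: generated_torsion_free.
move=> x Sx; split; [exact: left_nondegenerate|exact: right_nondegenerate].
Qed.

End Level.

(** [K0] fixes a finite set of generators of [M]. *)
Lemma dual_datum_ex : exists (M' : gmodule GF R) (p : M -> M' -> R), dual_datum Sigma p.
Proof.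
have [s0 s0gen] := set_finitely_generated st.
have /choice[Kf hKf] : forall v : M, exists K, ocs K /\ v \in fixed M K.
  by move=> v; have [K oK vK] := smM v; exists K.
have [K oK _] := smM 0.
have [|K0 [oK0 _ K0s]] := @ocs_inter_seq _ ssG _ s0 Kf K oK; first by move=> v _; case: (hKf v).
eexists; exists (@evaluation _ _ M (invariant_functionals K0)).
apply: (level_dual_datum oK0 (s0 := s0)) => // v vs.
by apply: fixedS (proj2 (hKf v)); exact: K0s.
Qed.

End DualDatum.

(** * Spherical characters in families *)

Lemma cancel_denominator (k : fieldType) (a b d z : k) :
  d != 0 -> a * (b * z) = d * (b * (a / d * z)).
Proof. by move=> d0; field. Qed.

Section Characters.
Variables (F : padicField) (Fbar : closedFieldType) (iota : {rmorphism F -> Fbar}).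
Variables (n : nat) (G H : algGroup iota n) (RT : realType).
Local Notation C := (complex RT).
Local Notation GF := (points G).
Variables (D : plancherel G H RT) (Z : local_periods D).
Variable mu : {measure set (borel_type GF) -> \bar RT}.
Hypothesis mu_haar : rational_haar mu.
Variables (E : fieldType) (R : comAlgType E).
Hypothesis QR : rational_algebra R.
Let ssG : small_subgroups GF := points_small_subgroups G.
Local Notation ocs := open_compact_subgroup.
Variables (Sigma : set (closed_point R)) (M : gmodule GF R).
Hypothesis st : setting D Sigma M.

Let noethR := set_noetherian st.
Let redR := set_reduced st.
Let dense := set_dense st.
Let smM := set_smooth st.
Let adM := set_admissible st.

(** An embedding of the residue field determines the functional. *)
Lemma fiber_character_unique x Jx Jx' f : Sigma x ->
  @fiber_character _ _ _ _ _ _ _ _ Z mu _ _ M x Jx ->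
  @fiber_character _ _ _ _ _ _ _ _ Z mu _ _ M x Jx' -> hecke_fun f -> Jx' f = Jx f.
Proof.
move=> Sx [_ hJ] [_ hJ'] hf; have [tau et] := set_embeddings st Sx.
by apply: (fmorph_inj tau); rewrite hJ // hJ'.
Qed.

Section WithDual.
Variables (M' : gmodule GF R) (p : M -> M' -> R).
Hypothesis dp : dual_datum Sigma p.

Let bp := dual_bilinear dp.
Let ip := dual_invariant dp.
Let smM' := dual_smooth dp.
Let adM' := dual_admissible dp.

Lemma characters_of_periods :
  (forall x, Sigma x -> exists Zx, @fiber_period _ _ _ _ _ _ _ _ Z _ _ M M' p x Zx) ->
  rationality_of_characters Z mu Sigma M.
Proof.
move=> hZ x Sx; have [Zx pZx] := hZ x Sx; have [tau et] := set_embeddings st Sx.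
have hJ := fiber_character_ofP mu_haar QR smM adM dp Sx tau pZx.
exists (fiber_character_of mu p Zx); split=> // Jx' hJ' f hf.
exact: fiber_character_unique Sx hJ hJ' hf.
Qed.

Section Meromorphy.
Variable ZM : M -> M' -> total_frac R.
Hypothesis hZM : forall x, Sigma x -> exists2 Zx, @fiber_period _ _ _ _ _ _ _ _ Z _ _ M M' p x Zx &
  forall v v', has_value (ZM v v') (Zx (fiber_elt x v) (fiber_elt x v')).
Variable f : GF -> E.
Hypothesis hf : hecke_fun f.
Hypothesis lc : locally_constant_fiber_dim Sigma M.

Definition specialize (x : closed_point R) : GF -> residue_field x := fun g => residue x ((f g)%:A).

Lemma specialize_hecke x : hecke_fun (specialize x).
Proof. exact: (hecke_fun_ext (residue x \o in_alg R) hf). Qed.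

(** The action of [f] on [K]-invariant vectors, before specialization; [s] represents
    the cosets [a K] in the support. *)
Definition hecke_operator (K : set GF) (s : seq GF) (v : M) : M :=
  \sum_(a <- s) ((ratr (vol mu K) * f a)%:A : R) *: gm_act a v.

Lemma hecke_operator_fiber K s v x : Sigma x -> ocs K -> bi_invariant_fun K f ->
  coset_free K s -> coset_cover K [set g | f g != 0] s -> v \in fixed M K ->
  hecke_act mu (specialize x) (fiber_elt x v) = fiber_elt x (hecke_operator K s v).
Proof.
move=> Sx oK fK sep cov vK; have [tau _] := set_embeddings st Sx.
have rK : right_invariant K (specialize x).
  by move=> g k Kk; rewrite /specialize (right_of_bi_invariant oK fK).
rewrite (hecke_actE ssG mu_haar tau oK rK _ sep) //; first last.
- move=> g /= fg; apply: cov => /=; apply: contra fg => /eqP fg0.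
  by rewrite /specialize fg0 scale0r rmorph0.
- exact: fixed_tens_pure.
rewrite /hecke_operator /fiber_elt tens_pure_sum; apply: eq_bigr => a _.
rewrite tens_pure_scale scalerA (gm_ext_act (residue x)); congr (_ *: _).
symmetry; transitivity (residue x ((ratr (vol mu K))%:A) * residue x ((f a)%:A)).
  by rewrite -rmorphM /= -scalerAl mul1r scalerA.
by congr (_ * _); exact: (fmorph_rat (residue x \o in_alg R)).
Qed.

Lemma common_denominator (I : finType) (q : I -> total_frac R) x :
  (forall i, exists c, has_value (x := x) (q i) c) ->
  exists B (A : I -> R), ~~ x B /\ forall i, to_frac B * q i = to_frac (A i).
Proof.
move=> h; have /choice[ab hab] : forall i, exists ab : R * R,
    ~~ x ab.2 /\ to_frac ab.2 * q i = to_frac ab.1.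
  by move=> i; have [c [a [b [xb e _]]]] := h i; exists (a, b).
exists (\prod_i (ab i).2), (fun i => (ab i).1 * \prod_(j | j != i) (ab j).2); split.
  have : residue x (\prod_i (ab i).2) != 0.
    rewrite rmorph_prod; apply/prodf_neq0 => i _.
    by apply: residue_neq0; case: (hab i).
  by rewrite residue_eq0.
move=> i; rewrite (bigD1 i) //= !rmorphM /=; have [_ <-] := hab i.
by rewrite mulrAC.
Qed.

(** Let [l] be dual at [x] to a local basis of the [K]-invariants of [M]. Near [x] the
    Gram matrix [P] stays invertible, so the dual bases at all nearby points of [Sigma]
    come from the adjugate of [P] divided by its determinant, and the character is
    [\sum_(i, k) adj P k i Z(f m_i, l_k) / det P]. *)
Lemma character_locally_regular x : Sigma x -> exists b a, ~~ x b /\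
  forall y, Sigma y -> ~~ y b -> forall Zy, @fiber_period _ _ _ _ _ _ _ _ Z _ _ M M' p y Zy ->
    (forall v v', has_value (ZM v v') (Zy (fiber_elt y v) (fiber_elt y v'))) ->
    residue y a = residue y b * fiber_character_of mu p Zy (specialize y).
Proof.
move=> Sx; have [K0 oK0 _] := smM 0.
have [K [oK _ fK]] := hecke_bi_invariant ssG oK0 hf.
have [s [sep cov]] := hecke_cover ssG oK hf.
have [d [lb]] := local_basis_ex QR noethR redR smM adM dense lc oK Sx.
have ndx := dual_nondegenerate dp Sx.
have [l [lK ldual]] := dual_vectors_ex QR smM' adM' bp ip oK lb (proj1 ndx).
pose P : 'M[R]_d := \matrix_(i, j) p (lb_vec lb i) (l j).
have PE i j : P i j = p (lb_vec lb i) (l j) by rewrite mxE.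
have dP : residue x (\det P) = 1.
  rewrite -det_map_mx -[RHS](det1 _ d); congr (\det _).
  by apply/matrixP => i j; rewrite !mxE /= ldual.
have xdP : ~~ x (\det P).
  by apply/negP => /residue_eq0P e; move: dP; rewrite e => /eqP; rewrite eq_sym oner_eq0.
pose T i := hecke_operator K s (lb_vec lb i).
have [Zx _ vZx] := hZM Sx.
have [B [A [xB hA]]] : exists B (A : 'I_d * 'I_d -> R), ~~ x B /\
    forall ik, to_frac B * ZM (T ik.1) (l ik.2) = to_frac (A ik).
  by apply: (common_denominator (x := x)) => ik; eexists; exact: vZx.
pose b0 := lb_den lb * lb_unit lb.
exists (b0 * \det P * B), (b0 * \sum_i \sum_k \adj P k i * A (i, k)); split.
  by do !apply: point_mulP => //; [exact: lb_den_x|exact: lb_unit_x].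
move=> y Sy yb Zy pZy vZy; have [tau _] := set_embeddings st Sy.
have nb : residue y (lb_den lb) * residue y (lb_unit lb) * residue y (\det P) * residue y B != 0.
  by rewrite -!rmorphM; exact: residue_neq0.
move: (nb); rewrite !mulf_eq0 !negb_or => /andP[/andP[/andP[yc yu] yP] yB].
pose py := @fiber_pairing _ _ _ _ _ _ _ M M' p y.
have bpy : bilinear_map idfun py by exact: tens_pairing_bilinear.
have ipy : invariant_pairing py by exact: invariant_pairing_ext.
have ndy : Defs.nondegenerate py := dual_nondegenerate dp Sy.
have [bZ _ _] := pZy.
pose Q : 'M[residue_field y]_d := (residue y (\det P))^-1 *: map_mx (residue y) (\adj P).
have QE k i : Q k i = residue y (\adj P k i) / residue y (\det P).
  by rewrite mxE [X in _ * X]mxE mulrC.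
have gram i j : py (fiber_elt y (lb_vec lb i)) (fiber_elt y (l j)) = map_mx (residue y) P i j.
  by rewrite [RHS]mxE PE /py fiber_pairingE.
have PQ : map_mx (residue y) P *m Q = 1%:M.
  by rewrite -scalemxAr -map_mxM mul_mx_adj map_scalar_mx scale_scalar_mx mulVf.
have be := level_bases_of_gram ssG tau (fiber_smooth smM) bpy ipy ndy oK
  (fun i => fixed_tens_pure _ _ (lb_vecK lb i)) (fun k => fixed_tens_pure _ _ (lK k))
  (fun v vK => local_basis_span QR smM oK (mulVf yc) vK) gram PQ.
have fyK : bi_invariant_fun K (specialize y).
  by move=> k k' g Kk Kk'; rewrite /specialize fK.
rewrite (fiber_character_ofE mu_haar QR smM adM dp Sy tau pZy (specialize_hecke y) oK fyK be).
rewrite /character_sum rmorphM rmorph_sum /= !rmorphM /= -!mulrA; congr (_ * (_ * _)).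
rewrite !mulr_sumr; apply: eq_bigr => i _.
rewrite (hecke_operator_fiber Sy oK fK sep cov (lb_vecK lb i)) -/(T i).
rewrite (bil_sumr bZ) rmorph_sum !mulr_sumr; apply: eq_bigr => k _.
rewrite (bilZr bZ) /= QE rmorphM /= (has_value_den (vZy (T i) (l k)) (hA (i, k))).
exact: cancel_denominator.
Qed.

Lemma meromorphy_at :
  exists q, interpolates_character Z mu Sigma M f q /\
    forall q', interpolates_character Z mu Sigma M f q' -> q' = q.
Proof.
have good y : exists c : residue_field y, Sigma y -> exists Zy,
    [/\ @fiber_period _ _ _ _ _ _ _ _ Z _ _ M M' p y Zy,
        forall v v', has_value (ZM v v') (Zy (fiber_elt y v) (fiber_elt y v')) &
        c = fiber_character_of mu p Zy (specialize y)].
  have [Sy|nSy] := pselect (Sigma y); last by exists 0.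
  by have [Zy pZy vZy] := hZM Sy; exists (fiber_character_of mu p Zy (specialize y)) => _; exists Zy.
pose J y := sval (cid (good y)).
have hJ y : Sigma y -> exists Zy, [/\ @fiber_period _ _ _ _ _ _ _ _ Z _ _ M M' p y Zy,
    forall v v', has_value (ZM v v') (Zy (fiber_elt y v) (fiber_elt y v')) &
    J y = fiber_character_of mu p Zy (specialize y)] by exact: (svalP (cid (good y))).
have charJ y : Sigma y -> exists2 Jy, @fiber_character _ _ _ _ _ _ _ _ Z mu _ _ M y Jy &
    J y = Jy (specialize y).
  move=> Sy; have [Zy [pZy _ ->]] := hJ y Sy; have [tau _] := set_embeddings st Sy.
  exists (fiber_character_of mu p Zy) => //.
  exact: (fiber_character_ofP mu_haar QR smM adM dp Sy tau pZy).
have [|q hq] := glue_values (J := J) noethR redR dense.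
  move=> x Sx; have [b [a [xb h]]] := character_locally_regular Sx.
  exists b, a; split=> // y Sy yb; have [Zy [pZy vZy ->]] := hJ y Sy.
  exact: h.
exists q; split=> [x Sx|q' hq'].
  by have [Jx cJx e] := charJ x Sx; exists Jx => //; have := hq x Sx; rewrite e.
apply: (has_value_unique noethR redR dense (J := J)) => // x Sx.
have [Jx' cJx' vJx'] := hq' x Sx; have [Jx cJx ->] := charJ x Sx.
by rewrite (fiber_character_unique Sx cJx' cJx (specialize_hecke x)).
Qed.

End Meromorphy.
End WithDual.
End Characters.

Lemma rational_algebra_of_embedding (E : fieldType) (C : numFieldType) (R : comAlgType E) :
  {rmorphism E -> C} -> rational_algebra R.
Proof. by move=> tau; exact: (rational_algebra_ext (in_alg R) (rational_field tau)). Qed.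

(** The ideal of a closed point is zero. *)
Lemma field_point_unique (E : fieldType) (x y : closed_point (E^o : comAlgType E)) : x = y.
Proof.
have val0 (z : closed_point (E^o : comAlgType E)) (a : E) : z a = (a == 0).
  apply/idP/eqP => [za|->]; last by apply/residue_eq0P; exact: rmorph0.
  apply/eqP; apply: contrapT => /negP a0.
  have /residue_eq0P e := za.
  have : residue z ((a^-1 : E^o) * a) = 0 by rewrite rmorphM /= e mulr0.
  by rewrite mulVf // rmorph1 => /eqP; rewrite oner_eq0.
have e : pp_ideal x = pp_ideal y by apply/funext => a; rewrite !val0.
case: x y e => [[I hI pI] mI] [[J hJ pJ] mJ] /= e; subst J.
rewrite (Prop_irrelevance hI hJ) (Prop_irrelevance pI pJ) in mI mJ *.
by rewrite (Prop_irrelevance mI mJ).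
Qed.

Theorem proposition1p3
  (F : padicField)
  (Fbar : closedFieldType) (iota : {rmorphism F -> Fbar})
  (Fbar_algebraic : forall a : Fbar, algebraicOver iota a)
  (n : nat) (G H : algGroup iota n)
  (H_sub_G : ag_pts H `<=` ag_pts G)
  (G_reductive : reductive (ag_pts G)) (H_reductive : reductive (ag_pts H))
  (Y_spherical : spherical (ag_pts H) (ag_pts G))
  (RT : realType)
  (mu : {measure set (borel_type (points G)) -> \bar RT})
  (mu_haar : rational_haar mu)
  (D : plancherel G H RT) (Z : local_periods D)
  (E : fieldType) (E_embeds : inhabited {rmorphism E -> complex RT}) :
  (forall (Sigma : set (closed_point (E^o : comAlgType E)))
      (M : gmodule (points G) (E^o : comAlgType E)),
    setting D Sigma M ->
    rationality_of_periods Z Sigma M ->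
    rationality_of_characters Z mu Sigma M)
  /\
  (forall (R : comAlgType E) (Sigma : set (closed_point R))
      (M : gmodule (points G) R),
    setting D Sigma M ->
    locally_constant_fiber_dim Sigma M ->
    meromorphy_of_periods Z Sigma M ->
    meromorphy_of_characters Z mu Sigma M).
Proof.
have [tau] := E_embeds; split=> [Sigma M st rat|R Sigma M st lc mer].
  have QR : rational_algebra (E^o : comAlgType E) := rational_algebra_of_embedding _ tau.
  have lc : locally_constant_fiber_dim Sigma M.
    move=> K oK x Sx; exists 1.
      by apply/negP => /residue_eq0P /eqP; rewrite rmorph1 oner_eq0.
    by move=> y _ _; rewrite (field_point_unique y x).
  have [M' [p dp]] := dual_datum_ex QR st lc.
  apply: (characters_of_periods mu_haar QR st dp) => x Sx.
  by have [Zx [hZx _]] := rat M' p dp x Sx; exists Zx.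
have QR : rational_algebra R := rational_algebra_of_embedding _ tau.
have [M' [p dp]] := dual_datum_ex QR st lc.
have [A [ZM [_ _ _ _ hZM]]] := mer M' p dp.
by move=> f hf; exact: (meromorphy_at mu_haar QR st dp hZM hf lc).
Qed.
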